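(* Let $n\ge1$ and let $G$ be a group $n$-acting on a geometry $P$, the action being $\omega$-homogeneous with respect to a group $\Sigma$ of automorphisms of the action. Assume that $G$ admits hereditarily unique generics with respect to $\Sigma$. Then either there is an unbounded non-classical $A$-invariant subgroup of $G$ (for some finite $A\subseteq P$), or $n\in\{1,2,3\}$ and: (1) if $n=1$, then $G$ is abelian and acts regularly on $P$; (2) if $n=2$, then $P$ can be given the $A$-invariant structure of an algebraically closed field $K$ (for some finite $A\subseteq P$), and the action of $G$ on $P$ is isomorphic to the affine action of $K^*\ltimes K^+$ on $K$; (3) if $n=3$, then $P\setminus\{\infty\}$ can be given the $A$-invariant structure of an algebraically closed field $K$ (for some $\infty\in P$ and some finite $A\subseteq P$), and the action of $G$ on $P$ is isomorphic to the action of $\mathrm{PGL}_2(K)$ on the projective line $\mathbb{P}^1(K)$.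
   Context: **Group actions on pregeometries.** $(P,\mathrm{cl})$ is a pregeometry with $\mathrm{cl}(\emptyset)=\emptyset$, infinite-dimensional with $\dim(P)=|P|$; it is a geometry if moreover $\mathrm{cl}(a)=\{a\}$ for all $a\in P$. Bounded means of size less than $|P|$. A group $G$ acts on $P$ respecting the pregeometry: $a\in\mathrm{cl}(X)$ iff $ga\in\mathrm{cl}(g(X))$. The action is an $n$-action (''$G$ $n$-acts on $P$'') if it - has rank $n$: whenever $\bar x,\bar y$ are $n$-tuples of $P$ with $\dim(\bar x\bar y)=2n$ there is $g\in G$ with $g\bar x=\bar y$, but for some $(n+1)$-tuples $\bar x,\bar y$ with $\dim(\bar x\bar y)=2n+2$ there is no $g\in G$ with $g\bar x=\bar y$; and - is $(n+1)$-determined: if $g,h\in G$ agree on an $(n+1)$-dimensional subset of $P$ then $g=h$. An automorphism $\sigma$ of the action is a pair consisting of an automorphism of the group $G$ and an automorphism of $(P,\mathrm{cl})$, both denoted $\sigma$, with $\sigma(gx)=\sigma(g)\sigma(x)$. For a group $\Sigma$ of such automorphisms, the action is $\omega$-homogeneous with respect to $\Sigma$ if whenever $X\subseteq P$ is finite and $x,y\in P\setminus\mathrm{cl}(X)$ there is $\sigma\in\Sigma$ fixing $X$ pointwise with $\sigma(x)=y$. $\Sigma_A$ is the group of $\sigma\in\Sigma$ fixing $A$ pointwise; a set (or structure) is $A$-invariant if it is fixed setwise by all $\sigma\in\Sigma_A$. **Generics.** For $X\subseteq P$, $\mathrm{tp}(g/X)$ is the orbit of $g\in G$ under $\Sigma_X$.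 $g\in G$ is generic over $X$ if there is an independent $n$-tuple $\bar x$ of $P$ with $\dim(\bar x g(\bar x)/X)=2n$. $G$ has unique generics if for all finite $X\subseteq P$ and all $g,h\in G$ generic over $X$, $\mathrm{tp}(g/X)=\mathrm{tp}(h/X)$. For an independent $k$-set $A\subseteq P$, $k<n$: $G_A$ is the pointwise stabiliser of $A$, and $P_A$ is the pregeometry on $P\setminus\mathrm{cl}(A)$ with $\mathrm{cl}_A(X)=\mathrm{cl}(A\cup X)\setminus\mathrm{cl}(A)$; $G_A$ has an $(n-k)$-action on $P_A$, homogeneous with respect to $\Sigma_A$. $G$ admits hereditarily unique generics if $G$ has unique generics and for any independent $k$-set $A\subseteq P$ with $k<n$ there is a normal subgroup $G'$ of $G_A$ such that the action of $G'$ on $P_A$ is a homogeneous $(n-k)$-action (with respect to the automorphisms induced by $\Sigma_A$) which has unique generics. **Non-classical groups.** An infinite structure $M$ carries an $\omega$-homogeneous pregeometry if there is a closure operator $\mathrm{cl}:\mathcal{P}(M)\to\mathcal{P}(M)$, invariant under automorphisms of $M$, satisfying the axioms of a pregeometry, with $\dim(M)=\|M\|$, such that whenever $X\subseteq M$ is finite and $a,b\notin\mathrm{cl}(X)$ there is an automorphism of $M$ preserving $\mathrm{cl}$, fixing $X$ pointwise and sending $a$ to $b$. A group is non-classical if it is nonabelian and carries (as a structure, the group operation possibly together with additional structure) an $\omega$-homogeneous pregeometry. An action is regular if it is sharply transitive. *)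

(* Defs.v *)
From HB Require Import structures.
From mathcomp Require Import all_boot all_algebra.
From mathcomp Require Import boolp classical_sets functions cardinality.

Set Implicit Arguments.
Unset Strict Implicit.
Unset Printing Implicit Defensive.

Local Open Scope classical_set_scope.
Local Open Scope card_scope.

(* Groups and pregeometries are given by carrier sets [H : set G] and
   [D : set P] inside ambient types, so that the same definitions serve for [G]
   acting on [P], for subgroups of [G], and for the localisations [P_A]. Values
   of closure operators outside subsets of the carrier are irrelevant. *)
Section Pregeometry.
Context {P : Type}.
Implicit Types (D X Y B : set P) (cl : set P -> set P).

Record pregeometry D cl : Prop := {
  cl_carrier : forall X, X `<=` D -> cl X `<=` D;
  cl_extensive : forall X, X `<=` D -> X `<=` cl X;
  cl_monotone : forall X Y, X `<=` Y -> Y `<=` D -> cl X `<=` cl Y;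
  cl_idempotent : forall X, X `<=` D -> cl (cl X) = cl X;
  cl_finite_character : forall X a, X `<=` D -> cl X a ->
    exists Y, [/\ finite_set Y, Y `<=` X & cl Y a];
  cl_exchange : forall X a b, X `<=` D -> D a -> D b ->
    cl (X `|` [set b]) a -> ~ cl X a -> cl (X `|` [set a]) b
}.

Definition independent_over cl X B :=
  forall b, B b -> ~ cl (X `|` (B `\ b)) b.

Definition independent cl B := independent_over cl set0 B.

Definition basis_over cl X Y B :=
  [/\ B `<=` Y, independent_over cl X B & Y `<=` cl (X `|` B)].

(* dim (Y / X) = |S| *)
Definition dim_over cl X Y {U : Type} (S : set U) :=
  exists B, basis_over cl X Y B /\ B #= S.

Definition dim cl Y {U : Type} (S : set U) := dim_over cl set0 Y S.

Definition infinite_pregeometry D cl :=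
  [/\ pregeometry D cl,
      cl set0 = set0,
      forall k, ~ dim cl D `I_k
    & dim cl D D].

Definition geometry D cl :=
  infinite_pregeometry D cl /\ forall a, D a -> cl [set a] = [set a].

Definition localize cl A X : set P := cl (A `|` X) `\` cl A.

Definition bounded {T : Type} D (X : set T) := (X #<= D) && (X #!= D).

Definition fixes D (f : P -> P) := forall a, D a -> f a = a.

Definition cl_automorphism D cl (f : P -> P) :=
  set_bij D D f /\ forall X, X `<=` D -> f @` cl X = cl (f @` X).

End Pregeometry.

Section Subgroups.
Context {G : groupType}.
Implicit Types H N : set G.

Definition subgroup H := group_closed (mem H).

Definition normal_subgroup N H :=
  [/\ subgroup N, N `<=` H & forall g h, H g -> N h -> N (h ^ g)%g].

Definition abelian_set H := forall g h, H g -> H h -> (g * h = h * g)%g.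

Definition group_automorphism H (f : G -> G) :=
  set_bij H H f /\ forall g h, H g -> H h -> (f (g * h) = f g * f h)%g.

End Subgroups.

Section Actions.
Context {G : groupType} {P : Type}.
Variable act : G -> P -> P.
Implicit Types (H : set G) (D X A : set P) (cl : set P -> set P).
Implicit Types (Sigma : set ((G -> G) * (P -> P))) (n : nat).

Record pregeometric_action H D cl : Prop := {
  pact_subgroup : subgroup H;
  pact_pregeometry : infinite_pregeometry D cl;
  pact_carrier : forall g x, H g -> D x -> D (act g x);
  pact_one : forall x, D x -> act 1%g x = x;
  pact_mul : forall g h x, H g -> H h -> D x ->
    act (g * h)%g x = act g (act h x);
  pact_cl : forall g a X, H g -> D a -> X `<=` D ->
    cl X a <-> cl (act g @` X) (act g a)
}.

Definition moves H n (x y : 'I_n -> P) :=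
  exists g, H g /\ forall i, act g (x i) = y i.

Definition has_rank H D cl n :=
  (forall x y : 'I_n -> P, range x `<=` D -> range y `<=` D ->
     dim cl (range x `|` range y) `I_(2 * n) -> moves H x y) /\
  (exists x y : 'I_n.+1 -> P, [/\ range x `<=` D, range y `<=` D,
     dim cl (range x `|` range y) `I_(2 * n + 2) & ~ moves H x y]).

Definition determined H D cl m :=
  forall g h X, H g -> H h -> X `<=` D -> dim cl X `I_m ->
    (forall x, X x -> act g x = act h x) -> g = h.

Definition n_action H D cl n :=
  [/\ pregeometric_action H D cl, has_rank H D cl n & determined H D cl n.+1].

(* An automorphism of the action is the pair of its components on [G] and [P]. *)
Record action_automorphism H D cl (s : (G -> G) * (P -> P)) : Prop := {
  aaut_group : group_automorphism H s.1;
  aaut_pregeometry : cl_automorphism D cl s.2;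
  aaut_act : forall g x, H g -> D x -> s.2 (act g x) = act (s.1 g) (s.2 x)
}.

Record automorphism_group H D cl Sigma : Prop := {
  agroup_aut : forall s, Sigma s -> action_automorphism H D cl s;
  agroup_one : Sigma (idfun, idfun);
  agroup_mul : forall s t, Sigma s -> Sigma t ->
    Sigma (s.1 \o t.1, s.2 \o t.2);
  agroup_inv : forall s, Sigma s -> exists t,
    [/\ Sigma t, cancel s.1 t.1, cancel t.1 s.1,
        cancel s.2 t.2 & cancel t.2 s.2]
}.

Definition fixer Sigma A := [set s | Sigma s /\ fixes A s.2].

(* For a localisation this asks that the elements of [Sigma] restrict to
   automorphisms of the action of [H] on [D]; in particular that they leave the
   subgroup [H] invariant. *)
Definition homogeneous H D cl Sigma :=
  automorphism_group H D cl Sigma /\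
  forall X x y, finite_set X -> X `<=` D ->
    (D `\` cl X) x -> (D `\` cl X) y ->
    exists s, fixer Sigma X s /\ s.2 x = y.

Definition tp Sigma X (g : G) := [set s.1 g | s in fixer Sigma X].

Definition generic D cl n X (g : G) :=
  exists x : 'I_n -> P, [/\ range x `<=` D, injective x,
    independent cl (range x) &
    dim_over cl X (range x `|` range (act g \o x)) `I_(2 * n)].

Definition unique_generics H D cl Sigma n :=
  forall X g h, finite_set X -> X `<=` D -> H g -> H h ->
    generic D cl n X g -> generic D cl n X h -> tp Sigma X g = tp Sigma X h.

Definition stabilizer A := [set g : G | fixes A (act g)].

Definition hereditarily_unique_generics cl Sigma n :=
  unique_generics [set: G] [set: P] cl Sigma n /\
  forall k A, (k < n)%N -> independent cl A -> A #= `I_k ->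
    exists N : set G,
      [/\ normal_subgroup N (stabilizer A),
          n_action N (~` cl A) (localize cl A) (n - k),
          homogeneous N (~` cl A) (localize cl A) (fixer Sigma A)
        & unique_generics N (~` cl A) (localize cl A) (fixer Sigma A) (n - k)].

Definition invariant_subgroup Sigma A H :=
  forall s, fixer Sigma A s -> s.1 @` H = H.

Definition regular := forall x y, exists! g, act g x = y.

End Actions.

(* [Aut] is the automorphism group of an infinite structure with universe [M]. *)
Definition carries_homogeneous_pregeometry {T : Type} (M : set T)
    (Aut : set (T -> T)) :=
  infinite_set M /\
  exists cl : set T -> set T,
    [/\ pregeometry M cl,
        forall f, Aut f -> cl_automorphism M cl f,
        dim cl M M
      & forall X a b, finite_set X -> X `<=` M ->
          (M `\` cl X) a -> (M `\` cl X) b ->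
          exists f, [/\ Aut f, fixes X f & f a = b]].

(* Automorphisms of the expansion of the group [H] by the finitary relations
   [R i]; functions and constants are coded by their graphs. *)
Definition expansion_automorphism {G : groupType} (H : set G) (I : Type)
    (ar : I -> nat) (R : forall i, set ('I_(ar i) -> G)) (f : G -> G) :=
  group_automorphism H f /\
  forall i (x : 'I_(ar i) -> G), range x `<=` H -> R i x <-> R i (f \o x).

Definition non_classical {G : groupType} (H : set G) :=
  ~ abelian_set H /\
  exists (I : Type) (ar : I -> nat) (R : forall i, set ('I_(ar i) -> G)),
    carries_homogeneous_pregeometry H [set f | expansion_automorphism H R f].

Section FieldStructure.
Context {G : groupType} {P : Type} {K : fieldType}.
Implicit Types (f : K -> P) (D A : set P).

Definition add_graph f : set (P * P * P) :=
  range (fun u : K * K => (f u.1, f u.2, f (u.1 + u.2)%R)).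

Definition mul_graph f : set (P * P * P) :=
  range (fun u : K * K => (f u.1, f u.2, f (u.1 * u.2)%R)).

(* The bijection [f] from [K] onto [D] transports the field structure to [D]. *)
Definition invariant_field_structure (Sigma : set ((G -> G) * (P -> P)))
    A D f :=
  set_bij [set: K] D f /\
  forall s, fixer Sigma A s ->
    let s3 := fun t : P * P * P => (s.2 t.1.1, s.2 t.1.2, s.2 t.2) in
    [/\ s.2 @` D = D,
        s3 @` add_graph f = add_graph f
      & s3 @` mul_graph f = mul_graph f].

End FieldStructure.

Definition action_isomorphism {G1 G2 : groupType} {X1 X2 : Type}
    (act1 : G1 -> X1 -> X1) (act2 : G2 -> X2 -> X2)
    (phi : G1 -> G2) (theta : X1 -> X2) :=
  [/\ bijective phi, {morph phi : g h / (g * h)%g}, bijective theta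
    & forall g x, theta (act1 g x) = act2 (phi g) (theta x)].

Section AffineGroup.
Variable K : fieldType.
Local Open Scope ring_scope.
Import GRing.Theory.

(* The semidirect product of the multiplicative group of [K] acting on the
   additive group of [K]; (a, b) acts on [K] as the map x |-> a x + b. *)
Record affine_group := AffineGroup {
  affine_val :> K * K;
  affine_valP : affine_val.1 != 0
}.

HB.instance Definition _ := [isSub for affine_val].
HB.instance Definition _ := [Choice of affine_group by <:].

Fact affine_one_subproof : ((1, 0) : K * K).1 != 0.
Proof. exact: oner_neq0. Qed.
Definition affine_one := AffineGroup affine_one_subproof.

Fact affine_mul_subproof (u v : affine_group) :
  (u.1 * v.1, u.2 + u.1 * v.2).1 != 0.
Proof. exact: mulf_neq0 (affine_valP u) (affine_valP v). Qed.
Definition affine_mul u v := AffineGroup (affine_mul_subproof u v).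

Fact affine_inv_subproof (u : affine_group) :
  (u.1^-1, - (u.1^-1 * u.2)).1 != 0.
Proof. by rewrite /= invr_neq0 ?affine_valP. Qed.
Definition affine_inv u := AffineGroup (affine_inv_subproof u).

Fact affine_mulA : associative affine_mul.
Proof.
by move=> u v w; apply: val_inj; rewrite /= !mulrA mulrDr !mulrA addrA.
Qed.
Fact affine_mul1g : left_id affine_one affine_mul.
Proof. by move=> [[a b] ?]; apply: val_inj; rewrite /= !mul1r add0r. Qed.
Fact affine_mulg1 : right_id affine_one affine_mul.
Proof. by move=> [[a b] ?]; apply: val_inj; rewrite /= mulr1 mulr0 addr0. Qed.
Fact affine_mulVg : left_inverse affine_one affine_inv affine_mul.
Proof.
by move=> [[a b] a0]; apply: val_inj; rewrite /= mulVf // addNr.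
Qed.
Fact affine_mulgV : right_inverse affine_one affine_inv affine_mul.
Proof.
by move=> [[a b] a0]; apply: val_inj; rewrite /= mulrN mulrA mulfV // mul1r addrN.
Qed.

HB.instance Definition _ := isGroup.Build affine_group affine_mulA affine_mul1g
  affine_mulg1 affine_mulVg affine_mulgV.

Definition affine_act (u : affine_group) (x : K) := u.1 * x + u.2.

End AffineGroup.

Section ProjectiveLinearGroup.
Variable K : fieldType.
Local Open Scope ring_scope.
Local Open Scope quotient_scope.
Import GRing.Theory.

Record GL2 := MkGL2 { GL2_val :> 'M[K]_2; GL2_valP : GL2_val \in unitmx }.

HB.instance Definition _ := [isSub for GL2_val].
HB.instance Definition _ := [Choice of GL2 by <:].

Definition GL2_one := MkGL2 (unitmx1 K 2).

Fact GL2_mul_subproof (M N : GL2) : M *m N \in unitmx.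
Proof. by rewrite unitmx_mul !GL2_valP. Qed.
Definition GL2_mul M N := MkGL2 (GL2_mul_subproof M N).

Fact GL2_inv_subproof (M : GL2) : invmx M \in unitmx.
Proof. by rewrite unitmx_inv GL2_valP. Qed.
Definition GL2_inv M := MkGL2 (GL2_inv_subproof M).

Fact GL2_mulA : associative GL2_mul.
Proof. by move=> M N L; apply: val_inj; rewrite /= mulmxA. Qed.
Fact GL2_mul1g : left_id GL2_one GL2_mul.
Proof. by move=> M; apply: val_inj; rewrite /= mul1mx. Qed.
Fact GL2_mulg1 : right_id GL2_one GL2_mul.
Proof. by move=> M; apply: val_inj; rewrite /= mulmx1. Qed.
Fact GL2_mulVg : left_inverse GL2_one GL2_inv GL2_mul.
Proof. by move=> [M Mu]; apply: val_inj; rewrite /= mulVmx. Qed.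
Fact GL2_mulgV : right_inverse GL2_one GL2_inv GL2_mul.
Proof. by move=> [M Mu]; apply: val_inj; rewrite /= mulmxV. Qed.

HB.instance Definition _ := isGroup.Build GL2 GL2_mulA GL2_mul1g GL2_mulg1
  GL2_mulVg GL2_mulgV.

Definition proportional {V : lmodType K} (u v : V) :=
  `[< exists c : K, c != 0 /\ u = c *: v >].

Lemma proportional_refl (V : lmodType K) : reflexive (@proportional V).
Proof. by move=> u; apply/asboolP; exists 1; rewrite oner_neq0 scale1r. Qed.

Lemma proportional_sym (V : lmodType K) : symmetric (@proportional V).
Proof.
move=> u v; apply/asboolP/asboolP => -[c [c0 ->]]; exists c^-1;
  by rewrite invr_neq0 // scalerA mulVf // scale1r.
Qed.

Lemma proportional_trans (V : lmodType K) : transitive (@proportional V).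
Proof.
move=> v u w /asboolP[c [c0 ->]] /asboolP[d [d0 ->]].
by apply/asboolP; exists (c * d); rewrite mulf_neq0 // scalerA.
Qed.

Definition GL2_prop (M N : GL2) := proportional (val M) (val N).

Canonical GL2_prop_equiv := EquivRel GL2_prop
  (fun M => proportional_refl (val M))
  (fun M N => proportional_sym (val M) (val N))
  (fun N M L => @proportional_trans _ (val N) (val M) (val L)).

Definition PGL2 := {eq_quot GL2_prop}.

HB.instance Definition _ := Choice.on PGL2.

Lemma PGL2_eqP (M N : GL2) :
  reflect (exists c : K, c != 0 /\ val M = c *: val N)
          (\pi_PGL2 M == \pi_PGL2 N).
Proof. by rewrite eqmodE; apply: asboolP. Qed.

Definition PGL2_one : PGL2 := \pi_PGL2 1%g.
Definition PGL2_mul (p q : PGL2) : PGL2 := \pi_PGL2 (repr p * repr q)%g.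
Definition PGL2_inv (p : PGL2) : PGL2 := \pi_PGL2 (repr p)^-1%g.

Lemma PGL2_reprP (M : GL2) :
  exists c : K, c != 0 /\ val (repr (\pi_PGL2 M)) = c *: val M.
Proof. by apply/PGL2_eqP; rewrite reprK. Qed.

Lemma PGL2_mulE (M N : GL2) :
  PGL2_mul (\pi_PGL2 M) (\pi_PGL2 N) = \pi_PGL2 (M * N)%g.
Proof.
have [[c [c0 cE]] [d [d0 dE]]] := (PGL2_reprP M, PGL2_reprP N).
apply/eqP/PGL2_eqP; exists (c * d); split; first exact: mulf_neq0.
by rewrite /= cE dE -scalemxAl -scalemxAr scalerA.
Qed.

Lemma PGL2_invE (M : GL2) : PGL2_inv (\pi_PGL2 M) = \pi_PGL2 (M^-1)%g.
Proof.
have [c [c0 cE]] := PGL2_reprP M.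
apply/eqP/PGL2_eqP; exists c^-1; split; first by rewrite invr_neq0.
by rewrite /= cE invmxZ // -cE; apply: GL2_valP.
Qed.

Fact PGL2_mulA : associative PGL2_mul.
Proof.
elim/quotW=> M; elim/quotW=> N; elim/quotW=> L.
rewrite (PGL2_mulE N L) (PGL2_mulE M (N * L)%g).
by rewrite (PGL2_mulE M N) (PGL2_mulE (M * N)%g L) mulgA.
Qed.
Fact PGL2_mul1g : left_id PGL2_one PGL2_mul.
Proof. by elim/quotW=> M; rewrite (PGL2_mulE 1%g M) mul1g. Qed.
Fact PGL2_mulg1 : right_id PGL2_one PGL2_mul.
Proof. by elim/quotW=> M; rewrite (PGL2_mulE M 1%g) mulg1. Qed.
Fact PGL2_mulVg : left_inverse PGL2_one PGL2_inv PGL2_mul.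
Proof.
by elim/quotW=> M; rewrite (PGL2_invE M) (PGL2_mulE M^-1%g M) mulVg.
Qed.
Fact PGL2_mulgV : right_inverse PGL2_one PGL2_inv PGL2_mul.
Proof.
by elim/quotW=> M; rewrite (PGL2_invE M) (PGL2_mulE M M^-1%g) mulgV.
Qed.

HB.instance Definition _ := isGroup.Build PGL2 PGL2_mulA PGL2_mul1g PGL2_mulg1
  PGL2_mulVg PGL2_mulgV.

Record nonzero_vector := NonzeroVector {
  vector_val :> 'cV[K]_2;
  vector_valP : vector_val != 0
}.

HB.instance Definition _ := [isSub for vector_val].
HB.instance Definition _ := [Choice of nonzero_vector by <:].

Definition vector_prop (u v : nonzero_vector) := proportional (val u) (val v).

Canonical vector_prop_equiv := EquivRel vector_prop
  (fun u => proportional_refl (val u))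
  (fun u v => proportional_sym (val u) (val v))
  (fun v u w => @proportional_trans _ (val v) (val u) (val w)).

Definition projective_line := {eq_quot vector_prop}.

Fact GL2_act_subproof (M : GL2) (v : nonzero_vector) :
  M *m (v : 'cV_2) != 0.
Proof.
apply: contra_neq (vector_valP v) => Mv0.
by rewrite -[LHS](mulKmx (GL2_valP M)) Mv0 mulmx0.
Qed.
Definition GL2_act M v := NonzeroVector (GL2_act_subproof M v).

Definition PGL2_act (p : PGL2) (l : projective_line) : projective_line :=
  \pi_projective_line (GL2_act (repr p) (repr l)).

Lemma PGL2_actE (M : GL2) (v : nonzero_vector) :
  PGL2_act (\pi_PGL2 M) (\pi_projective_line v) =
  \pi_projective_line (GL2_act M v).
Proof.
have [c [c0 cE]] := PGL2_reprP M.
have /eqP := reprK (\pi_projective_line v).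
rewrite eqmodE => /asboolP[d [d0 dE]].
apply/eqP; rewrite eqmodE; apply/asboolP; exists (c * d).
split; first exact: mulf_neq0.
by rewrite /= cE dE -scalemxAl -scalemxAr scalerA.
Qed.

Fact finite_point_subproof (x : K) :
  (\col_(i < 2) if i == 0 then x else 1) != 0.
Proof.
by apply/eqP => /matrixP/(_ 1 0)/eqP; rewrite !mxE (negbTE (oner_neq0 K)).
Qed.
(* [x : 1] *)
Definition finite_point (x : K) : projective_line :=
  \pi_projective_line (NonzeroVector (finite_point_subproof x)).

Fact infinite_point_subproof :
  (\col_(i < 2) if i == 0 then 1 else 0 : K) != 0.
Proof.
by apply/eqP => /matrixP/(_ 0 0)/eqP; rewrite !mxE (negbTE (oner_neq0 K)).
Qed.
(* [1 : 0] *)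
Definition infinite_point : projective_line :=
  \pi_projective_line (NonzeroVector infinite_point_subproof).

End ProjectiveLinearGroup.

(* Main.v *)
Require Import Defs.
From mathcomp Require Import all_boot all_algebra.
From mathcomp Require Import boolp classical_sets functions cardinality.
From HB Require Import structures.
From mathcomp Require Import all_field zify ring.

(** By homogeneity a point fixed by all automorphisms over a finite set lies in
    its closure; with rank [n] and [n + 1]-determinacy this gives, for [g] in [G]
    and an independent [n]-tuple [x], that [g v] is in [cl (v, x, g x)].

    Rank one: pull the pregeometry back along [g |-> g x0]. Uniqueness of generics
    makes the result homogeneous, so the group is abelian or non-classical.

    Otherwise the normal subgroups attached to independent [(n - 1)]-sets [A] are
    abelian and regular outside [cl A]. Any generic move [x |-> y] of [n]-tuples is
    then realised by some [g] fixed by all automorphisms fixing [x] and [y]; if [f]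
    fixes [x], then [g] and [g f] are generic over [x], hence conjugate by such an
    automorphism, so [f = 1]. It follows that the stabiliser of [n - 2] independent
    points is sharply 2-transitive with abelian point stabilisers. For a generic
    ratio [b], the conjugacy class of the homothety of ratio [b] at the origin is a
    coset of a set [T] of translations which does not depend on [b]; this forces [T]
    to be a group, and gives a field [K].

    [K] is algebraically closed: a generic monic polynomial splits, and a generic
    element of a finite extension [K[X]/(p)] is a root of a monic polynomial with
    generic coefficients. Finally, an involution permuting the fixed points together
    with the origin, and fixing 1, acts as [x |-> 1 / x]. For [n = 3] this gives
    [PGL_2]; for [n > 3] some such involution is also additive, which is absurd. *)

Set Implicit Arguments.
Unset Strict Implicit.
Unset Printing Implicit Defensive.

Local Open Scope classical_set_scope.

(** Conjugation by automorphisms controls only group elements definable from the points they move.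
    Rank one supplies these: when no subgroup is non-classical, the abelian transitive group
    attached to [n - 1] points has exactly one element sending [a] to [b], which therefore commutes
    with every automorphism fixing the data.

    The obstacle to building the field is the addition, as the elements without fixed point are not
    known beforehand to form a group. The candidate for the translation by 1 is a homothety of
    generic ratio sending the origin to 1, composed with the inverse of the homothety of the same
    ratio at the origin. It has no fixed point. Homotheties sending the origin to 1 do have one, and
    every generic point is one of their parameters; so the parameter of the candidate is not
    generic, and homogeneity makes it independent of the ratio.

    A non-classical group needs a basis as large as itself. Transitivity only bounds the group from
    below; the bound from above by [P] is a separate count of fibres.

    Closures are taken over lists in a type, so that localising only restricts the type and appends
    points. *)

Ltac inmem := rewrite ?(inE, mem_cat);
  repeat (case/orP); (try move=> ->); rewrite ?orbT //.
Ltac submem := let x := fresh "x" in move=> x; inmem.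

Ltac permeq := let p := fresh "p" in
  apply/permP => p; repeat rewrite ?(map_cat, count_cat) /=; lia.

(** * Pregeometries given by closures of lists *)

Record seq_pregeometry (T : eqType) (c : seq T -> T -> Prop) : Prop := {
  sp_in : forall s a, a \in s -> c s a;
  sp_trans : forall s t b, (forall a, a \in s -> c t a) -> c s b -> c t b;
  sp_exchange : forall s a b, c (b :: s) a -> ~ c s a -> c (a :: s) b;
  sp_nil : forall a, ~ c [::] a;
  sp_infinite : forall s, exists a, ~ c s a
}.

Section SeqPregeometry.
Variables (T : eqType) (c : seq T -> T -> Prop).
Hypothesis Pc : seq_pregeometry c.
Implicit Types (s t u : seq T) (a b : T).

Lemma sp_sub s t a : {subset s <= t} -> c s a -> c t a.
Proof. by move=> st; apply: (sp_trans Pc) => b /st; apply: (sp_in Pc). Qed.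

Lemma sp_head s a : c (a :: s) a.
Proof. by apply: (sp_in Pc); rewrite inE eqxx. Qed.

(* Sequential form of independence of [t] over [s]. *)
Fixpoint ind s t : Prop :=
  if t is a :: t' then ~ c s a /\ ind (a :: s) t' else True.

Lemma sp_trans_cons s s' a b :
  (forall x, x \in s' -> c s x) -> c (a :: s') b -> c (a :: s) b.
Proof.
move=> ss'; apply: (sp_trans Pc) => x; rewrite inE => /orP[/eqP->|/ss'].
  exact: sp_head.
by apply: sp_sub => y ys; rewrite inE ys orbT.
Qed.

Lemma ind_le s s' t : (forall a, a \in s' -> c s a) -> ind s t -> ind s' t.
Proof.
elim: t s s' => //= a t IH s s' ss' [na it]; split.
  by move=> c'a; apply/na/(sp_trans Pc ss').
apply: IH it => x xs; apply: (sp_trans_cons ss').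
exact: (sp_in Pc).
Qed.

Lemma ind_sub s s' t : {subset s' <= s} -> ind s t -> ind s' t.
Proof. by move=> ss'; apply: ind_le => a /ss'; apply: (sp_in Pc). Qed.

Lemma ind_cat s t u : ind s (t ++ u) <-> ind s t /\ ind (t ++ s) u.
Proof.
elim: t s => /= [|a t IH] s; first by split=> [|[]].
rewrite IH.
split=> [[na [it iu]]|[[na it] iu]]; split=> //; try split=> //;
  by apply: ind_sub iu; submem.
Qed.

Lemma gen_swap s a b : ~ c s a -> ~ c (a :: s) b -> ~ c s b /\ ~ c (b :: s) a.
Proof.
move=> na nb; split; first by apply: contra_not nb; apply: sp_sub; submem.
by move=> cba; apply: nb; apply: (sp_exchange Pc).
Qed.

Lemma ind_swap s a b t : ind s [:: a, b & t] -> ind s [:: b, a & t].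
Proof.
move=> /= [na [nb it]]; have [nb' na'] := gen_swap na nb.
by split=> //; split=> //; apply: ind_sub it; submem.
Qed.

Lemma ind_move s t1 a t2 : ind s (t1 ++ a :: t2) <-> ind s (a :: t1 ++ t2).
Proof.
elim: t1 s => [|b t1 IH] s; first by [].
split=> [/= [nb /IH i]|i]; first by apply: ind_swap => /=; split.
by have [nb i'] := ind_swap i; split=> //; apply/IH.
Qed.

Lemma ind_perm s t t' : perm_eq t t' -> ind s t -> ind s t'.
Proof.
elim: t' s t => [|a t' IH] s t ptt'; first by move/perm_nilP: ptt' => ->.
have at_ : a \in t by rewrite (perm_mem ptt') inE eqxx.
case/splitPr: at_ ptt' => t1 t2; rewrite perm_catC /= perm_cons perm_catC => p.
by move/ind_move => /= [na it]; split=> //; apply: IH it.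
Qed.

Lemma ind_notin s t a : ind s t -> a \in t -> ~ c s a.
Proof.
move=> it /splitPr at_; case: at_ it => t1 t2 /ind_move [] //.
Qed.

Lemma ind_uniq s t : ind s t -> uniq t.
Proof.
elim: t s => //= a t IH s [na it]; rewrite (IH _ it) andbT.
by apply/negP => /(ind_notin it); apply; apply: sp_head.
Qed.

(** Otherwise [a :: t] is independent over [s], and moving [a] to the end keeps it out of
    [c (t ++ s)]. This discards auxiliary generic points. *)
Lemma ind_remove s t a : c (t ++ s) a -> ind (a :: s) t -> c s a.
Proof.
move=> ca it; apply: contrapT => na.
have i : ind s ([:: a] ++ t) by [].
have /ind_cat[_ [//]] : ind s (t ++ [:: a]).
  by apply: ind_perm i; rewrite perm_catC.
Qed.

Lemma ind_catC s t u : ind s (t ++ u) -> ind s (u ++ t).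
Proof. by apply: (@ind_perm s (t ++ u) (u ++ t)); rewrite perm_catC. Qed.

Lemma ind_catl s t u : ind s (t ++ u) -> ind s t.
Proof. by case/ind_cat. Qed.

Lemma ind_catr s t u : ind s (t ++ u) -> ind (t ++ s) u.
Proof. by case/ind_cat. Qed.

Lemma ind_extend s k : exists2 t, size t = k & ind s t.
Proof.
elim: k s => [|k IH] s; first by exists [::].
have [a na] := sp_infinite Pc s; have [t <- it] := IH (a :: s).
by exists (a :: t).
Qed.

Lemma ind_full s t : uniq t ->
  (forall b, b \in t -> ~ c ([seq x <- t | x != b] ++ s) b) -> ind s t.
Proof.
elim: t s => //= a t IH s /andP[at_ ut] H; split.
  move=> ca; apply: (H a); first by rewrite inE eqxx.
  by apply: sp_sub ca; submem.
apply: IH => // b bt cb; apply: (H b); first by rewrite inE bt orbT.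
have -> : a != b by apply: contraNneq at_ => ->.
by apply: sp_sub cb; submem.
Qed.

Lemma full_ind s t b : ind s t -> b \in t -> ~ c ([seq x <- t | x != b] ++ s) b.
Proof.
move=> it bt; have ut := ind_uniq it.
have p : perm_eq t (rem b t ++ [:: b]).
  by rewrite (permPl (perm_to_rem bt)) -cat1s perm_catC.
have /ind_cat[_ /= [nb _]] := ind_perm p it.
by rewrite -rem_filter.
Qed.

(** The element given up is the first one of [t] that falls into the closure of [a], [s] and its
    predecessors; exchange puts [a] in its place. *)
Lemma ind_drop s t a : ind s t ->
  exists t', [/\ {subset t' <= t}, size t <= (size t').+1 & ind (a :: s) t'].
Proof.
elim: t s => [|b t IH] s /=; first by exists [::].
move=> [nb it]; have [cb|nb'] := pselect (c (a :: s) b).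
  exists t; split=> //; first by submem.
  apply: ind_le it => x; rewrite inE => /orP[/eqP->|xs].
    by apply: (sp_exchange Pc).
  by apply: (sp_in Pc); rewrite inE xs orbT.
have [t' [t't st' it']] := IH _ it.
exists (b :: t'); split=> //=.
  by move=> x; rewrite !inE => /orP[->//|/t't ->]; rewrite orbT.
by split=> //; apply: ind_sub it'; submem.
Qed.

(** Each element of [e] put into the base costs [t] at most one element, by [ind_drop]. *)
Lemma ind_size s t e : ind s t -> (forall a, a \in t -> c (e ++ s) a) ->
  size t <= size e.
Proof.
elim: e s t => [|x e IH] s t it te.
  case: t it te => //= a t [na _] te; case: na; apply: te; exact: mem_head.
have [t' [t't st' it']] := ind_drop x it.
apply: leq_trans st' _; rewrite ltnS; apply: IH it' _ => a /t't /te.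
by apply: sp_sub; submem.
Qed.

(** The same descent: if the head of [e] depended on [s], its tail would span [t] with too few
    elements. *)
Lemma steinitz s t e : ind s t -> (forall a, a \in t -> c (e ++ s) a) ->
  size e <= size t -> ind s e.
Proof.
elim: e s t => //= x e IH s t it te se.
have nx : ~ c s x.
  move=> cx; have /(ind_size it) : forall a, a \in t -> c (e ++ s) a.
    move=> a /te; apply: (sp_trans Pc) => y; rewrite inE mem_cat.
    case/or3P=> [/eqP->|ye|ys]; first by apply: sp_sub cx; submem.
      by apply: (sp_in Pc); rewrite mem_cat ye.
    by apply: (sp_in Pc); rewrite mem_cat ys orbT.
  by rewrite leqNgt se.
split=> //; have [t' [t't st' it']] := ind_drop x it.
apply: IH it' _ _ => [a /t't /te|]; first by apply: sp_sub; submem.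
by rewrite -ltnS (leq_trans se).
Qed.

Lemma ind_map (f g : T -> T) s t :
  cancel f g -> (forall s a, c s a -> c (map g s) (g a)) ->
  ind s t -> ind (map f s) (map f t).
Proof.
move=> fK gc; elim: t s => //= a t IH s [na it]; split; last exact: (IH (a :: s)).
by move=> /gc; rewrite -map_comp fK map_id_in // => x _; apply: fK.
Qed.

End SeqPregeometry.

(** * Homogeneity under a group of automorphisms *)

Record perm_group (T : Type) (S : set (T -> T)) : Prop := {
  pg_id : S id;
  pg_comp : forall f g, S f -> S g -> S (f \o g);
  pg_inv : forall f, S f -> exists g, [/\ S g, cancel f g & cancel g f]
}.

Record seq_homogeneous (T : eqType) (c : seq T -> T -> Prop)
    (Sigma : set (T -> T)) : Prop := {
  sh_group : perm_group Sigma;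
  sh_cl : forall f s a, Sigma f -> c s a -> c (map f s) (f a);
  sh_move : forall s a b, ~ c s a -> ~ c s b ->
    exists f, [/\ Sigma f, {in s, f =1 id} & f a = b]
}.

Section SeqHomogeneous.
Variables (T : eqType) (c : seq T -> T -> Prop) (Sigma : set (T -> T)).
Hypothesis (Pc : seq_pregeometry c) (Hom : seq_homogeneous c Sigma).
Implicit Types (s t u : seq T) (a b : T).

(** The axiom for points is applied to one coordinate at a time; the coordinates already placed join
    the fixed base. *)
Lemma ind_homogeneous s t u : ind c s t -> ind c s u -> size t = size u ->
  exists f, [/\ Sigma f, {in s, f =1 id} & map f t = u].
Proof.
elim: u s t => [|b u IH] s [|a t] //=.
  by move=> _ _ _; exists id; split=> //; apply: pg_id (sh_group Hom).
move=> [na it] [nb iu] [stu].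
have [f [Sf fs fa]] := sh_move Hom na nb.
have [g [Sg fK gK]] := pg_inv (sh_group Hom) Sf.
have := ind_map fK (fun s a => sh_cl Hom (s := s) (a := a) Sg) it.
rewrite /= fa (map_id_in fs) => it'.
have [h [Sh hs ht]] := IH _ _ it' iu (etrans (size_map _ _) stu).
exists (h \o f); split.
- exact: (pg_comp (sh_group Hom)).
- by move=> x xs /=; rewrite fs //; apply: hs; rewrite inE xs orbT.
- by rewrite map_comp ht /= fa hs ?mem_head.
Qed.

(** Otherwise homogeneity sends [a] to a point outside [c (a :: s)]. This turns definability into
    dependence. *)
Lemma fixed_closure s a :
  (forall f, Sigma f -> {in s, f =1 id} -> f a = a) -> c s a.
Proof.
move=> fixa; apply: contrapT => na.
have [b nb] := sp_infinite Pc (a :: s).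
have nb' : ~ c s b by apply: contra_not nb; apply: (sp_sub Pc); submem.
have [f [Sf fs fab]] := sh_move Hom na nb'.
by apply: nb; rewrite -fab fixa //; apply: (sp_head Pc).
Qed.

(** Serves to exceed bounds on the number of roots of a polynomial. *)
Lemma large_orbit s a k : ~ c s a -> exists bs, [/\ uniq bs, size bs = k &
  forall b, b \in bs -> exists f, [/\ Sigma f, {in s, f =1 id} & f a = b]].
Proof.
move=> na; have [bs <- ibs] := ind_extend Pc s k.
exists bs; split=> // [|b bb]; first exact: ind_uniq ibs.
exact: (sh_move Hom) na (ind_notin Pc ibs bb).
Qed.

End SeqHomogeneous.

(** * Permutation groups of rank n *)

(** The group is a set of permutations, so automorphisms act on it by conjugation; [npa_normal] is
    all that remains of their component on the group. *)
Record n_perm_action (T : eqType) (c : seq T -> T -> Prop)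
    (Sigma S : set (T -> T)) (n : nat) : Prop := {
  npa_group : perm_group S;
  npa_cl : forall f s a, S f -> c s a -> c (map f s) (f a);
  npa_normal : forall sg f, Sigma sg -> S f ->
    exists2 g, S g & sg \o f =1 g \o sg;
  npa_rank : forall x y, size x = n -> size y = n -> ind c [::] (x ++ y) ->
    exists2 f, S f & map f x = y;
  npa_rank_max : exists x y, [/\ size x = n.+1, size y = n.+1,
    ind c [::] (x ++ y) & forall f, S f -> map f x <> y];
  npa_det : forall f g x, S f -> S g -> size x = n.+1 -> ind c [::] x ->
    {in x, f =1 g} -> f =1 g
}.

Section NPermAction.
Variables (T : eqType) (c : seq T -> T -> Prop) (Sigma S : set (T -> T)).
Variable n : nat.
Hypothesis (Pc : seq_pregeometry c) (Hom : seq_homogeneous c Sigma).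
Hypothesis (Act : n_perm_action c Sigma S n).
Implicit Types (s t u x y : seq T) (a b v : T) (f g : T -> T).

(** The rank axiom excludes a single pair of tuples. Homogeneity carries that pair to any other
    independent one, and a conjugate of [f] would move it. *)
Lemma npa_rank_bound f x :
  S f -> size x = n.+1 -> ~ ind c [::] (x ++ map f x).
Proof.
move=> Sf sx ix; have [x0 [y0 [sx0 sy0 i0 nm]]] := npa_rank_max Act.
have [sg [Ssg _]] : exists sg, [/\ Sigma sg, {in [::], sg =1 id} &
    map sg (x0 ++ y0) = x ++ map f x].
  by apply: (ind_homogeneous Hom) => //; rewrite !size_cat size_map sx0 sy0 sx.
rewrite map_cat => /eqP; rewrite eqseq_cat ?size_map ?sx0 ?sx //.
case/andP=> /eqP xE /eqP yE.
have [ta [Sta sgK taK]] := pg_inv (sh_group Hom) Ssg.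
have [g Sg gE] := npa_normal Act Sta Sf.
apply: (nm g Sg); rewrite -[LHS](mapK sgK) -[RHS](mapK sgK) yE; congr map.
rewrite -xE -!map_comp; apply: eq_map => z /=.
by rewrite -[RHS]taK; have /= -> := gE (sg z); rewrite sgK.
Qed.

(** The conjugate of [f] by [sg] agrees with [f] on the [n + 1] points of [t], hence everywhere. *)
Lemma npa_fix f sg t : S f -> Sigma sg -> size t = n.+1 -> ind c [::] t ->
  {in t, sg =1 id} -> {in map f t, sg =1 id} -> sg \o f =1 f \o sg.
Proof.
move=> Sf Ssg st it fixt fixft; have [g Sg gE] := npa_normal Act Ssg Sf.
have gf : g =1 f.
  apply: (npa_det Act Sg Sf st it) => z zt.
  have /= := gE z; rewrite (fixt z zt) => <-; rewrite fixft //; exact: map_f.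
by move=> z; rewrite gE /= gf.
Qed.

(** With an auxiliary generic point [t], the tuple [t :: x] is long enough for determinacy, so [f v]
    is fixed by the automorphisms fixing [v], [t], [x], [f t] and [f x]. The rank bound puts [f t]
    in the closure of [t], [x] and [f x], and exchange then removes [t]. *)
Lemma closure_image_generic f x v : S f -> size x = n ->
  ind c [::] (x ++ map f x) -> c (v :: x ++ map f x) (f v).
Proof.
move=> Sf sx ix; have [t nt] := sp_infinite Pc (v :: f v :: x ++ map f x).
have nt' : ~ c (x ++ map f x) t.
  by apply: contra_not nt; apply: (sp_sub Pc); submem.
have itx : ind c [::] (t :: x).
  have ixt : ind c [::] ((x ++ map f x) ++ [:: t]).
    by apply/(ind_cat Pc); rewrite cats0.
  apply: (ind_catl Pc (u := map f x)); apply: (ind_perm Pc) ixt; permeq.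
have cft : c (t :: x ++ map f x) (f t).
  apply: contrapT => nft; apply: (@npa_rank_bound f (t :: x) Sf) => //=.
    by rewrite sx.
  have i : ind c [::] ((x ++ map f x) ++ [:: t; f t]).
    by apply/(ind_cat Pc); rewrite cats0.
  apply: (ind_perm Pc (t' := (t :: x) ++ map f (t :: x))) i; permeq.
have cfv : c (v :: t :: x ++ map f x) (f v).
  suff : c (f t :: v :: t :: x ++ map f x) (f v).
    apply: (sp_trans Pc) => y; rewrite inE => /orP[/eqP->|].
      by apply: (sp_sub Pc) cft; submem.
    exact: (sp_in Pc).
  apply: (fixed_closure Pc Hom) => sg Ssg fixs.
  have -> : sg (f v) = f (sg v).
    apply: (npa_fix Sf Ssg _ itx) => [|y yx|y yx]; first by rewrite /= sx.
      by apply: fixs; move: yx; rewrite !inE mem_cat => /orP[->|->]; rewrite ?orbT.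
    by apply: fixs; move: yx; rewrite !inE mem_cat => /orP[->|->]; rewrite ?orbT.
  by rewrite fixs // !inE eqxx !orbT.
apply: contrapT => nfv; apply: nt.
apply: (sp_sub Pc (s := f v :: v :: x ++ map f x)); first by submem.
apply: (sp_exchange Pc) => //; apply: (sp_sub Pc) cfv; submem.
Qed.

Lemma npa_ind_map f s x : S f -> ind c s x -> ind c (map f s) (map f x).
Proof.
move=> Sf; have [g [Sg fK gK]] := pg_inv (npa_group Act) Sf.
by apply: (ind_map fK) => t a; apply: (npa_cl Act).
Qed.

(** Write [f] as the composite of [h \o f] and the inverse of [h], where [h] sends [f x] to a
    generic [w]. Both factors fall under the generic case, and [ind_remove] discards [w]. *)
Lemma closure_image f x v : S f -> size x = n -> ind c [::] x ->
  c (v :: x ++ map f x) (f v).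
Proof.
move=> Sf sx ix.
have [w sw iw] := ind_extend Pc (f v :: v :: x ++ map f x) n.
have ifx := npa_ind_map Sf ix.
have ifxw : ind c [::] (map f x ++ w).
  by apply/(ind_cat Pc); split=> //; apply: (ind_sub Pc) iw; submem.
have [h Sh hE] := npa_rank Act (etrans (size_map _ _) sx) sw ifxw.
have [h' [Sh' hK h'K]] := pg_inv (npa_group Act) Sh.
have h'E : map h' w = map f x by rewrite -hE mapK.
have c1 : c (v :: x ++ w) (h (f v)).
  have Shf := pg_comp (npa_group Act) Sh Sf.
  have := closure_image_generic v Shf sx; rewrite map_comp hE /=; apply.
  by apply/(ind_cat Pc); split=> //; apply: (ind_sub Pc) iw; submem.
have c2 : c (h (f v) :: w ++ map f x) (f v).
  have := closure_image_generic (h (f v)) Sh' sw; rewrite h'E hK; apply.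
  exact: (ind_catC Pc).
apply: (ind_remove Pc (t := w)) => //.
apply: (sp_trans Pc) c2 => y; rewrite inE => /orP[/eqP->|].
  by apply: (sp_sub Pc) c1; submem.
by move=> yw; apply: (sp_in Pc); move: yw; inmem.
Qed.

Definition generic_over s f :=
  exists x, size x = n /\ ind c s (x ++ map f x).

(** For a generic [w], [closure_image] places [f x] in the closure of [s], [w] and [f w], so
    Steinitz makes [w] and [f w] independent over [s]. Genericity can thus be tested on a tuple
    inside the base. *)
Lemma generic_image f s x : S f -> size x = n -> {subset x <= s} ->
  ind c [::] x -> ind c s (map f x) -> generic_over s f.
Proof.
move=> Sf sx xs ix ifx; have [w sw iw] := ind_extend Pc (map f x ++ s) n.
exists w; split=> //.
apply: (steinitz Pc (t := map f x ++ w)); last by rewrite !size_cat !size_map sx sw.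
  exact/(ind_cat Pc).
move=> a; rewrite mem_cat => /orP[/mapP[b bx ->]|aw]; last first.
  by apply: (sp_in Pc); move: aw; inmem.
apply: (sp_sub Pc (s := b :: w ++ map f w)).
  move: (xs b bx) => bs y; rewrite !(inE, mem_cat).
  by case/or3P=> [/eqP->|->|->]; rewrite ?bs ?orbT.
apply: closure_image => //; apply: (ind_sub Pc) iw; submem.
Qed.

End NPermAction.

(** * Abelian stabilisers of n - 1 independent points *)

Definition seq_unique_generics (T : eqType) (c : seq T -> T -> Prop)
    (Sigma S : set (T -> T)) (n : nat) :=
  forall s f g, S f -> S g -> generic_over c n s f -> generic_over c n s g ->
    exists sg, [/\ Sigma sg, {in s, sg =1 id} & sg \o f =1 g \o sg].

Definition abelian_generic_stabilizers (T : eqType) (c : seq T -> T -> Prop)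
    (Sigma S : set (T -> T)) (n : nat) :=
  forall u, (size u).+1 = n -> ind c [::] u -> exists N : set (T -> T),
    [/\ forall f, N f -> S f /\ {in u, f =1 id},
        forall f g, N f -> N g -> f \o g =1 g \o f,
        forall a b, ~ c u a -> ~ c u b -> exists2 f, N f & f a = b
      & forall sg f, Sigma sg -> {in u, sg =1 id} -> N f ->
          exists2 g, N g & sg \o f =1 g \o sg].

Section AbelianStabilizers.
Variables (T : eqType) (c : seq T -> T -> Prop) (Sigma S : set (T -> T)).
Variable n : nat.
Hypothesis (Pc : seq_pregeometry c) (Hom : seq_homogeneous c Sigma).
Hypothesis (Act : n_perm_action c Sigma S n).
Hypothesis (UG : seq_unique_generics c Sigma S n).
Hypothesis (AS : abelian_generic_stabilizers c Sigma S n).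
Implicit Types (s t u x y : seq T) (a b v : T) (f g : T -> T).

(** The rank axiom wants [x] and [y] jointly independent; a third tuple generic over both
    mediates. *)
Lemma npa_transitive x y : size x = n -> size y = n ->
  ind c [::] x -> ind c [::] y -> exists2 f, S f & map f x = y.
Proof.
move=> sx sy ix iy; have [z sz iz] := ind_extend Pc (x ++ y) n.
have [f Sf fx] : exists2 f, S f & map f x = z.
  apply: (npa_rank Act) => //; apply/(ind_cat Pc); split=> //.
  by apply: (ind_sub Pc) iz; submem.
have [g Sg gz] : exists2 f, S f & map f z = y.
  apply: (npa_rank Act) => //; apply: (ind_catC Pc); apply/(ind_cat Pc).
  by split=> //; apply: (ind_sub Pc) iz; submem.
exists (g \o f); last by rewrite map_comp fx.
exact: (pg_comp (npa_group Act)).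
Qed.

(* Move the coordinates of [x] one at a time, each by the unique such element of the
   abelian group attached to the other coordinates. *)
Lemma definable_move_rec p x y : size p + size x = n -> size x = size y ->
  ind c [::] (p ++ x ++ y) -> exists f, [/\ S f, {in p, f =1 id}, map f x = y &
    forall sg, Sigma sg -> {in p ++ x ++ y, sg =1 id} -> sg \o f =1 f \o sg].
Proof.
elim: x p y => [|a x IH] p [|b y] //= sn sxy i.
  by exists id; split=> //; apply: pg_id (npa_group Act).
have {}i : ind c [::] (p ++ x ++ [:: a; b] ++ y).
  by apply: (ind_perm Pc) i; permeq.
have iu : ind c [::] (p ++ x) by apply: (ind_catl Pc (u := [:: a; b] ++ y)); rewrite -catA.
have iu2 : ind c (p ++ x) [:: a; b].
  move: i; rewrite catA => /(ind_catr Pc)/(ind_catl Pc).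
  by rewrite cats0.
have [na nb] := iu2.
have {}nb : ~ c (p ++ x) b.
  by case: nb => nb _; apply: contra_not nb; apply: (sp_sub Pc); submem.
have su : (size (p ++ x)).+1 = n by rewrite size_cat -sn addnS.
have [N [NS Nab Ntr Nsg]] := AS su iu.
have [f1 Nf1 f1a] := Ntr _ _ na nb.
have [Sf1 f1u] := NS _ Nf1.
have [f2 [Sf2 f2p f2x f2sg]] : exists f, [/\ S f, {in b :: p, f =1 id}, map f x = y &
    forall sg, Sigma sg -> {in (b :: p) ++ x ++ y, sg =1 id} -> sg \o f =1 f \o sg].
  apply: IH; [by rewrite /= addSnnS | by case: sxy|].
  have i' : ind c [::] ([:: a] ++ (b :: p) ++ x ++ y).
    by apply: (ind_perm Pc) i; permeq.
  by apply: (ind_sub Pc) (ind_catr Pc i'); submem.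
exists (f2 \o f1); split.
- exact: (pg_comp (npa_group Act)).
- move=> z zp /=; rewrite f1u ?mem_cat ?zp //.
  by apply: f2p; rewrite inE zp orbT.
- rewrite map_comp /= f1a f2p ?mem_head //; congr (_ :: _).
  by rewrite -f2x; congr map; apply: map_id_in => z zx; rewrite f1u // mem_cat zx orbT.
move=> sg Ssg sgE.
have sgu : {in p ++ x, sg =1 id} by move=> z zi; apply: sgE; move: zi; inmem.
have sga : sg a = a by apply: sgE; rewrite !(inE, mem_cat) eqxx orbT.
have sgb : sg b = b by apply: sgE; rewrite !(inE, mem_cat) eqxx !orbT.
have [g Ng gE] := Nsg _ _ Ssg sgu Nf1.
(* An element of the abelian transitive [N] is determined by its value at [a]: its value at
   [z = h a] follows by commuting with [h], and [p ++ x], [a], [z] are [n + 1] independent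
   points. *)
have f1g : f1 =1 g.
  have ga : g a = f1 a by have /= := gE a; rewrite sga f1a sgb.
  have [Sg gu] := NS _ Ng.
  have [z nz] := sp_infinite Pc (a :: p ++ x).
  have nz' : ~ c (p ++ x) z.
    by apply: contra_not nz; apply: (sp_sub Pc); submem.
  have [h Nh hz] := Ntr _ _ na nz'.
  apply: (npa_det Act Sf1 Sg (x := (p ++ x) ++ [:: a; z])).
  - by rewrite size_cat addn2 su.
  - by apply/(ind_cat Pc); rewrite cats0.
  move=> y'; rewrite mem_cat => /orP[yu|]; first by rewrite f1u ?gu.
  rewrite !inE => /orP[/eqP->//|/eqP->]; rewrite -hz.
  by have /= -> := Nab _ _ Nf1 Nh a; have /= -> := Nab _ _ Ng Nh a; rewrite ga.
move=> z /=; have /= -> : sg (f2 (f1 z)) = f2 (sg (f1 z)).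
  by apply: f2sg => // w wi; apply: sgE; move: wi; inmem.
by congr f2; have /= -> := gE z; rewrite f1g.
Qed.

Lemma definable_move x y : size x = n -> size y = n -> ind c [::] (x ++ y) ->
  exists f, [/\ S f, map f x = y &
    forall sg, Sigma sg -> {in x ++ y, sg =1 id} -> sg \o f =1 f \o sg].
Proof.
move=> sx sy i; have [|f [? _ ? ?]] := @definable_move_rec [::] x y sx _ i.
  by rewrite sx.
by exists f.
Qed.

(* A definable [g] moving [x] to a generic [y] is conjugate to [g \o f] by an
   automorphism fixing [x], hence [y = g x], hence [g]. *)
Lemma trivial_stabilizer f x : S f -> size x = n -> ind c [::] x ->
  {in x, f =1 id} -> f =1 id.
Proof.
move=> Sf sx ix fx; have [y sy iy] := ind_extend Pc x n.
have [|g [Sg gx gsg]] := definable_move sx sy.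
  by apply/(ind_cat Pc); rewrite cats0.
have Sgf := pg_comp (npa_group Act) Sg Sf.
have gfx : map (g \o f) x = y by rewrite map_comp (map_id_in fx).
have [||sg [Ssg sgx sgE]] := UG (s := x) Sg Sgf.
- by apply: (generic_image Pc Hom Act Sg sx) => //; rewrite gx.
- by apply: (generic_image Pc Hom Act Sgf sx) => //; rewrite gfx.
have sgy : {in y, sg =1 id}.
  move=> _ /[!(esym gx)] /mapP[a ax ->].
  have /= -> := sgE a; rewrite (sgx a ax).
  by rewrite fx.
have [h [Sh gK hK]] := pg_inv (npa_group Act) Sg.
have [ta [Sta sgK taK]] := pg_inv (sh_group Hom) Ssg.
move=> a; rewrite -[a]taK; set b := ta a.
have /= E1 := sgE b; have /= E2 : sg (g b) = g (sg b).
  apply: gsg => // z; rewrite mem_cat => /orP[]; [exact: sgx|exact: sgy].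
by rewrite -[RHS]gK -E2 E1 gK.
Qed.

Lemma ind_agree f g x : S f -> S g -> size x = n -> ind c [::] x ->
  {in x, f =1 g} -> f =1 g.
Proof.
move=> Sf Sg sx ix fg; have [h [Sh gK hK]] := pg_inv (npa_group Act) Sg.
have E : h \o f =1 id.
  apply: (trivial_stabilizer (pg_comp (npa_group Act) Sh Sf) sx ix) => a ax /=.
  by rewrite fg ?gK.
by move=> a; rewrite -[LHS]hK; have /= -> := E a.
Qed.

Definition fixing u : set (T -> T) := [set f | S f /\ {in u, f =1 id}].

Lemma fixing_spec u : (size u).+1 = n -> ind c [::] u ->
  (forall f g, fixing u f -> fixing u g -> f \o g =1 g \o f) /\
  (forall a b, ~ c u a -> ~ c u b -> exists2 f, fixing u f & f a = b).
Proof.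
move=> su iu; have [N [NS Nab Ntr Nsg]] := AS su iu.
have NE f : fixing u f -> exists2 g, N g & f =1 g.
  move=> [Sf fu]; have [a na] := sp_infinite Pc u.
  have nfa : ~ c u (f a).
    have [h [Sh fK hK]] := pg_inv (npa_group Act) Sf.
    move=> /(npa_cl Act Sh); rewrite fK map_id_in // => x xu.
    by rewrite -[RHS]fK fu.
  have [g Ng ga] := Ntr _ _ na nfa; exists g => //.
  have [Sg gu] := NS _ Ng.
  apply: (ind_agree Sf Sg (x := rcons u a)); first by rewrite size_rcons.
    by rewrite -cats1; apply/(ind_cat Pc); rewrite cats0.
  move=> x; rewrite mem_rcons inE => /orP[/eqP->//|xu].
  by rewrite fu ?gu.
split=> [f g /NE[f' Nf' fE] /NE[g' Ng' gE] a|a b na nb].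
  by rewrite /= fE gE; have /= -> := Nab _ _ Nf' Ng' a; rewrite fE gE.
by have [f /NS Nf fa] := Ntr _ _ na nb; exists f.
Qed.

(* For [x] outside [c (a :: C)], let [e] fix [x :: C] and send [a] to [b]. By
   commutation [e z] is in [c (z :: C)] for all [z], so by homogeneity [e] does not
   depend on a generic [x], and [e = id]. *)
Lemma closure_cons_geometry C a b : (size C).+2 = n -> ind c [::] C ->
  ~ c C a -> ~ c C b -> c (a :: C) b -> b = a.
Proof.
move=> sC iC na nb cab.
have [z nz] := sp_infinite Pc (a :: C).
have nzC : ~ c C z by apply: contra_not nz; apply: (sp_sub Pc); submem.
have iaz : ind c [::] (C ++ [:: a; z]).
  by apply/(ind_cat Pc); rewrite cats0; split=> //; split=> //; split.
have key (x : T) : ~ c [:: z, a & C] x -> exists e,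
    [/\ fixing (x :: C) e, e a = b & c (z :: C) (e z)].
  move=> nx.
  have nxC : ~ c C x by apply: contra_not nx; apply: (sp_sub Pc); submem.
  have nxa : ~ c (a :: C) x by apply: contra_not nx; apply: (sp_sub Pc); submem.
  have nxz : ~ c (z :: C) x by apply: contra_not nx; apply: (sp_sub Pc); submem.
  have iu : ind c [::] (x :: C).
    by apply: (ind_catC Pc (t := C) (u := [:: x])); apply/(ind_cat Pc); rewrite cats0.
  have [cm tr] := fixing_spec (u := x :: C) sC iu.
  have nua : ~ c (x :: C) a by have [] := gen_swap Pc na nxa.
  have nuz : ~ c (x :: C) z by have [] := gen_swap Pc nzC nxz.
  have nub : ~ c (x :: C) b.
    move=> cb; apply: nxa; have := sp_exchange Pc cb nb.
    apply: (sp_trans Pc) => y; rewrite inE => /orP[/eqP->//|yC].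
    by apply: (sp_in Pc); rewrite inE yC orbT.
  have [e Fe ea] := tr _ _ nua nub; have [g Fg ga] := tr _ _ nua nuz.
  exists e; split=> //; rewrite -ga; have /= -> := cm _ _ Fe Fg a.
  have [Sg gu] := Fg.
  rewrite ea; have := npa_cl Act Sg cab; rewrite /= map_id_in // => y yC.
  by apply: gu; rewrite inE yC orbT.
have [x1 nx1] := sp_infinite Pc [:: z, a & C].
have [e1 [[Se1 e1u] e1a e1z]] := key _ nx1.
have [x2 nx2] := sp_infinite Pc [:: x1, z, a & C].
have nx2' : ~ c [:: z, a & C] x2.
  by apply: contra_not nx2; apply: (sp_sub Pc); submem.
have bound (x : T) : c [:: e1 z, b, z, a & C] x -> c [:: z, a & C] x.
  apply: (sp_trans Pc) => y; rewrite 2!inE => /or3P[/eqP->|/eqP->|].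
  - by apply: (sp_sub Pc) e1z; submem.
  - by apply: (sp_sub Pc) cab; submem.
  - exact: (sp_in Pc).
have [sg [Ssg sgs sgx]] := sh_move Hom (contra_not (@bound x1) nx1)
  (contra_not (@bound x2) nx2').
have [g Sg gE] := npa_normal Act Ssg Se1.
have e1g : e1 =1 g.
  apply: (ind_agree Se1 Sg _ iaz) => [|y]; first by rewrite size_cat addn2.
  have ysg : y \in C ++ [:: a; z] -> sg y = y.
    by move=> yi; apply: sgs; move: yi; inmem.
  have sgey : y \in C ++ [:: a; z] -> sg (e1 y) = e1 y.
    move=> yi; apply: sgs; move: yi; rewrite !(inE, mem_cat).
    case/or3P=> [yC|/eqP->|/eqP->]; last by rewrite eqxx.
      by rewrite (e1u y) ?inE yC ?orbT.
    by rewrite e1a eqxx orbT.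
  by move=> yi; have /= := gE y; rewrite ysg // sgey.
have e1x2 : e1 x2 = x2.
  rewrite e1g -{1}sgx; have /= <- := gE x1.
  by rewrite e1u ?mem_head.
have e1id : e1 =1 id.
  apply: (ind_agree Se1 (pg_id (npa_group Act)) (x := C ++ [:: x1; x2])).
  - by rewrite size_cat addn2.
  - apply/(ind_cat Pc); rewrite cats0; split=> //; split=> /=; last split=> //.
      by apply: contra_not nx1; apply: (sp_sub Pc); submem.
    by apply: contra_not nx2; apply: (sp_sub Pc); submem.
  - move=> y; rewrite mem_cat !inE => /or3P[yC|/eqP->|/eqP->] //.
      by apply: e1u; rewrite inE yC orbT.
    by apply: e1u; rewrite mem_head.
by rewrite -e1a e1id.
Qed.

End AbelianStabilizers.

(** * From closures on sets to closures on lists *)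

Lemma card_set_of_seq (T : eqType) (s : seq T) :
  uniq s -> ([set` s] #= `I_(size s))%card.
Proof.
case: s => [|a s] us; first by rewrite II0 set_nil.
move: {s}(a :: s) us => t us.
have -> : [set` t] = (nth a t) @` `I_(size t).
  apply/seteqP; split=> [x /= xt|_ [i /= it <-]]; last exact: mem_nth.
  by exists (index x t); rewrite /= ?index_mem ?nth_index.
apply: inj_card_eq => i j /set_mem /= it /set_mem /= jt /eqP.
by rewrite nth_uniq // => /eqP.
Qed.

Lemma image_set_cons (T : eqType) (U : Type) (v : T -> U) a (s : seq T) :
  v @` [set` a :: s] = v @` [set` s] `|` [set v a].
Proof.
apply/seteqP; split=> [p [x /=]|x [[y /= ys <-]|->]].
- rewrite inE => /orP[/eqP->|xs] <-; first by right.
  by left; exists x.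
- by exists y => //=; rewrite inE ys orbT.
- by exists a => //=; rewrite mem_head.
Qed.

Lemma image_set_cat (T : eqType) (U : Type) (v : T -> U) (s t : seq T) :
  v @` [set` s ++ t] = v @` [set` s] `|` v @` [set` t].
Proof.
apply/seteqP; split=> [p [x /=]|x [[y /= ys <-]|[y /= ys <-]]].
- by rewrite mem_cat => /orP[] xs <-; [left|right]; exists x.
- by exists y => //=; rewrite mem_cat ys.
- by exists y => //=; rewrite mem_cat ys orbT.
Qed.

Lemma image_set_map (T U : eqType) (V : Type) (f : T -> U) (v : U -> V) s :
  v @` [set` map f s] = (v \o f) @` [set` s].
Proof.
apply/seteqP; split=> [_ [x /= /mapP[y ys ->] <-]|_ [x xs <-]]; first by exists y.
by exists (f x) => //=; apply: map_f.
Qed.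

Lemma image_set_nil (T : eqType) (U : Type) (v : T -> U) :
  v @` [set` [::]] = set0.
Proof. by rewrite set_nil image_set0. Qed.

Section Subgroup.
Variables (G : groupType) (H : set G).
Hypothesis sH : subgroup H.

Lemma subgroup1 : H 1%g.
Proof. by case: sH => /set_mem. Qed.

Lemma subgroupM g h : H g -> H h -> H (g * h)%g.
Proof.
by move=> Hg Hh; apply: set_mem; apply: (group_closedM sH); apply: mem_set.
Qed.

Lemma subgroupV g : H g -> H (g^-1)%g.
Proof. by move=> Hg; apply/set_mem/(group_closedV sH)/mem_set. Qed.

End Subgroup.

Section Transfer.
Variables (G : groupType) (P : Type) (T : choiceType) (v : T -> P).
Variables (D : set P) (cl : set P -> set P) (act : G -> P -> P) (H : set G).
Variable Sigma : set ((G -> G) * (P -> P)).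
Hypotheses (v_inj : injective v) (v_range : forall p, D p <-> exists t, v t = p).
Implicit Types (s t : seq T) (a b : T).

(* [v] parametrises the carrier [D] by a type. *)
Definition seqcl s a := cl (v @` [set` s]) (v a).
Definition induced : set (T -> T) :=
  [set f | exists2 g, H g & forall x, v (f x) = act g (v x)].
Definition induced_aut : set (T -> T) :=
  [set f | exists2 s, Sigma s & forall x, v (f x) = s.2 (v x)].

Lemma v_carrier a : D (v a).
Proof. by apply/v_range; exists a. Qed.

Lemma v_image_carrier (X : set T) : v @` X `<=` D.
Proof. by move=> _ [a _ <-]; apply: v_carrier. Qed.

Lemma lift_perm F : (forall p, D p -> D (F p)) ->
  exists f : T -> T, forall x, v (f x) = F (v x).
Proof.
move=> DF; have [f fE] : {f : T -> T & forall x, v (f x) = F (v x)}.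
  apply: (@choice T T (fun x y => v y = F (v x))) => x.
  exact/v_range/DF/v_carrier.
by exists f.
Qed.

Lemma independent_ind s : uniq s -> independent cl (v @` [set` s]) ->
  seq_pregeometry seqcl -> ind seqcl [::] s.
Proof.
move=> us is_ Pc; apply: (ind_full Pc) => // b bs cb.
apply: (is_ (v b)); first by exists b.
rewrite set0U; move: cb; rewrite cats0 /seqcl; congr (cl _ _).
apply/seteqP; split=> [p [x /=]|_ [[x /= xs <-] xb]].
  rewrite mem_filter => /andP[xb xs] <-; split; first by exists x.
  by move=> /v_inj /eqP; apply/negP.
exists x => //=; rewrite mem_filter xs andbT; apply/eqP => xb'.
by apply: xb; rewrite xb'.
Qed.

Section Pregeometry.
Hypothesis IP : infinite_pregeometry D cl.

Lemma transfer_pregeometry_axioms :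
  [/\ forall s a, a \in s -> seqcl s a,
      forall s t b, (forall a, a \in s -> seqcl t a) -> seqcl s b -> seqcl t b,
      forall s a b, seqcl (b :: s) a -> ~ seqcl s a -> seqcl (a :: s) b
    & forall a, ~ seqcl [::] a].
Proof.
have [Pcl cl0 _ _] := IP; split.
- move=> s a as_; apply: (cl_extensive Pcl); last by exists a.
  exact: v_image_carrier.
- move=> s t b st; rewrite /seqcl -[cl (v @` [set` t])](cl_idempotent Pcl).
    apply: (cl_monotone Pcl) => [_ [a as_ <-]|]; first exact: st.
    by apply: (cl_carrier Pcl); apply: v_image_carrier.
  exact: v_image_carrier.
- move=> s a b; rewrite /seqcl !image_set_cons; apply: (cl_exchange Pcl).
  + exact: v_image_carrier.
  + exact: v_carrier.
  + exact: v_carrier.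
- by move=> a; rewrite /seqcl image_set_nil cl0.
Qed.

Lemma card_seqcl_image s : uniq s -> (v @` [set` s] #= `I_(size s))%card.
Proof.
move=> us; apply: card_eq_trans (card_set_of_seq us).
by apply: inj_card_eq => x y _ _; apply: v_inj.
Qed.

Lemma ind_basis_over r s : seq_pregeometry seqcl -> ind seqcl r s ->
  basis_over cl (v @` [set` r]) (v @` [set` s]) (v @` [set` s]).
Proof.
move=> Pc is_; have [Pcl _ _ _] := IP; split=> //.
- move=> _ [b bs <-] cb; apply: (full_ind Pc is_ bs).
  apply: (cl_monotone Pcl) cb; last exact: v_image_carrier.
  rewrite image_set_cat => p [rp|[[x xs <-] xb]]; first by right.
  left; exists x => //=; rewrite mem_filter; apply/andP; split=> //.
  by apply/eqP => xb'; apply: xb; rewrite xb'.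
- rewrite -image_set_cat => p sp; apply: (cl_extensive Pcl).
    exact: v_image_carrier.
  by case: sp => x xs <-; exists x => //=; rewrite mem_cat [x \in s]xs orbT.
Qed.

Lemma ind_independent s : seq_pregeometry seqcl -> ind seqcl [::] s ->
  independent cl (v @` [set` s]).
Proof. by move=> Pc /(ind_basis_over Pc)[_]; rewrite image_set_nil. Qed.

Lemma ind_dim_over r s : seq_pregeometry seqcl -> ind seqcl r s ->
  dim_over cl (v @` [set` r]) (v @` [set` s]) `I_(size s).
Proof.
move=> Pc is_; exists (v @` [set` s]); split; first exact: ind_basis_over.
exact/card_seqcl_image/(ind_uniq Pc is_).
Qed.

Lemma ind_dim s : seq_pregeometry seqcl -> ind seqcl [::] s ->
  Defs.dim cl (v @` [set` s]) `I_(size s).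
Proof. by move=> Pc /(ind_dim_over Pc); rewrite image_set_nil. Qed.

Lemma finite_support (B : set P) s : B `<=` D -> v @` [set` s] `<=` cl B ->
  exists F, [/\ finite_set F, F `<=` B & v @` [set` s] `<=` cl F].
Proof.
have [Pcl _ _ _] := IP; move=> BD.
elim: s => [|a s IH].
  by rewrite image_set_nil => _; exists set0; split; [exact: finite_set0| |].
rewrite image_set_cons => sB; have [|F [fF FB sF]] := IH.
  by move=> p sp; apply: sB; left.
have [E [fE EB aE]] : exists Y, [/\ finite_set Y, Y `<=` B & cl Y (v a)].
  by apply: (cl_finite_character Pcl) => //; apply: sB; right.
have UB : F `|` E `<=` B by move=> p [/FB|/EB].
have UD := subset_trans UB BD.
exists (F `|` E); split=> //; first by rewrite finite_setU.
move=> p [/sF|->]; last by move: aE; apply: (cl_monotone Pcl) => //; right.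
by apply: (cl_monotone Pcl) => // q; left.
Qed.

(** A spanning list would depend on a finite part of the basis; by independence that part would be
    the whole basis, against infinite dimension. *)
Lemma basis_not_finitely_spanned (B : set P) s : basis_over cl set0 D B ->
  exists2 b : P, B b & ~ cl (v @` [set` s]) b.
Proof.
move=> [BD iB DB]; have [Pcl cl0 ndim _] := IP; apply: contrapT => nfin.
have Bs (b : P) : B b -> cl (v @` [set` s]) b.
  by move=> Bb; apply: contrapT => nb; apply: nfin; exists b.
have [|F [fF FB sF]] := @finite_support B s BD.
  by move=> p [x xs <-]; have := DB _ (v_carrier x); rewrite set0U.
have FD := subset_trans FB BD.
have BF : B `<=` F.
  move=> b Bb; apply: contrapT => nFb; apply: (iB b Bb); rewrite set0U.
  have bF : cl F b.
    rewrite -(cl_idempotent Pcl FD); apply: (cl_monotone Pcl) (Bs b Bb) => //.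
    exact: (cl_carrier Pcl).
  apply: (cl_monotone Pcl) bF => [p Fp|]; last by move=> p [/BD].
  by split; [apply: FB|move=> pb; apply: nFb; rewrite -pb].
have {}BF : B = F by apply/seteqP; split.
have [k Fk] := fF; apply: (ndim k); exists B; split; first by [].
by rewrite BF.
Qed.

Lemma transfer_pregeometry : seq_pregeometry seqcl.
Proof.
have [c1 c2 c3 c4] := transfer_pregeometry_axioms.
split=> // s; have [_ _ _ [B [bB _]]] := IP.
have [b Bb nb] := basis_not_finitely_spanned s bB.
have [BD _ _] := bB.
by have [x xb] := (v_range b).1 (BD _ Bb); exists x; rewrite /seqcl xb.
Qed.

Lemma dim_ind (X : set P) m : X `<=` D -> Defs.dim cl X `I_m ->
  exists s, [/\ size s = m, ind seqcl [::] s & v @` [set` s] `<=` X].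
Proof.
move=> XD [B [[BX iB _] Bm]].
have BE : v @` (v @^-1` B) = B.
  apply/seteqP; split=> [_ [x xB <-] //|b Bb].
  by have [x xb] := (v_range b).1 (XD _ (BX _ Bb)); exists x; rewrite /= ?xb.
have cB : (v @^-1` B #= B)%card.
  rewrite -{2}BE; apply: card_esym; apply: inj_card_eq => x y _ _; exact: v_inj.
have : finite_set (v @^-1` B) by exists m; apply: card_eq_trans cB Bm.
move=> /finite_seqP[s sE].
have sE' : v @^-1` B = [set` undup s].
  by rewrite sE; apply/seteqP; split=> x /=; rewrite mem_undup.
have BE' : v @` [set` undup s] = B by rewrite -sE'.
exists (undup s); split; last by rewrite BE'.
  apply/card_eq_II; apply: card_eq_trans Bm.
  by rewrite -BE'; apply: card_esym; apply: card_seqcl_image; apply: undup_uniq.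
apply: independent_ind; [exact: undup_uniq|by rewrite BE'|].
exact: transfer_pregeometry.
Qed.

End Pregeometry.
Hypothesis PA : pregeometric_action act H D cl.
Let IP := pact_pregeometry PA.
Let Pc := transfer_pregeometry IP.

Lemma induced_lift g : H g -> exists2 f, induced f & forall x, v (f x) = act g (v x).
Proof.
move=> Hg; have [f fE] := lift_perm (fun p => pact_carrier PA (x := p) Hg).
by exists f => //; exists g.
Qed.

Lemma induced_group : perm_group induced.
Proof.
split.
- by exists 1%g; [exact: subgroup1 (pact_subgroup PA)|
     move=> x; rewrite (pact_one PA) //; apply: v_carrier].
- move=> f f' [g Hg fE] [g' Hg' fE']; exists (g * g')%g.
    exact: (subgroupM (pact_subgroup PA)).
  by move=> x /=; rewrite fE fE' (pact_mul PA) //; apply: v_carrier.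
- move=> f [g Hg fE]; have Hg' := subgroupV (pact_subgroup PA) Hg.
  have [f' If' fE'] := induced_lift Hg'; exists f'.
  split=> // x; apply: v_inj; rewrite ?(fE, fE').
    by rewrite -(pact_mul PA) ?mulVg ?(pact_one PA) //; apply: v_carrier.
  by rewrite -(pact_mul PA) ?mulgV ?(pact_one PA) //; apply: v_carrier.
Qed.

Lemma induced_cl f s a : induced f -> seqcl s a -> seqcl (map f s) (f a).
Proof.
move=> [g Hg fE]; rewrite /seqcl image_set_map fE.
rewrite (pact_cl PA Hg (v_carrier a) (@v_image_carrier [set` s])).
by congr (cl _ _); rewrite image_comp; apply: eq_imagel => x _ /=.
Qed.

Lemma transfer_homogeneous : homogeneous act H D cl Sigma ->
  seq_homogeneous seqcl induced_aut.
Proof.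
move=> [AG Hm]; have autD (r : (G -> G) * (P -> P)) p : Sigma r -> D p -> D (r.2 p).
  move=> Sr Dp; have [[sD _ _] _] := aaut_pregeometry (agroup_aut AG Sr).
  exact: sD.
split; first split.
- by exists (idfun, idfun); [exact: agroup_one AG|].
- move=> f f' [s Ss fE] [s' Ss' fE'].
  by exists (s.1 \o s'.1, s.2 \o s'.2); [exact: agroup_mul AG _ _ Ss Ss'|
    move=> x /=; rewrite fE fE'].
- move=> f [s Ss fE]; have [t [St _ _ sK tK]] := agroup_inv AG Ss.
  have [f' fE'] := lift_perm (fun p => autD t p St).
  by exists f'; split; [exists t|move=> x; apply: v_inj; rewrite fE' fE sK|
    move=> x; apply: v_inj; rewrite fE fE' tK].
- move=> f s a [t St fE]; rewrite /seqcl image_set_map fE => ca.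
  have [_ tcl] := aaut_pregeometry (agroup_aut AG St).
  have <- : t.2 @` (v @` [set` s]) = (v \o f) @` [set` s].
    by rewrite image_comp; apply: eq_imagel => x _ /=.
  by rewrite -tcl; [exists (v a)|exact: v_image_carrier].
- move=> s a b na nb.
  have [||||t [[St ts] tab]] := Hm (v @` [set` s]) (v a) (v b).
  + exact/finite_image/finite_seq.
  + exact: v_image_carrier.
  + by split=> //; apply: v_carrier.
  + by split=> //; apply: v_carrier.
  have [f fE] := lift_perm (fun p => autD t p St).
  exists f; split; [by exists t| |by apply: v_inj; rewrite fE].
  by move=> x xs; apply: v_inj; rewrite fE ts //; exists x.
Qed.

Lemma range_nth n x0 x : size x = n ->
  range (fun i : 'I_n => v (nth x0 x i)) = v @` [set` x].
Proof.
move=> sx; apply/seteqP; split=> [_ [i _ <-]|_ [y yx <-]].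
  by exists (nth x0 x i) => //=; apply: mem_nth; rewrite sx.
have iy : (index y x < n)%N by rewrite -sx index_mem.
by exists (Ordinal iy) => //=; rewrite nth_index.
Qed.

Lemma range_seq n (x : 'I_n -> P) : range x `<=` D ->
  exists s, [/\ size s = n, range x = v @` [set` s] &
    forall i x0, x i = v (nth x0 s i)].
Proof.
move=> xD; have [f fE] : {f : 'I_n -> T & forall i, v (f i) = x i}.
  apply: (@choice _ _ (fun i y => v y = x i)) => i.
  by apply/v_range/xD; exists i.
exists (codom f); split; first by rewrite size_codom card_ord.
  apply/seteqP; split=> [_ [i _ <-]|_ [_ /codomP[i ->] <-]]; last by exists i.
  by exists (f i) => //; apply: codom_f.
by move=> i x0; rewrite -fE; congr v; rewrite (nth_map i) ?size_enum_ord // nth_ord_enum.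
Qed.

Variable n : nat.

Lemma transfer_action : homogeneous act H D cl Sigma ->
  n_action act H D cl n -> n_perm_action seqcl induced_aut induced n.
Proof.
move=> hom [_ [rk1 rk2] det]; have [AG _] := hom.
split.
- exact: induced_group.
- exact: induced_cl.
- move=> sg f [t St sgE] [g Hg fE].
  have At := agroup_aut AG St; have [[tH _ _] _] := aaut_group At.
  have [h Ih hE] := induced_lift (tH _ Hg); exists h => // x /=.
  by apply: v_inj; rewrite sgE fE hE sgE (aaut_act At) //; apply: v_carrier.
- move=> x y sx sy ixy; have [x0 _] := sp_infinite Pc [::].
  have [|||g [Hg gE]] := rk1 (fun i => v (nth x0 x i)) (fun i => v (nth x0 y i)).
  + by rewrite range_nth //; apply: v_image_carrier.
  + by rewrite range_nth //; apply: v_image_carrier.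
  + rewrite !range_nth // -image_set_cat mul2n -addnn -{1}sx -sy -size_cat.
    exact: ind_dim.
  have [f If fE] := induced_lift Hg; exists f => //.
  apply: (@eq_from_nth _ x0); rewrite size_map sx ?sy // => i it.
  by apply: v_inj; rewrite (nth_map x0) ?sx // fE (gE (Ordinal it)).
- have [x [y [xD yD dxy nm]]] := rk2.
  have [xs [sx xE xn]] := range_seq xD; have [ys [sy yE yn]] := range_seq yD.
  have [|s [ss is_ sxy]] := dim_ind IP _ dxy; first by move=> p [/xD|/yD].
  exists xs, ys; split=> //.
    (* The independent list [s] has length [2 * n + 2] and lies in [xs ++ ys], which is therefore a
       permutation of it. *)
    have us := ind_uniq Pc is_.
    have sub : {subset s <= xs ++ ys}.
      move=> z zs; have : (v @` [set` xs ++ ys]) (v z).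
        by rewrite image_set_cat -xE -yE; apply: sxy; exists z.
      by case=> w wxy /v_inj <-.
    have sz : (size (xs ++ ys) <= size s)%N by rewrite size_cat sx sy ss; lia.
    have [m u] := uniq_min_size us sub sz.
    by apply: (ind_perm Pc) is_; apply: uniq_perm => //; exact: leq_size_uniq sz.
  move=> f [g Hg fE] fx; apply: nm; exists g; split=> // i.
  have [x0 _] := sp_infinite Pc [::].
  by rewrite (xn i x0) (yn i x0) -fx (nth_map x0) ?sx // fE.
- move=> f f' x [g Hg fE] [g' Hg' fE'] sx ix ff'.
  suff gg' : g = g' by move=> a; apply: v_inj; rewrite fE fE' gg'.
  apply: (det g g' (v @` [set` x])) => //; first exact: v_image_carrier.
    by rewrite -sx; apply: ind_dim.
  by move=> _ [a ax <-]; rewrite -fE -fE' ff'.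
Qed.

Lemma transfer_generic X f g : (forall x, v (f x) = act g (v x)) ->
  generic_over seqcl n X f -> generic act D cl n (v @` [set` X]) g.
Proof.
move=> fE [x [sx ix]]; have [x0 _] := sp_infinite Pc [::].
exists (fun i => v (nth x0 x i)); rewrite range_nth //.
have ux := ind_uniq Pc (ind_catl Pc ix).
split.
- exact: v_image_carrier.
- move=> i j /v_inj /eqP; rewrite nth_uniq ?sx // => /eqP ij; exact: ord_inj.
- move=> _ [b bx <-]; rewrite set0U => cb.
  apply: (full_ind Pc (ind_catl Pc ix) bx).
  have [Pcl _ _ _] := IP; apply: (cl_monotone Pcl) cb; last exact: v_image_carrier.
  rewrite image_set_cat => p [[y yx <-] yb]; left.
  exists y => //=; rewrite mem_filter; apply/andP; split=> //.
  by apply/eqP => yb'; apply: yb; rewrite yb'.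
- have -> : range (act g \o (fun i : 'I_n => v (nth x0 x i))) = v @` [set` map f x].
    rewrite image_set_map.
    transitivity (act g @` range (fun i : 'I_n => v (nth x0 x i))).
      by rewrite image_comp.
    by rewrite range_nth // image_comp; apply: eq_imagel => y _ /=; rewrite fE.
  rewrite -image_set_cat; have -> : (2 * n = size (x ++ map f x))%N.
    by rewrite size_cat size_map sx mul2n addnn.
  exact: ind_dim_over.
Qed.

Lemma transfer_unique_generics : homogeneous act H D cl Sigma ->
  unique_generics act H D cl Sigma n ->
  seq_unique_generics seqcl induced_aut induced n.
Proof.
move=> [AG _] UG X f f' [g Hg fE] [g' Hg' fE'] gf gf'.
have : tp Sigma (v @` [set` X]) g = tp Sigma (v @` [set` X]) g'.
  apply: UG => //; [exact/finite_image/finite_seq|exact: v_image_carrier| |];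
  exact: transfer_generic.
(* Through the identity, [g'] lies in its own orbit, hence in that of [g]: this yields the
   conjugating automorphism. *)
have : tp Sigma (v @` [set` X]) g' g'.
  by exists (idfun, idfun) => //; split; [exact: agroup_one AG|].
move=> /[swap] <- [s [Ss sX] sg].
have As := agroup_aut AG Ss; have [[sD _ _] _] := aaut_pregeometry As.
have [sgm sgmE] := lift_perm sD; exists sgm; split.
- by exists s.
- by move=> x xX; apply: v_inj; rewrite sgmE sX //; exists x.
- move=> x /=; apply: v_inj.
  by rewrite sgmE fE fE' sgmE (aaut_act As) ?sg //; apply: v_carrier.
Qed.

End Transfer.

(** * Actions of rank one *)

Lemma card_le_injection (T U : Type) (A : set T) (B : set U) (f : T -> U) :
  set_fun A B f -> set_inj A f -> (A #<= B)%card.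
Proof.
move=> fAB fi; have [g] : $|{injfun A >-> B}| by apply/injfunPex; exists f.
exact: inj_card_le.
Qed.

Lemma injection_card_le (T U : Type) (B : set U) : ([set: T] #<= B)%card ->
  exists f : T -> U, injective f /\ forall x, B (f x).
Proof.
move=> /card_leP[f]; pose i (t : T) : [set: T] := SigSub (mem_setT t).
exists (fun t => val (f (i t))); split=> [t u /val_inj fE|t]; last first.
  exact: set_mem (valP (f (i t))).
have := 'inj_f (mem_setT _) (mem_setT _) fE.
by move=> /(congr1 val).
Qed.

(** Hilbert's hotel along an embedded copy of the natural numbers that avoids [x]. *)
Lemma card_le_setD1 (T : Type) (A : set T) (x : T) :
  infinite_set A -> (A #<= A `\ x)%card.
Proof.
move=> iA; have [Ax|nAx] := pselect (A x); last first.
  apply: subset_card_le => y Ay; split=> // yx; apply: nAx; by rewrite -yx.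
have : infinite_set (A `\ x) by apply: infinite_setD; [|exact: finite_set1].
move=> /infiniteP /injection_card_le[i [i_inj iE]].
pose F y := if pselect (y = x) then i 0 else
  if pselect (exists k, y = i k) is left e then i (projT1 (cid e)).+1 else y.
have Fi k : F (i k) = i k.+1.
  rewrite /F; case: (pselect (i k = x)) => [ikx|nikx]; first by have [_ /(_ ikx)] := iE k.
  case: (pselect (exists j, i k = i j)) => [e|[]]; last by exists k.
  by case: (cid e) => j /= /i_inj ->.
have Fx : F x = i 0 by rewrite /F; case: (pselect (x = x)).
have Fo y : y <> x -> ~ (exists k, y = i k) -> F y = y.
  by move=> yx yi; rewrite /F; case: (pselect (y = x)) => // ?; case: (pselect (exists k, y = i k)).
apply: (@card_le_injection _ _ _ _ F).
  move=> y Ay; have [->|yx] := pselect (y = x); first by rewrite Fx.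
  have [[k ->]|ni] := pselect (exists k, y = i k); first by rewrite Fi.
  by rewrite Fo.
have cases y : [\/ y = x, exists k, y = i k | y <> x /\ ~ (exists k, y = i k)].
  have [->|yx] := pselect (y = x); first by constructor 1.
  have [yi|ni] := pselect (exists k, y = i k); first by constructor 2.
  by constructor 3.
move=> y z _ _; case: (cases y) => [->|[k ->]|[yx yi]];
  case: (cases z) => [->|[l ->]|[zx zi]] //; rewrite ?Fx ?Fi ?(Fo y) ?(Fo z) //.
- by move/i_inj.
- by move=> zE; case: zi; exists 0%N.
- by move/i_inj.
- by move/i_inj => [->].
- by move=> zE; case: zi; exists k.+1.
- by move=> yE; case: yi; exists 0%N.
- by move=> yE; case: yi; exists l.+1.
Qed.

Lemma finite_subset_image (T U : Type) (f : T -> U) (X : set T) (Y : set U) :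
  finite_set Y -> Y `<=` f @` X ->
  exists Z, [/\ finite_set Z, Z `<=` X & f @` Z = Y].
Proof.
move=> fY YX.
have [g gE] : {g : U -> option T & forall y, Y y ->
    exists x, [/\ g y = Some x, X x & f x = y]}.
  apply: (@choice _ _ (fun y o => Y y -> exists x, [/\ o = Some x, X x & f x = y])) => y.
  have [Yy|nYy] := pselect (Y y); last by exists None.
  by have [x Xx xy] := YX y Yy; exists (Some x) => _; exists x.
exists [set x | (g @` Y) (Some x)]; split.
- apply: (@finite_preimage _ _ (g @` Y) Some); last exact: finite_image.
  by move=> x y _ _ [].
- by move=> x [y Yy] gy; have [x' [+ Xx' _]] := gE y Yy; rewrite gy => -[->].
- apply/seteqP; split=> [_ [x [y Yy gy] <-]|y Yy].
    have [x' [gx' _ xy]] := gE y Yy; move: gx'; rewrite gy => -[->].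
    by rewrite xy.
  by have [x [gy Xx xy]] := gE y Yy; exists x => //; exists y.
Qed.

(** * A pregeometry on the group *)

Section PulledBackPregeometry.
Variables (G : Type) (P : Type) (H : set G) (D : set P) (cl : set P -> set P).
Variables (F : set P) (e : G -> P).
Hypotheses (Pcl : pregeometry D cl) (FD : F `<=` D) (eD : set_fun H D e).

(** The localisation of [cl] at [F], pulled back along [e]. It is used with [F = [set x0]] and
    [e g = act g x0]: automorphisms fixing [x0] intertwine this [e] with their action on the
    group. *)
Definition pullback_cl (X : set G) : set G :=
  [set g | H g /\ cl (F `|` e @` X) (e g)].

Let FeD X : X `<=` H -> F `|` e @` X `<=` D.
Proof. by move=> XH p [/FD //|[g Xg <-]]; apply/eD/XH. Qed.

Lemma pullback_pregeometry : pregeometry H pullback_cl.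
Proof.
split.
- by move=> X _ g [].
- move=> X XH g Xg; split; first exact: XH.
  by apply: (cl_extensive Pcl); [exact: FeD|right; exists g].
- move=> X Y XY YH g [Hg cg]; split=> //.
  by apply: (cl_monotone Pcl) cg; [apply/setUS/image_subset|exact: FeD].
- move=> X XH; have clXH : pullback_cl X `<=` H by move=> g [].
  apply/seteqP; split=> [g [Hg cg]|g [Hg cg]]; split=> //; last first.
    apply: (cl_monotone Pcl) cg; last exact: FeD.
    apply/setUS/image_subset => h Xh; split; first exact: XH.
    by apply: (cl_extensive Pcl); [exact: FeD|right; exists h].
  rewrite -(cl_idempotent Pcl (FeD XH)).
  apply: (cl_monotone Pcl) cg; last exact/(cl_carrier Pcl)/FeD.
  move=> p [Fp|[h [_ ch] <-] //].
  by apply: (cl_extensive Pcl); [exact: FeD|left].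
- move=> X a XH [Ha ca].
  have [Y [fY YX cY]] := cl_finite_character Pcl (FeD XH) ca.
  have fYe : finite_set (Y `&` e @` X) by exact: finite_setIl.
  have [Z [fZ ZX ZE]] := finite_subset_image fYe (@subIsetr _ _ _).
  exists Z; split=> //; split=> //; apply: (cl_monotone Pcl) cY; last first.
    exact/FeD/(subset_trans ZX).
  by rewrite ZE => p Yp; have [Fp|Xp] := YX p Yp; [left|right].
- move=> X a b XH Ha Hb; rewrite /pullback_cl /= => -[_ cab] nca; split=> //.
  move: cab; rewrite !image_setU !image_set1 !setUA.
  move=> /(cl_exchange Pcl); apply; [exact: FeD|exact: eD|exact: eD|].
  by move=> ca; apply: nca.
Qed.

End PulledBackPregeometry.

Lemma finite_set_range (T : Type) (X : set T) : finite_set X ->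
  exists k (x : 'I_k -> T), range x = X.
Proof.
move=> /(@finite_seqP {classic T})[s ->]; exists (size s), (tnth (in_tuple s)).
apply/seteqP; split=> [_ [i _ <-]|x /= /(@seq_tnthP {classic T})]; first exact: mem_tnth.
by move=> [i ->]; exists i.
Qed.

Section ClosureExpansion.
Variables (G : groupType) (H : set G) (cl : set G -> set G).
Hypothesis Pcl : pregeometry H cl.

(** One relation for each arity makes the automorphisms of the expansion preserve closures of finite
    sets, hence by finite character the whole pregeometry. *)
Definition closure_relation (k : nat) : set ('I_k.+1 -> G) :=
  [set x | cl (range (fun i : 'I_k => x (lift ord0 i))) (x ord0)].
Arguments closure_relation : clear implicits.

Lemma closure_relation_cons k (y : 'I_k -> G) a (f : G -> G) :
  closure_relation k (fun j => f (if unlift ord0 j is Some i then y i else a))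
  = cl (f @` range y) (f a).
Proof.
rewrite /closure_relation /= unlift_none; congr (cl _ _).
by rewrite image_comp; apply: eq_imagel => i _; rewrite liftK.
Qed.

Lemma expansion_finite f X a :
  expansion_automorphism H closure_relation f ->
  finite_set X -> X `<=` H -> H a -> cl X a <-> cl (f @` X) (f a).
Proof.
move=> [_ fR] fX XH Ha; have [k [y yX]] := finite_set_range fX.
have := fR k (fun j => if unlift ord0 j is Some i then y i else a).
have -> : f \o (fun j : 'I_k.+1 => if unlift ord0 j is Some i then y i else a) =
   (fun j => f (if unlift ord0 j is Some i then y i else a)) by [].
rewrite (closure_relation_cons y a f) (closure_relation_cons y a id) yX image_id.
apply=> _ [j _ <-]; case: unliftP => [i _|_] //.
by apply: XH; rewrite -yX; exists i.
Qed.

Lemma expansion_cl_automorphism f :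
  expansion_automorphism H closure_relation f ->
  cl_automorphism H cl f.
Proof.
move=> Ef; have [[fb _] _] := Ef; split=> // X XH.
have [fH finj fsurj] := fb.
have fXH : f @` X `<=` H by move=> _ [x Xx <-]; apply/fH/XH.
apply/seteqP; split=> [_ [a ca <-]|b cb].
  have [Y [fY YX cY]] := cl_finite_character Pcl XH ca.
  have YH := subset_trans YX XH.
  have := (expansion_finite Ef fY YH (cl_carrier Pcl XH ca)).1 cY.
  by apply: (cl_monotone Pcl) => //; apply: image_subset.
have [Z [fZ ZX cZ]] := cl_finite_character Pcl fXH cb.
have [Y [fY YX YZ]] := finite_subset_image fZ ZX.
have [a Ha ab] := fsurj _ (cl_carrier Pcl fXH cb).
have YH := subset_trans YX XH.
exists a => //; apply: (cl_monotone Pcl YX XH).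
by apply/(expansion_finite Ef fY YH Ha); rewrite YZ ab.
Qed.

End ClosureExpansion.

(** The base [s] of the proof contains [x], a generic [z] and their images under all [F i], so the
    automorphism supplied by uniqueness of generics commutes with each [F i] by 2-determinacy. As
    [closure_image] puts [F i z] in the closure of [z], [x] and [F i x], the enlarged base leaves
    [f] and [g] generic. *)
Lemma rank_one_homogeneous (T : eqType) (c : seq T -> T -> Prop)
    (Sigma S : set (T -> T)) (J : eqType) (F : J -> T -> T) (r : seq J)
    (x : T) (f g : T -> T) :
  seq_pregeometry c -> seq_homogeneous c Sigma ->
  n_perm_action c Sigma S 1 -> seq_unique_generics c Sigma S 1 ->
  (forall i, i \in r -> S (F i)) -> S f -> S g ->
  ~ c (x :: [seq F i x | i <- r]) (f x) -> ~ c (x :: [seq F i x | i <- r]) (g x) ->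
  exists sg, [/\ Sigma sg, sg x = x, forall i, i \in r -> sg \o F i =1 F i \o sg
    & sg \o f =1 g \o sg].
Proof.
move=> Pc Hom Act UG SF Sf Sg nf ng.
have nx : ~ c [::] x by exact: sp_nil Pc x.
have [z nz] := sp_infinite Pc (f x :: g x :: x :: [seq F i x | i <- r]).
pose s := x :: z :: [seq F i x | i <- r] ++ [seq F i z | i <- r].
have sz a : c s a -> c (z :: x :: [seq F i x | i <- r]) a.
  apply: (sp_trans Pc) => b; rewrite !inE mem_cat => /or4P[bE|bE|bE|].
  1-3: by apply: (sp_in Pc); rewrite !inE bE ?orbT.
  case/mapP => i ir ->; have := closure_image Pc Hom Act z (SF i ir)
    (erefl : size [:: x] = 1) (conj nx I).
  apply: (sp_sub Pc) => y; rewrite !inE => /or3P[->//|->|/eqP->]; first by rewrite orbT.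
  by apply/orP; right; apply/orP; right; apply/mapP; exists i.
have gen h : S h -> ~ c (x :: [seq F i x | i <- r]) (h x) ->
    ~ c (h x :: x :: [seq F i x | i <- r]) z -> generic_over c 1 s h.
  move=> Sh nh nzh; apply: (generic_image Pc Hom Act Sh (erefl : size [:: x] = 1)).
  - by move=> y; rewrite !inE => /eqP->; rewrite eqxx.
  - by split.
  - by split=> // /sz; have [] := gen_swap Pc nh nzh.
have [||sg [Ssg sgs sgE]] := UG s f g Sf Sg.
- by apply: gen => //; apply: contra_not nz; apply: (sp_sub Pc); submem.
- by apply: gen => //; apply: contra_not nz; apply: (sp_sub Pc); submem.
exists sg; split=> //; first by apply: sgs; rewrite mem_head.
move=> i ir; apply: (npa_fix Act (SF i ir) Ssg (t := [:: z; x])) => //.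
- by split; [apply: contra_not nz; apply: (sp_sub Pc)|split=> // cx; apply: nz;
    apply: (sp_sub Pc) (sp_exchange Pc cx nx)]; submem.
- by move=> y; rewrite !inE => /orP[]/eqP->; apply: sgs; rewrite !inE eqxx ?orbT.
- move=> y /=; rewrite !inE => /orP[]/eqP->; apply: sgs;
    rewrite !(inE, mem_cat) ?(map_f (fun i => F i _)) ?orbT //.
Qed.

Section RankOne.
Variables (G : groupType) (P : Type) (T : choiceType) (v : T -> P).
Variables (D : set P) (cl : set P -> set P) (act : G -> P -> P) (H : set G).
Variable Sigma : set ((G -> G) * (P -> P)).
Hypotheses (v_inj : injective v) (v_range : forall p, D p <-> exists t, v t = p).
Hypothesis NA : n_action act H D cl 1.
Hypothesis Hom : homogeneous act H D cl Sigma.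
Hypothesis UG : unique_generics act H D cl Sigma 1.

Let PA : pregeometric_action act H D cl. Proof. by case: NA. Qed.
Let IP := pact_pregeometry PA.
Let Pcl : pregeometry D cl. Proof. by case: IP. Qed.
Let c := seqcl v cl.
Let Pc : seq_pregeometry c := transfer_pregeometry v_range IP.
Let S := induced v act H.
Let Sg := induced_aut v Sigma.
Let Hc : seq_homogeneous c Sg := transfer_homogeneous v_inj v_range Hom.
Let Act : n_perm_action c Sg S 1 := transfer_action v_inj v_range PA Hom NA.
Let UGc : seq_unique_generics c Sg S 1 := transfer_unique_generics v_inj v_range PA Hom UG.

Lemma rank_one_faithful g h : H g -> H h ->
  (forall x, act g (v x) = act h (v x)) -> g = h.
Proof.
have [_ _ det] := NA; move=> Hg Hh gh.
have [s ss is_] := ind_extend Pc [::] 2.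
apply: (det g h (v @` [set` s])) => //; first exact: (v_image_carrier v_range).
  by rewrite -ss; apply: (ind_dim v_inj v_range IP Pc).
by move=> _ [x _ <-].
Qed.

Lemma rank_one_closure_automorphism x0 : D x0 -> forall s, Sigma s -> s.2 x0 = x0 ->
  expansion_automorphism H
    (closure_relation (pullback_cl H cl [set x0] (fun g => act g x0))) s.1.
Proof.
move=> Dx0 s Ss sx0; have [AG _] := Hom.
have As := agroup_aut AG Ss; split; first exact: aaut_group As.
have [[sH sinj _] _] := aaut_group As.
have [[sD s2inj _] scl] := aaut_pregeometry As.
move=> k x xH; pose a := x ord0.
pose Y := range (fun i : 'I_k => x (lift ord0 i)).
pose Y' := range (fun i : 'I_k => s.1 (x (lift ord0 i))).
pose clH := pullback_cl H cl [set x0] (fun g => act g x0).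
change (clH Y a <-> clH Y' (s.1 a)).
have Ha : H a by apply: xH; exists ord0.
have YH : Y `<=` H by move=> _ [i _ <-]; apply: xH; exists (lift ord0 i).
have Y'E : Y' = s.1 @` Y.
  by rewrite image_comp; apply: eq_imagel => i _.
have sact g : H g -> act (s.1 g) x0 = s.2 (act g x0).
  by move=> Hg; rewrite (aaut_act As) // sx0.
have YD : [set x0] `|` (fun g => act g x0) @` Y `<=` D.
  by move=> p [->//|[g Yg <-]]; apply: (pact_carrier PA); [apply: YH|].
have YE : [set x0] `|` (fun g => act g x0) @` Y' =
    s.2 @` ([set x0] `|` (fun g => act g x0) @` Y).
  rewrite image_setU image_set1 sx0 Y'E !image_comp; congr (_ `|` _).
  by apply: eq_imagel => i _ /=; apply: sact; apply: YH; exists i.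
rewrite /clH /pullback_cl /= YE -(scl _ YD) sact //.
have Da : D (act a x0) by exact: (pact_carrier PA).
split=> -[_ ca]; split=> //; first exact: sH.
case: ca => p cp /s2inj pE; rewrite -pE //; apply: mem_set => //.
exact: (cl_carrier Pcl YD).
Qed.
(** [rank_one_homogeneous] with [r] a listing of [X]; by faithfulness, commuting with the
    permutation induced by [g] means fixing [g]. *)
Lemma rank_one_closure_homogeneous x0 (X : set G) a b :
  let clH := pullback_cl H cl [set x0] (fun g => act g x0) in
  D x0 -> finite_set X -> X `<=` H -> (H `\` clH X) a -> (H `\` clH X) b ->
  exists f, [/\ expansion_automorphism H (closure_relation clH) f,
    fixes X f & f a = b].
Proof.
move=> clH Dx0 /finite_seqP[r XE] XH [Ha na] [Hb nb].
have [t0 t0E] := (v_range x0).1 Dx0.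
have [F FE] : {F : G -> T -> T & forall g, H g ->
    S (F g) /\ forall x, v (F g x) = act g (v x)}.
  apply: (@choice _ _ (fun g f => H g -> S f /\ forall x, v (f x) = act g (v x))) => g.
  have [Hg|nHg] := pselect (H g); last by exists id.
  by have [f Sf fE] := induced_lift v_range PA Hg; exists f.
have rH g : g \in r -> H g by move=> gr; apply: XH; rewrite XE.
have cE g : H g -> c (t0 :: [seq F i t0 | i <- r]) (F g t0) -> clH X g.
  move=> Hg; rewrite /c /seqcl (FE g Hg).2 t0E => cg; split=> //.
  apply: (cl_monotone Pcl) cg; last first.
    by move=> p [->//|[h Xh <-]]; apply: (pact_carrier PA) => //; apply: XH.
  rewrite image_set_cons => p [[_ /mapP[g' g'r ->] <-]|->]; [right|left=> //].
  by exists g'; [rewrite XE|rewrite (FE g' (rH _ g'r)).2 t0E].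
have [|||||sg [[s Ss sgE] sgt sgF sgab]] := rank_one_homogeneous Pc Hc Act UGc
   (F := F) (r := r) (x := t0) (f := F a) (g := F b).
- by move=> g gr; have [] := FE g (rH g gr).
- by have [] := FE a Ha.
- by have [] := FE b Hb.
- by move=> /(cE a Ha).
- by move=> /(cE b Hb).
have [AG _] := Hom; have As := agroup_aut AG Ss.
have [[sH _ _] _] := aaut_group As.
have sx0 : s.2 x0 = x0 by rewrite -t0E -sgE sgt.
have [sg' [_ sgK sg'K]] := pg_inv (sh_group Hc) (ex_intro2 _ _ s Ss sgE : Sg sg).
have sE g h : H g -> H h -> sg \o F g =1 F h \o sg -> s.1 g = h.
  move=> Hg Hh gh; apply: rank_one_faithful => [||x]; [exact: sH|by []|].
  rewrite -[x]sg'K sgE -(aaut_act As) //; last exact: (v_carrier v_range).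
  rewrite -(FE g Hg).2 -sgE; have /= -> := gh (sg' x).
  by rewrite (FE h Hh).2 sgE.
exists s.1; split.
- exact: rank_one_closure_automorphism.
- by move=> g Xg; have Hg := XH g Xg; apply: sE => //; apply: sgF; rewrite XE in Xg.
- exact: sE.
Qed.

Lemma rank_one_move x y : ~ c [:: x] y ->
  exists2 g, H g & act g (v x) = v y.
Proof.
move=> nxy; have [|f [g Hg fE] [fx]] := npa_rank Act (x := [:: x]) (y := [:: y]) erefl erefl.
  by split; [exact: (sp_nil Pc)|split].
by exists g => //; rewrite -fE fx.
Qed.

Lemma rank_one_transitive x y : exists2 g, H g & act g (v x) = v y.
Proof.
have [z nz] := sp_infinite Pc [:: x; y].
have [|g Hg gx] := @rank_one_move x z.
  by apply: contra_not nz; apply: (sp_sub Pc); submem.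
have [|h Hh hz] := @rank_one_move z y.
  move=> czy; apply: nz; have := sp_exchange Pc czy (@sp_nil _ _ Pc y).
  by apply: (sp_sub Pc); submem.
exists (h * g)%g; first exact: (subgroupM (pact_subgroup PA)).
by rewrite (pact_mul PA) ?gx //; apply: (v_carrier v_range).
Qed.

Lemma basis_generic (B : set P) x y : basis_over cl set0 D B -> B (v x) ->
  B (v y) -> v x <> v y -> ~ c [:: x] y.
Proof.
move=> [BD iB _] Bx By xy cxy; apply: (iB _ By); rewrite set0U.
move: cxy; rewrite /c /seqcl image_set_cons image_set_nil set0U.
apply: (cl_monotone Pcl) => [p ->|p [/BD //]].
by split.
Qed.

(* Fibers of [g |-> g x0] embed in [c [:: z; x0]] outside [c [:: x0]]; by homogeneity
   the copies of this set over the elements of a basis embed disjointly in [D]. *)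
Lemma rank_one_card_le (B : set P) : basis_over cl set0 D B -> (B #= D)%card ->
  (H #<= D)%card.
Proof.
move=> bB BD; have [Bsub iB DB] := bB.
have iD : infinite_set B.
  move=> [k Bk]; have [_ _ ndim _] := IP; apply: (ndim k); by exists B.
have [p0 Bp0] := infinite_setN0 iD; have [x0 x0E] := (v_range p0).1 (Bsub _ Bp0).
have TB : ([set: T] #<= B `\ p0)%card.
  apply: card_le_trans (card_le_setD1 p0 iD).
  rewrite (card_le_eqr BD); apply: (@card_le_injection _ _ _ _ v) => [t _|t u _ _].
    exact: (v_carrier v_range).
  exact: v_inj.
have [be [be_inj beB]] := injection_card_le TB.
have be_gen t : exists2 b, v b = be t & ~ c [:: x0] b.
  have [Bb nb] := beB t; have [b bE] := (v_range _).1 (Bsub _ Bb).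
  exists b => //; apply: (basis_generic bB); rewrite ?x0E ?bE //.
  by move=> bp; apply: nb.
have [z nz] := sp_infinite Pc [:: x0].
have [sg sgE] : {sg : T -> T -> T & forall t, [/\ Sg (sg t), sg t x0 = x0 &
    v (sg t z) = be t]}.
  apply: (@choice _ _ (fun t f => [/\ Sg f, f x0 = x0 & v (f z) = be t])) => t.
  have [b bE nb] := be_gen t; have [f [Sf fx fz]] := sh_move Hc nz nb.
  by exists f; split=> //; [apply: fx; rewrite mem_head|rewrite fz].
have [k kE] : {k : T -> G & forall t, H (k t) /\ act (k t) (v x0) = v t}.
  apply: (@choice _ _ (fun t g => H g /\ act g (v x0) = v t)) => t.
  by have [g Hg gt] := rank_one_transitive x0 t; exists g.
have [l lE] : {l : G -> T -> T & forall g, H g ->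
    S (l g) /\ forall x, v (l g x) = act g (v x)}.
  apply: (@choice _ _ (fun g f => H g -> S f /\ forall x, v (f x) = act g (v x))) => g.
  have [Hg|nHg] := pselect (H g); last by exists id.
  by have [f Sf fE] := induced_lift v_range PA Hg; exists f.
(* [k t] is a chosen element sending [x0] to [t], so [k^-1 g] fixes [x0] and [w g] is its value at
   [z]. Together with [l g x0] it determines [g], by 2-determinacy. *)
pose w g := l ((k (l g x0))^-1 * g)%g z.
have HV := subgroupV (pact_subgroup PA); have HM := subgroupM (pact_subgroup PA).
have wE g : H g -> act (k (l g x0)) (v (w g)) = act g (v z).
  move=> Hg; have [Hk _] := kE (l g x0); have Hkg := HM _ _ (HV _ Hk) Hg.
  rewrite (lE _ Hkg).2 -(pact_mul PA) //; last exact: (v_carrier v_range).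
  by rewrite mulgA mulgV mul1g.
have wc g : H g -> c [:: z; x0] (w g) /\ ~ c [:: x0] (w g).
  move=> Hg; have [Hk kx] := kE (l g x0); have Hkg := HM _ _ (HV _ Hk) Hg.
  have [Sl lv] := lE _ Hkg.
  have lx0 : l ((k (l g x0))^-1 * g)%g x0 = x0.
    apply: v_inj; rewrite lv (pact_mul PA) //; [|exact: HV|exact: (v_carrier v_range)].
    rewrite -(lE g Hg).2 -kx -(pact_mul PA) //; [|exact: HV|exact: (v_carrier v_range)].
    by rewrite mulVg (pact_one PA) //; exact: (v_carrier v_range).
  split.
    have := closure_image Pc Hc Act z Sl (erefl : size [:: x0] = 1)
      (conj (sp_nil Pc (a := x0)) I).
    by rewrite /= lx0; apply: (sp_sub Pc); submem.
  have [f [Sf lK fK]] := pg_inv (npa_group Act) Sl.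
  move=> /(npa_cl Act Sf); rewrite /w lK /= => cz; apply: nz; move: cz.
  by rewrite -{1}lx0 lK.
pose Phi g := v (sg (l g x0) (w g)).
apply: (@card_le_injection _ _ _ _ Phi); first by move=> g _; apply: (v_carrier v_range).
move=> g h; rewrite !inE => Hg Hh /v_inj ghE.
have sgw g' : H g' -> exists b, [/\ v b = be (l g' x0), ~ c [:: x0] b,
    c [:: b; x0] (sg (l g' x0) (w g')) & ~ c [:: x0] (sg (l g' x0) (w g'))].
  move=> Hg'; have [Sgf fx fz] := sgE (l g' x0); have [c1 c2] := wc _ Hg'.
  have [b bE nb] := be_gen (l g' x0); exists b; split=> //.
    have := sh_cl Hc Sgf c1; rewrite /= fx.
    by have -> : sg (l g' x0) z = b by apply: v_inj; rewrite fz bE.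
  have [f [Sf lK fK]] := pg_inv (sh_group Hc) Sgf.
  move=> /(sh_cl Hc Sf); rewrite lK /= => cz; apply: c2; move: cz.
  by rewrite -{1}fx lK.
have lgh : l g x0 = l h x0.
  (* A common value of [Phi] over distinct basis elements would make one of them depend on the other
     and [x0]. *)
  apply: be_inj; apply: contrapT => bgh.
  have [b [bE nb cb nc]] := sgw g Hg; have [b' [bE' nb' cb' _]] := sgw h Hh.
  have Bb : (B `\ p0) (v b) by rewrite bE.
  have Bb' : (B `\ p0) (v b') by rewrite bE'.
  have cbb : c [:: b'; x0] b.
    have := sp_exchange Pc cb nc; apply: (sp_trans Pc) => y.
    rewrite !inE => /orP[]/eqP->; first by rewrite ghE.
    by apply: (sp_in Pc); rewrite !inE eqxx orbT.
  apply: (iB (v b) Bb.1); rewrite set0U.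
  move: cbb; rewrite /c /seqcl !image_set_cons image_set_nil set0U x0E.
  apply: (cl_monotone Pcl) => [p [->|->]|p [/Bsub //]].
    by split=> // pb; apply: Bb.2.
  by split; [exact: Bb'.1|rewrite /= bE bE' => /esym].
have [Sgf _ _] := sgE (l h x0); have [f [_ sgK _]] := pg_inv (sh_group Hc) Sgf.
move: ghE; rewrite lgh => /(can_inj sgK) wgh.
have [[Sl lv] [Sl' lv']] := (lE g Hg, lE h Hh).
have gh : l g =1 l h.
  apply: (npa_det Act Sl Sl' (x := [:: x0; z])) => //.
    by split; [exact: (sp_nil Pc)|split].
  move=> y; rewrite !inE => /orP[]/eqP-> //; apply: v_inj.
  by rewrite lv lv' -(wE g) // -(wE h) // wgh lgh.
by apply: rank_one_faithful => // x; rewrite -lv -lv' gh.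
Qed.

(** For each basis point [p] other than [x0] choose one group element sending [x0] to [p]; [x0]
    itself is absorbed by the localisation. *)
Lemma rank_one_lifted_basis (B : set P) x0 : basis_over cl set0 D B ->
  B (v x0) -> infinite_set B ->
  exists BH, [/\ basis_over (pullback_cl H cl [set v x0] (fun g => act g (v x0)))
    set0 H BH & (BH #= B `\ v x0)%card].
Proof.
move=> bB Bx0 iB; have [BD indB DB] := bB.
have [g gE] : {g : P -> G & forall p, (B `\ v x0) p -> H (g p) /\ act (g p) (v x0) = p}.
  apply: (@choice _ _ (fun p h => (B `\ v x0) p -> H h /\ act h (v x0) = p)) => p.
  have [[Bp px]|nBp] := pselect ((B `\ v x0) p); last by exists 1%g.
  have [t tp] := (v_range p).1 (BD _ Bp).
  have [|h Hh hE] := @rank_one_move x0 t.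
    by apply: (basis_generic bB); rewrite ?tp // => xp; apply: px.
  by exists h => _; rewrite hE.
exists (g @` (B `\ v x0)); split; last first.
  apply: inj_card_eq => p q /set_mem Bp /set_mem Bq pq.
  by rewrite -(gE p Bp).2 -(gE q Bq).2 pq.
split.
- by move=> _ [p Bp <-]; have [] := gE p Bp.
- move=> _ [p Bp <-] [_]; have [Hg ->] := gE p Bp; rewrite set0U => cp.
  apply: (indB p Bp.1); rewrite set0U; apply: (cl_monotone Pcl) cp => [q|q [/BD //]].
  case=> [->|[_ [[r Br <-] rp] <-]]; first by split=> // xp; apply: Bp.2.
  have [_ ->] := gE r Br; split; first exact: Br.1.
  by move=> rp'; apply: rp; rewrite rp'.
- move=> h Hh; split=> //; rewrite set0U.
  have : cl (set0 `|` B) (act h (v x0)).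
    by apply/DB/(pact_carrier PA) => //; apply: (v_carrier v_range).
  rewrite set0U; apply: (cl_monotone Pcl) => [p Bp|].
    have [->|px] := pselect (p = v x0); first by left.
    have Bp' : (B `\ v x0) p by [].
    by right; exists (g p); [exists p|have [] := gE p Bp'].
  move=> p [->|[_ [q Bq <-] <-]]; first exact: BD.
  by have [_ ->] := gE q Bq; apply: BD; apply: Bq.1.
Qed.

Lemma rank_one_basis : exists B x0,
  [/\ basis_over cl set0 D B, (B #= D)%card, infinite_set B & B (v x0)].
Proof.
have [_ _ ndim [B [bB BD]]] := IP; have [Bsub _ _] := bB.
have iB : infinite_set B by move=> [k Bk]; apply: (ndim k); exists B.
have [p Bp] := infinite_setN0 iB; have [x0 x0E] := (v_range p).1 (Bsub _ Bp).
by exists B, x0; rewrite x0E.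
Qed.

Lemma rank_one_card_ge : (D #<= H)%card.
Proof.
have [B [x0 [bB BD iB Bx0]]] := rank_one_basis.
have [BH [[BHH _ _] cBH]] := rank_one_lifted_basis bB Bx0 iB.
rewrite -(card_le_eql BD); apply: card_le_trans (card_le_setD1 (v x0) iB) _.
by rewrite -(card_le_eql cBH); apply: subset_card_le.
Qed.

Lemma rank_one_non_classical : ~ abelian_set H -> non_classical H.
Proof.
move=> nab; split=> //.
have [B [x0 [bB BD iB Bx0]]] := rank_one_basis.
pose clH := pullback_cl H cl [set v x0] (fun g => act g (v x0)).
have Dx0 : D (v x0) by apply: (v_carrier v_range).
have Pclh : pregeometry H clH.
  apply: (pullback_pregeometry Pcl); first by move=> p ->.
  by move=> g Hg; apply: (pact_carrier PA).
exists nat, (fun k => k.+1), (closure_relation clH); split.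
  have : infinite_set D.
    move=> fD; apply: iB; apply: card_le_finite fD.
    by rewrite (card_le_eql BD).
  by apply: contra_not; apply: card_le_finite; exact: rank_one_card_ge.
exists clH; split=> //.
- by move=> f; apply: expansion_cl_automorphism.
- have [BH [bBH cBH]] := rank_one_lifted_basis bB Bx0 iB.
  exists BH; split=> //; have [BHH _ _] := bBH.
  apply/card_eqPle; split; first exact: subset_card_le.
  apply: card_le_trans (rank_one_card_le bB BD) _.
  rewrite -(card_le_eql BD); apply: card_le_trans (card_le_setD1 (v x0) iB) _.
  by rewrite (card_le_eqr cBH).
- by move=> X a b fX XH Ha Hb; apply: rank_one_closure_homogeneous.
Qed.

End RankOne.

(** * Sharply 2-transitive groups with abelian stabilizers *)

Record field_operations (T : choiceType) := FieldOperations {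
  fo_zero : T;
  fo_one : T;
  fo_add : T -> T -> T;
  fo_mul : T -> T -> T;
  fo_opp : T -> T;
  fo_inv : T -> T;
  fo_addA : associative fo_add;
  fo_addC : commutative fo_add;
  fo_add0 : left_id fo_zero fo_add;
  fo_addN : left_inverse fo_zero fo_opp fo_add;
  fo_mulA : associative fo_mul;
  fo_mulC : commutative fo_mul;
  fo_mul1 : left_id fo_one fo_mul;
  fo_mulD : left_distributive fo_mul fo_add;
  fo_one_neq0 : fo_one != fo_zero;
  fo_mulV : forall x, x != fo_zero -> fo_mul (fo_inv x) x = fo_one;
  fo_inv0 : fo_inv fo_zero = fo_zero
}.

(** An alias of [T] that carries the field instances, leaving [T] itself untouched. *)
Definition field_of T (O : field_operations T) : Type := T.
HB.instance Definition _ T (O : field_operations T) := Choice.on (field_of O).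
HB.instance Definition _ T (O : field_operations T) :=
  GRing.isZmodule.Build (field_of O)
    (@fo_addA T O) (@fo_addC T O) (@fo_add0 T O) (@fo_addN T O).
HB.instance Definition _ T (O : field_operations T) :=
  GRing.Zmodule_isComNzRing.Build (field_of O) (@fo_mulA T O) (@fo_mulC T O)
    (@fo_mul1 T O) (@fo_mulD T O) (@fo_one_neq0 T O).
HB.instance Definition _ T (O : field_operations T) :=
  GRing.ComNzRing_isField.Build (field_of O) (@fo_mulV T O) (@fo_inv0 T O).

Record abelian_sharp2 (T : Type) (Sigma S : set (T -> T)) : Prop := {
  as_group : perm_group S;
  as_normal : forall sg f, Sigma sg -> S f ->
    exists2 g, S g & sg \o f = g \o sg;
  as_trans : forall x y x' y', x <> y -> x' <> y' ->
    exists f, [/\ S f, f x = x' & f y = y'];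
  as_uniq : forall f g x y, S f -> S g -> x <> y -> f x = g x -> f y = g y ->
    f = g;
  as_abelian : forall f g x, S f -> S g -> f x = x -> g x = x ->
    f \o g = g \o f
}.

Module Sharp2.
Section Sharp2.
Variables (T : choiceType) (c : seq T -> T -> Prop) (Sigma S : set (T -> T)).
Hypothesis (Pc : seq_pregeometry c) (Hom : seq_homogeneous c Sigma).
Hypothesis (Sh : abelian_sharp2 Sigma S).
Variables (o i : T).
Hypothesis oi : o <> i.
Implicit Types (a b x y z : T) (f g h : T -> T).

Definition pinv f : T -> T :=
  if pselect (exists g, [/\ S g, cancel f g & cancel g f]) is left e
  then projT1 (cid e) else f.

Lemma pinvP f : S f -> [/\ S (pinv f), cancel f (pinv f) & cancel (pinv f) f].
Proof.
move=> Sf; rewrite /pinv; case: pselect => [e|n]; first by case: (cid e).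
by case: n; apply: (pg_inv (as_group Sh)).
Qed.

Lemma S_pinv f : S f -> S (pinv f). Proof. by case/pinvP. Qed.
Lemma pinvK f : S f -> cancel f (pinv f). Proof. by case/pinvP. Qed.
Lemma pinvKV f : S f -> cancel (pinv f) f. Proof. by case/pinvP. Qed.
Lemma S_comp f g : S f -> S g -> S (f \o g). Proof. exact: pg_comp (as_group Sh) f g. Qed.
Lemma S_id : S id. Proof. exact: pg_id (as_group Sh). Qed.
Lemma S_inj f : S f -> injective f. Proof. by move/pinvK/can_inj. Qed.

Lemma fix2_id f x y : S f -> x <> y -> f x = x -> f y = y -> f = id.
Proof. by move=> Sf xy fx fy; apply: (as_uniq Sh Sf S_id xy). Qed.

Lemma pinv_fix f x : S f -> f x = x -> pinv f x = x.
Proof. by move=> Sf fx; rewrite -{1}fx pinvK. Qed.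

(* [mu a] is multiplication by [a]. *)
Definition mu_spec : {m : T -> T -> T & forall a, a <> o ->
  [/\ S (m a), m a o = o & m a i = a]}.
Proof.
apply: (@choice _ _ (fun a m => a <> o -> [/\ S m, m o = o & m i = a])) => a.
have [->|ao] := pselect (a = o); first by exists id.
by have [m mP] := as_trans Sh oi (nesym ao); exists m.
Qed.

Definition mu : T -> T -> T := projT1 mu_spec.

Lemma S_mu a : a <> o -> S (mu a). Proof. by move/(projT2 mu_spec) => []. Qed.
Lemma mu_o a : a <> o -> mu a o = o. Proof. by move/(projT2 mu_spec) => []. Qed.
Lemma mu_i a : a <> o -> mu a i = a. Proof. by move/(projT2 mu_spec) => []. Qed.

Lemma mu_neq0 a x : a <> o -> x <> o -> mu a x <> o.
Proof. by move=> ao xo mx; apply: xo; apply: (S_inj (S_mu ao)); rewrite mx mu_o.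
Qed.

Lemma fix_o_mu f x : S f -> f o = o -> x <> o -> f x <> o.
Proof. by move=> Sf fo xo fx; apply: xo; apply: (S_inj Sf); rewrite fo. Qed.

Lemma muE f : S f -> f o = o -> f = mu (f i).
Proof.
move=> Sf fo; have fi : f i <> o by apply: fix_o_mu => //; apply: nesym.
by apply: (as_uniq Sh Sf (S_mu fi) oi); rewrite ?mu_o ?mu_i.
Qed.

Lemma mu_comm a b : a <> o -> b <> o -> mu a \o mu b = mu b \o mu a.
Proof. by move=> ao bo; apply: (as_abelian Sh (x := o)); rewrite ?mu_o //; apply: S_mu. Qed.

Lemma muM a b : a <> o -> b <> o -> mu a \o mu b = mu (mu a b).
Proof.
move=> ao bo; rewrite -{2}(mu_i bo); apply: muE; first by apply: S_comp; apply: S_mu.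
by rewrite /= !mu_o.
Qed.

Lemma mu_commute a b x : a <> o -> b <> o -> mu a (mu b x) = mu b (mu a x).
Proof. by move=> ao bo; have /(congr1 (@^~ x)) := mu_comm ao bo. Qed.

Lemma mu_sym a b : a <> o -> b <> o -> mu a b = mu b a.
Proof. by move=> ao bo; rewrite -{1}(mu_i bo) mu_commute // mu_i. Qed.

Lemma mu_fix b x : b <> o -> b <> i -> mu b x = x -> x = o.
Proof.
move=> bo bi bx; apply: contrapT => xo; apply: bi.
by rewrite -(mu_i bo) (fix2_id (S_mu bo) (nesym xo)) ?mu_o.
Qed.

Lemma mu_one : mu i = id.
Proof.
have io : i <> o := nesym oi.
by apply: (fix2_id (S_mu io) oi); rewrite ?mu_o ?mu_i.
Qed.

Lemma mu_ratio x y : x <> o -> y <> o -> exists2 b, b <> o & mu b x = y.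
Proof.
move=> xo yo; have [f [Sf fo fx]] := as_trans Sh (nesym xo) (nesym yo).
exists (f i); first by apply: fix_o_mu => //; apply: nesym.
by rewrite -muE.
Qed.

(** The homotheties of ratio [b], with all centres. *)
Definition conjugate b : set (T -> T) :=
  [set f | exists2 g, S g & f = g \o mu b \o pinv g].

Lemma conjugate_S b f : b <> o -> conjugate b f -> S f.
Proof.
by move=> bo [g Sg ->]; apply: S_comp (S_comp Sg (S_mu bo)) (S_pinv Sg).
Qed.

Lemma conjugate_fix b f : b <> o -> conjugate b f -> exists p, f p = p.
Proof. by move=> bo [g Sg ->]; exists (g o); rewrite /= pinvK // mu_o. Qed.

Lemma conjugateJ b f g : b <> o -> conjugate b f -> S g ->
  conjugate b (g \o f \o pinv g).
Proof.
move=> bo [h Sh_ ->] Sg; exists (g \o h); first exact: S_comp.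
have Sgh := S_comp Sg Sh_; apply: funext => x /=; congr (g (h (mu b _))).
by apply: (S_inj Sgh); rewrite [RHS]pinvKV //= !pinvKV.
Qed.

Lemma conjugate_mu b : conjugate b (mu b).
Proof.
exists id; first exact: S_id; apply: funext => x /=; congr (mu b _).
exact: esym (pinvK S_id x).
Qed.

(** As [b] is not 1, both conjugators must send [o] to [p]. They differ by an element fixing [o],
    which commutes with [mu b]. *)
Lemma conjugate_same_fix b f g p : b <> o -> b <> i -> conjugate b f ->
  conjugate b g -> f p = p -> g p = p -> f = g.
Proof.
move=> bo bi [h Sh_ ->] [k Sk ->] /= fp gp.
have ho : pinv h p = o.
  by apply: (mu_fix bo bi); apply: (S_inj Sh_); rewrite fp pinvKV.
have ko : pinv k p = o.
  by apply: (mu_fix bo bi); apply: (S_inj Sk); rewrite gp pinvKV.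
have Sm : S (pinv h \o k) by apply: S_comp => //; apply: S_pinv.
have mo : (pinv h \o k) o = o by rewrite /= -{1}ko pinvKV.
have /(congr1 (fun f => h \o f \o pinv k)) := as_abelian Sh (S_mu bo) Sm (mu_o bo) mo.
move=> E; apply: funext => x; have /(congr1 (@^~ x)) /= := E.
by rewrite pinvKV // pinvKV.
Qed.

(** If [f q] differs from [q], let [k] fix [q] and send the centre of [f] to that of [g]. It
    conjugates [f] to [g], so it also fixes the common value [f q], and sharpness gives [k = id]. *)
Lemma conjugate_same_value b f g q : b <> o -> b <> i -> conjugate b f ->
  conjugate b g -> f q = g q -> f = g.
Proof.
move=> bo bi Cf Cg fg; have [fq|fq] := pselect (f q = q).
  by apply: (conjugate_same_fix bo bi Cf Cg fq); rewrite -fg.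
have [[p fp] [p' gp]] := (conjugate_fix bo Cf, conjugate_fix bo Cg).
have qp : q <> p by move=> e; apply: fq; rewrite e.
have qp' : q <> p' by move=> e; apply: fq; rewrite fg e.
have [k [Sk kq kp]] := as_trans Sh qp qp'.
have E : k \o f \o pinv k = g.
  apply: (conjugate_same_fix (p := p') bo bi _ Cg) => //; first exact: conjugateJ.
  by rewrite /= -kp pinvK // fp.
have kf : k (f q) = f q.
  by rewrite [RHS]fg -E /= pinv_fix.
have k1 : k = id by apply: (fix2_id Sk fq).
rewrite -E k1; apply: funext => x /=; congr f.
exact: esym (pinvKV S_id x).
Qed.

Lemma conjugate_trans b q r : b <> o -> b <> i -> q <> r ->
  exists2 f, conjugate b f & f q = r.
Proof.
move=> bo bi qr; have [k [Sk ki kb]] := as_trans Sh (nesym bi) qr.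
exists (k \o mu b \o pinv k); first by exists k.
by rewrite /= -ki pinvK // mu_i.
Qed.

Lemma conjugate_inj b b' f : b <> o -> b <> i -> b' <> o -> conjugate b f ->
  conjugate b' f -> b = b'.
Proof.
move=> bo bi b'o Cf [g Sg fE].
have : conjugate b (mu b').
  have := conjugateJ bo Cf (S_pinv Sg); rewrite fE.
  suff -> : pinv g \o (g \o mu b' \o pinv g) \o pinv (pinv g) = mu b' by [].
  by apply: funext => x /=; rewrite pinvK // pinvKV //; apply: S_pinv.
move=> Cb'; have E : mu b = mu b'.
  apply: (conjugate_same_fix bo bi (conjugate_mu b) Cb' (p := o)); exact: mu_o.
by rewrite -(mu_i bo) E mu_i.
Qed.

Definition through_spec : {E : T -> T -> T & forall b, b <> o -> b <> i ->
  conjugate b (E b) /\ E b o = i}.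
Proof.
apply: (@choice _ _ (fun b f => b <> o -> b <> i -> conjugate b f /\ f o = i)) => b.
have [->|bo] := pselect (b = o); first by exists id.
have [->|bi] := pselect (b = i); first by exists id.
by have [f Cf fo] := conjugate_trans bo bi oi; exists f.
Qed.

(* [E b] is the homothety of ratio [b] sending [o] to [i]. *)
Definition E : T -> T -> T := projT1 through_spec.

Lemma E_conj b : b <> o -> b <> i -> conjugate b (E b).
Proof. by move=> bo bi; have [] := projT2 through_spec b bo bi. Qed.

Lemma E_o b : b <> o -> b <> i -> E b o = i.
Proof. by move=> bo bi; have [] := projT2 through_spec b bo bi. Qed.

Lemma S_E b : b <> o -> b <> i -> S (E b).
Proof. by move=> bo bi; apply: conjugate_S bo (E_conj bo bi). Qed.

(** A base point among the elements sending [o] to [i]: each of them is [sw \o mu a] for some point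
    [a], which serves as its coordinate. *)
Definition swap_spec : {s : T -> T | [/\ S s, s o = i & s i = o]} :=
  cid (as_trans Sh oi (nesym oi)).
Definition sw : T -> T := projT1 swap_spec.
Lemma S_sw : S sw. Proof. by case: (projT2 swap_spec). Qed.
Lemma sw_o : sw o = i. Proof. by case: (projT2 swap_spec). Qed.
Lemma sw_i : sw i = o. Proof. by case: (projT2 swap_spec). Qed.

Lemma sw_mu f : S f -> f o = i -> exists2 a, a <> o & f = sw \o mu a.
Proof.
move=> Sf fo; have Sg := S_comp (S_pinv S_sw) Sf.
have go : (pinv sw \o f) o = o by rewrite /= fo -sw_o pinvK //; apply: S_sw.
exists ((pinv sw \o f) i); first by apply: fix_o_mu => //; apply: nesym.
by rewrite -muE //; apply: funext => x /=; rewrite pinvKV //; apply: S_sw.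
Qed.

(** [kappa b] is the coordinate of [E b], and [kap b] that of [E b \o pinv (mu b)], the candidate
    for the translation sending [o] to [i]. *)
Definition kappa b := pinv sw (E b i).
Definition kap b := pinv sw (E b (pinv (mu b) i)).

Lemma sw_mu_value f : S f -> f o = i ->
  pinv sw (f i) <> o /\ f = sw \o mu (pinv sw (f i)).
Proof.
move=> Sf fo; have [a ao ->] := sw_mu Sf fo.
by rewrite /= mu_i // pinvK //; apply: S_sw.
Qed.

Lemma kappaP b : b <> o -> b <> i -> kappa b <> o /\ E b = sw \o mu (kappa b).
Proof. by move=> bo bi; apply: sw_mu_value; [apply: S_E|apply: E_o]. Qed.

Lemma kapP b : b <> o -> b <> i ->
  kap b <> o /\ E b \o pinv (mu b) = sw \o mu (kap b).
Proof.
move=> bo bi; apply: (sw_mu_value (f := E b \o pinv (mu b))).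
  by apply: S_comp; [apply: S_E|apply/S_pinv/S_mu].
by rewrite /= pinv_fix ?E_o ?mu_o //; apply: S_mu.
Qed.

Lemma kappa_inj b b' : b <> o -> b <> i -> b' <> o -> b' <> i ->
  kappa b = kappa b' -> b = b'.
Proof.
move=> bo bi bo' bi' k; have [_ e] := kappaP bo bi; have [_ e'] := kappaP bo' bi'.
apply: (conjugate_inj bo bi bo' (E_conj bo bi)).
by rewrite e k -e'; apply: E_conj.
Qed.

(** [E m] has a fixed point. The candidate translation has none: a fixed point would give [E b] and
    [mu b] a common value, hence make them equal, though only the second fixes [o]. *)
Lemma kap_kappa b m : b <> o -> b <> i -> m <> o -> m <> i -> kap b <> kappa m.
Proof.
move=> bo bi mo mi bm; have [_ e] := kapP bo bi; have [_ e'] := kappaP mo mi.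
have [q] := conjugate_fix mo (E_conj mo mi); rewrite e' -bm -e /= => Eq.
have Emu : E b = mu b.
  apply: (conjugate_same_value bo bi (E_conj bo bi) (conjugate_mu b)
    (q := pinv (mu b) q)).
  by rewrite Eq pinvKV //; apply: S_mu.
by have := E_o bo bi; rewrite Emu mu_o.
Qed.

Lemma conj_Sigma sg f : Sigma sg -> S f ->
  exists g, [/\ S g, sg \o f = g \o sg & forall x, g (sg x) = sg (f x)].
Proof.
move=> Ss Sf; have [g Sg e] := as_normal Sh Ss Sf.
by exists g; split=> // x; have /(congr1 (@^~ x)) := e.
Qed.

(** * Equivariance under automorphisms fixing the origin and the unit *)

Section Equivariance.
Variable sg : T -> T.
Hypotheses (Ss : Sigma sg) (sgo : sg o = o) (sgi : sg i = i).

Lemma sg_inj : injective sg.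
Proof. by have [g [_ /can_inj]] := pg_inv (sh_group Hom) Ss. Qed.

Lemma sg_neq a x : a <> x -> sg a <> sg x.
Proof. by move=> ax /sg_inj. Qed.

Lemma sg_neqo a : a <> o -> sg a <> o.
Proof. by move=> /sg_neq; rewrite sgo. Qed.

Lemma sg_neqi a : a <> i -> sg a <> i.
Proof. by move=> /sg_neq; rewrite sgi. Qed.

Lemma sg_mu a x : a <> o -> sg (mu a x) = mu (sg a) (sg x).
Proof.
move=> ao; have [g [Sg _ ge]] := conj_Sigma Ss (S_mu ao).
have go : g o = o by rewrite -{1}sgo ge mu_o.
by rewrite -ge (muE Sg go) -{1}sgi ge mu_i.
Qed.

Lemma sg_sw x : sg (sw x) = sw (sg x).
Proof.
have [g [Sg _ ge]] := conj_Sigma Ss S_sw.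
suff e : sw = g by rewrite -ge e.
apply: (as_uniq Sh S_sw Sg oi); first by rewrite -{2}sgo ge sw_o.
by rewrite -{2}sgi ge sw_i.
Qed.

Lemma sg_pinv f g x : S f -> S g -> (forall x, sg (f x) = g (sg x)) ->
  sg (pinv f x) = pinv g (sg x).
Proof. by move=> Sf Sg e; apply: (S_inj Sg); rewrite -e !pinvKV. Qed.

Lemma sg_conjugate b f g : b <> o -> conjugate b f -> S g ->
  (forall x, sg (f x) = g (sg x)) -> conjugate (sg b) g.
Proof.
move=> bo [h Sh_ fE] Sg e; have [k [Sk _ ke]] := conj_Sigma Ss Sh_.
exists k => //; have [sg' [_ _ sgK]] := pg_inv (sh_group Hom) Ss.
apply: funext => x; rewrite -[x]sgK /= -e fE /= -ke sg_mu //.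
by congr (k (mu _ _)); apply: sg_pinv.
Qed.

Lemma sg_E b x : b <> o -> b <> i -> sg (E b x) = E (sg b) (sg x).
Proof.
move=> bo bi; have [g [Sg _ ge]] := conj_Sigma Ss (S_E bo bi).
have [so si] := (sg_neqo bo, sg_neqi bi).
suff e : E (sg b) = g by rewrite -ge e.
apply: (conjugate_same_value so si (E_conj so si) _ (q := o)).
  by apply: (sg_conjugate bo (E_conj bo bi) Sg).
by rewrite -{2}sgo ge !E_o.
Qed.

Lemma sg_kappa b : b <> o -> b <> i -> sg (kappa b) = kappa (sg b).
Proof.
move=> bo bi; rewrite /kappa (sg_pinv _ S_sw S_sw) ?sg_E ?sgi //.
exact: sg_sw.
Qed.

Lemma sg_kap b : b <> o -> b <> i -> sg (kap b) = kap (sg b).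
Proof.
move=> bo bi; have [so si] := (sg_neqo bo, sg_neqi bi).
rewrite /kap (sg_pinv _ S_sw S_sw); last exact: sg_sw.
rewrite sg_E // (sg_pinv _ (S_mu bo) (S_mu so)) ?sgi // => x.
exact: sg_mu.
Qed.

End Equivariance.

(** * Translations obtained from generic ratios *)

Notation gen b := (~ c [:: o; i] b).

Lemma gen_neq b : gen b -> b <> o /\ b <> i.
Proof.
move=> gb; split=> e; apply: gb; rewrite e; apply: (sp_in Pc);
  by rewrite !inE eqxx ?orbT.
Qed.

Lemma sigma_oi s sg : {in [:: o, i & s], sg =1 id} -> sg o = o /\ sg i = i.
Proof. by move=> e; split; apply: e; rewrite !inE eqxx ?orbT. Qed.

Lemma move_gen x b b' : c [:: o; i] x -> gen b -> gen b' ->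
  exists sg, [/\ Sigma sg, sg o = o, sg i = i, sg x = x & sg b = b'].
Proof.
move=> cx gb gb'; have cx' y : c [:: o; i; x] y -> c [:: o; i] y.
  apply: (sp_trans Pc) => z; rewrite !inE => /or3P[]/eqP-> //;
    by apply: (sp_in Pc); rewrite !inE eqxx ?orbT.
have [sg [Ss e eb]] := sh_move Hom (contra_not (@cx' b) gb) (contra_not (@cx' b') gb').
have [so si] := sigma_oi e.
by exists sg; split=> //; apply: e; rewrite !inE eqxx !orbT.
Qed.

Lemma gen_exists s : exists2 b, gen b & ~ c [:: o, i & s] b.
Proof.
have [b nb] := sp_infinite Pc [:: o, i & s]; exists b => //.
by apply: contra_not nb; apply: (sp_sub Pc); submem.
Qed.

(** A value in the closure of [o] and [i] could be held fixed while the ratio moves, against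
    injectivity of [kappa]. *)
Lemma gen_kappa m : gen m -> gen (kappa m).
Proof.
move=> gm ck; have [mo mi] := gen_neq gm.
have [m' gm' nm'] := gen_exists [:: m]; have [mo' mi'] := gen_neq gm'.
have [sg [Ss so si sk sm]] := move_gen ck gm gm'.
apply: nm'; apply: (sp_in Pc); rewrite !inE.
have -> : m' = m; last by rewrite eqxx !orbT.
by apply: kappa_inj => //; rewrite -sk -sm (sg_kappa Ss so si).
Qed.

Lemma kappa_gen a : gen a -> exists m, [/\ m <> o, m <> i & kappa m = a].
Proof.
move=> ga; have [m gm _] := gen_exists [::]; have [mo mi] := gen_neq gm.
have co : c [:: o; i] o by apply: (sp_head Pc).
have [sg [Ss so si _ sm]] := move_gen co (gen_kappa gm) ga.
exists (sg m); split; [exact: sg_neqo|exact: sg_neqi|].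
by rewrite -(sg_kappa Ss so si).
Qed.

(** Every generic point is a value of [kappa], and [kap] avoids those values. *)
Lemma kap_closed b : b <> o -> b <> i -> c [:: o; i] (kap b).
Proof.
move=> bo bi; apply: contrapT => /kappa_gen[m [mo mi km]].
exact: (kap_kappa bo bi mo mi).
Qed.

Lemma kap_const b b' : gen b -> gen b' -> kap b = kap b'.
Proof.
move=> gb gb'; have [bo bi] := gen_neq gb.
have [sg [Ss so si sk sb]] := move_gen (kap_closed bo bi) gb gb'.
by rewrite -sb -(sg_kap Ss so si) // sk.
Qed.

(* The translation sending [o] to [i]; any generic ratio gives the same one. *)
Definition t1 : T -> T :=
  sw \o mu (kap (projT1 (cid2 (gen_exists [::])))).

Lemma t1P b : gen b -> E b = t1 \o mu b.
Proof.
move=> gb; have [bo bi] := gen_neq gb; have [_ e] := kapP bo bi.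
rewrite /t1; case: cid2 => b' gb' _ /=; rewrite (kap_const gb' gb) -e.
by apply: funext => x /=; rewrite pinvK //; apply: S_mu.
Qed.

Lemma t1E : exists2 b, gen b & t1 = E b \o pinv (mu b).
Proof.
have [b gb _] := gen_exists [::]; exists b => //; have [bo bi] := gen_neq gb.
rewrite (t1P gb); apply: funext => x /=; rewrite pinvKV //; exact: S_mu.
Qed.

Lemma S_t1 : S t1.
Proof.
have [b gb ->] := t1E; have [bo bi] := gen_neq gb.
by apply: S_comp; [apply: S_E|apply/S_pinv/S_mu].
Qed.

Lemma t1_o : t1 o = i.
Proof.
have [b gb ->] := t1E; have [bo bi] := gen_neq gb.
by rewrite /= pinv_fix ?E_o ?mu_o //; apply: S_mu.
Qed.

Lemma sg_t1 sg x : Sigma sg -> sg o = o -> sg i = i -> sg (t1 x) = t1 (sg x).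
Proof.
move=> Ss so si; rewrite /t1 /=; case: cid2 => b gb _ /=.
have [bo bi] := gen_neq gb; have [ko _] := kapP bo bi.
rewrite (sg_sw Ss so si) (sg_mu Ss so si) // (sg_kap Ss so si) //.
congr (sw (mu _ _)); apply: kap_const => //.
have [f [Sf fK _]] := pg_inv (sh_group Hom) Ss.
move=> /(sh_cl Hom Sf); rewrite fK /=.
by rewrite -{1}so -{1}si !fK.
Qed.

(* The translation sending [o] to [a]. *)
Definition t a : T -> T := if a == o then id else mu a \o t1 \o pinv (mu a).

Lemma t_zero : t o = id. Proof. by rewrite /t eqxx. Qed.
Lemma tE a : a <> o -> t a = mu a \o t1 \o pinv (mu a).
Proof. by move=> /eqP/negbTE ao; rewrite /t ao. Qed.

Lemma S_t a : S (t a).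
Proof.
have [->|ao] := pselect (a = o); first by rewrite t_zero; apply: S_id.
rewrite tE //; apply: S_comp; last exact/S_pinv/S_mu.
by apply: S_comp; [apply: S_mu|apply: S_t1].
Qed.

Lemma t_o a : t a o = a.
Proof.
have [->|ao] := pselect (a = o); first by rewrite t_zero.
by rewrite tE //= pinv_fix ?mu_o ?t1_o ?mu_i //; apply: S_mu.
Qed.

Lemma mu_t e a x : e <> o -> mu e (t a x) = t (mu e a) (mu e x).
Proof.
move=> eo; have [->|ao] := pselect (a = o); first by rewrite mu_o // t_zero.
have eao := mu_neq0 eo ao; rewrite !tE //=.
rewrite -(muM eo ao) /=; congr (mu e (mu a (t1 _))).
apply: (S_inj (S_comp (S_mu eo) (S_mu ao))) => /=.
rewrite pinvKV; last exact: S_mu.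
by have := pinvKV (S_comp (S_mu eo) (S_mu ao)) (mu e x); rewrite /=.
Qed.

Lemma sg_t sg a x : Sigma sg -> sg o = o -> sg i = i ->
  sg (t a x) = t (sg a) (sg x).
Proof.
move=> Ss so si; have [->|ao] := pselect (a = o); first by rewrite so t_zero.
have sao := sg_neqo Ss so ao.
rewrite !tE //= (sg_mu Ss so si) // (sg_t1 _ Ss so si); congr (mu _ (t1 _)).
apply: sg_pinv => [||y]; [exact: S_mu|exact: S_mu|].
exact: sg_mu.
Qed.

(** Conjugating [E b = t1 \o mu b] by [mu a] turns [t1] into [t a] and leaves [mu b] alone; a
    homothety of ratio [b] is determined by its value at [o]. *)
Lemma conjugate_t b f : gen b -> conjugate b f -> f = t (f o) \o mu b.
Proof.
move=> gb Cf; have [bo bi] := gen_neq gb.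
have [fo|ao] := pselect (f o = o).
  rewrite fo t_zero; apply: (conjugate_same_fix bo bi Cf (conjugate_mu b) fo).
  exact: mu_o.
set a := f o in ao *.
have Ce := conjugateJ bo (E_conj bo bi) (S_mu ao).
have -> : f = mu a \o E b \o pinv (mu a).
  apply: (conjugate_same_value bo bi Cf Ce (q := o)).
  by rewrite /= pinv_fix ?mu_o ?E_o ?mu_i //; apply: S_mu.
rewrite (t1P gb) tE //; apply: funext => x /=; congr (mu a (t1 _)).
apply: (S_inj (S_mu ao)); rewrite mu_commute // !pinvKV //; exact: S_mu.
Qed.

Lemma t_conjugate b a : gen b -> conjugate b (t a \o mu b).
Proof.
move=> gb; have [bo bi] := gen_neq gb.
have [ao|ao] := pselect (a = o); first by rewrite ao t_zero; apply: conjugate_mu.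
have [f Cf fo] := conjugate_trans bo bi (nesym ao).
by rewrite -fo -conjugate_t.
Qed.

Lemma gen_closed s b : c s b -> (forall x, x \in s -> c [:: o; i] x) -> c [:: o; i] b.
Proof. by move=> cb h; apply: (sp_trans Pc) cb. Qed.

Lemma definable_closed s b : (forall sg, Sigma sg -> sg o = o -> sg i = i ->
  {in s, sg =1 id} -> sg b = b) -> c [:: o, i & s] b.
Proof.
move=> h; apply: (fixed_closure Pc Hom) => sg Ss e.
have [so si] := sigma_oi e; apply: h => // x xs.
by apply: e; rewrite !inE xs !orbT.
Qed.

(** The inverse of a homothety of generic ratio [b] is one of ratio [b' = 1 / b], again generic. For
    [t i \o mu b] this exhibits the inverse of [t i] as some [t i']. *)
Lemma t_inverse : exists2 i', i' <> o & forall x, t i (t i' x) = x.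
Proof.
have [b gb _] := gen_exists [::]; have [bo bi] := gen_neq gb.
have [b' b'o bb'] : exists2 b', b' <> o & mu b b' = i.
  by have [b' b'o e] := mu_ratio bo (nesym oi); exists b' => //; rewrite mu_sym.
have mb' x : mu b (mu b' x) = x.
  have /(congr1 (@^~ x)) /= -> := muM bo b'o.
  by rewrite bb' mu_one.
have gb' : gen b'.
  move=> cb'; apply: gb.
  have : c [:: o; i; b'] b.
    apply: definable_closed => sg Ss so si sb'.
    have {}sb' : sg b' = b' by apply: sb'; rewrite mem_head.
    have sbo := sg_neqo Ss so bo.
    apply: (S_inj (S_mu b'o)); rewrite mu_sym // [RHS]mu_sym // bb'.
    by rewrite -[in LHS]sb' -(sg_mu Ss so si) // bb'.
  by move=> cb; apply: gen_closed cb _ => x; rewrite !inE => /or3P[]/eqP-> //;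
    apply: (sp_in Pc); rewrite !inE eqxx ?orbT.
have [g Sg fE] := t_conjugate i gb.
have Cf' : conjugate b' (g \o mu b' \o pinv g) by exists g.
have f'E := conjugate_t gb' Cf'; set a := (g \o mu b' \o pinv g) o in f'E.
have inv x : t i (mu b (t a (mu b' x))) = x.
  have /(congr1 (@^~ ((t a \o mu b') x))) /= -> := fE.
  have /(congr1 (@^~ x)) /= <- := f'E.
  by rewrite pinvK // mb' pinvKV.
have inv2 x : t i (t (mu b a) x) = x.
  by rewrite -{2}(inv x) mu_t // mb'.
exists (mu b a) => // ba; have := inv2 o; rewrite ba !t_o; exact: nesym.
Qed.

Definition minus_one : T := projT1 (cid2 t_inverse).
Definition opp a := if a == o then o else mu a minus_one.

Lemma minus_one_neq : minus_one <> o.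
Proof. by rewrite /minus_one; case: cid2. Qed.

Lemma oppE a : a <> o -> opp a = mu a minus_one.
Proof. by move/eqP/negbTE; rewrite /opp => ->. Qed.

Lemma opp_o : opp o = o. Proof. by rewrite /opp eqxx. Qed.

Lemma t_opp a x : t a (t (opp a) x) = x.
Proof.
have [->|ao] := pselect (a = o); first by rewrite opp_o t_zero.
rewrite oppE // -[x](pinvKV (S_mu ao)) -mu_t // -{1}(mu_i ao) -mu_t //.
by congr (mu a _); rewrite /minus_one; case: cid2.
Qed.

Lemma opp_t a x : t (opp a) (t a x) = x.
Proof. by apply: (S_inj (S_t a)); rewrite t_opp. Qed.

Lemma opp_eq a x : t a x = o -> x = opp a.
Proof. by move=> e; apply: (S_inj (S_t a)); rewrite e -(t_o (opp a)) t_opp. Qed.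

Lemma opp_neq a : a <> o -> opp a <> o.
Proof. by move=> ao; rewrite oppE //; apply: mu_neq0 => //; apply: minus_one_neq. Qed.

Lemma sg_opp sg a : Sigma sg -> sg o = o -> sg i = i -> sg (opp a) = opp (sg a).
Proof.
by move=> Ss so si; apply: opp_eq; rewrite -sg_t // -[opp a]t_o t_opp so.
Qed.

(* The conjugate of [mu b] by [t a] is of the form [t z \o mu b]. *)
Lemma t_comp_ratio a b : a <> o -> gen b ->
  exists z, forall x, t a (t (mu b (opp a)) x) = t z x.
Proof.
move=> ao gb; have [bo bi] := gen_neq gb.
have Cf := conjugateJ bo (conjugate_mu b) (S_t a).
have := conjugate_t gb Cf; set z := _ o => fE; exists z => x.
rewrite -[x](pinvKV (S_mu bo)) -mu_t //.
have /(congr1 (@^~ (pinv (mu b) x))) /= <- := fE.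
by congr (t a (mu b _)); apply: (S_inj (S_t a)); rewrite t_opp pinvKV //; apply: S_t.
Qed.

(** A point [y] generic over [x] is [mu b (opp x)] for a generic [b], the case treated by
    [t_comp_ratio]. *)
Lemma t_comp_gen x y : x <> o -> ~ c [:: o; i; x] y ->
  exists z, forall w, t x (t y w) = t z w.
Proof.
move=> xo ny; have yo : y <> o.
  by move=> yo; apply: ny; rewrite yo; apply: (sp_head Pc).
have [b bo by_] := mu_ratio (opp_neq xo) yo.
have gb : gen b.
  move=> cb; apply: ny.
  have : c [:: o; i; x; b] y.
    apply: definable_closed => sg Ss so si e.
    have [sx sb] : sg x = x /\ sg b = b by split; apply: e; rewrite !inE eqxx ?orbT.
    by rewrite -by_ (sg_mu Ss so si) // (sg_opp _ Ss so si) sx sb.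
  apply: (sp_trans Pc) => z; rewrite !inE => /or4P[]/eqP->; last first.
    by apply: (sp_sub Pc) cb; submem.
  1-3: by apply: (sp_in Pc); rewrite !inE eqxx ?orbT.
by have [z zE] := t_comp_ratio xo gb; exists z => w; rewrite -by_.
Qed.

(** Let [g = t x \o t y] move [o]. For a generic [z], two uses of the generic case give
    [g \o t z = t v] with [v = g z]; let [mu b v = z]. If [b] is generic, [t_comp_ratio] applies to
    [t v \o t (opp z)], which is [g]. Otherwise an automorphism moving [z] but not [b] shows that
    [mu b \o g] has two fixed points; it would be the identity, yet it moves [o]. *)
Lemma t_comp_ex x y : exists z, forall w, t x (t y w) = t z w.
Proof.
have [->|xo] := pselect (x = o); first by exists y => w; rewrite t_zero.
have [->|yo] := pselect (y = o); first by exists x => w; rewrite t_zero.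
have Sg := S_comp (S_t x) (S_t y); set g := t x \o t y in Sg.
have [go|go] := pselect (g o = o).
  exists o => w; have -> : y = opp x by apply: opp_eq; rewrite -{1}(t_o y).
  by rewrite t_opp t_zero.
have [z _ nz] := gen_exists [:: x; y].
have [w wE] : exists w, forall u, t y (t z u) = t w u.
  by apply: t_comp_gen => //; apply: contra_not nz; apply: (sp_sub Pc); submem.
have w_ : w = t y z by rewrite -[z]t_o wE t_o.
have nw : ~ c [:: o; i; x] w.
  move=> cw; apply: nz; have : c [:: o; i; w; y] z.
    apply: definable_closed => sg Ss so si e.
    have [sw' sy] : sg w = w /\ sg y = y by split; apply: e; rewrite !inE eqxx ?orbT.
    by apply: (S_inj (S_t y)); rewrite -w_ -{1}sy -(sg_t _ _ Ss so si) -w_.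
  apply: (sp_trans Pc) => u; rewrite !inE => /or4P[]/eqP->.
  3: by apply: (sp_sub Pc) cw; submem.
  1-3: by apply: (sp_in Pc); rewrite !inE eqxx ?orbT.
have [v vE] := t_comp_gen xo nw.
have gz u : g (t z u) = t v u by rewrite /g /= wE vE.
have v_ : v = g z by rewrite -[z]t_o gz t_o.
have zo : z <> o.
  by move=> zo; apply: nz; rewrite zo; apply: (sp_head Pc).
have sgg sg : Sigma sg -> sg o = o -> sg i = i -> sg x = x -> sg y = y ->
    forall u, sg (g u) = g (sg u).
  by move=> Ss so si sx sy u; rewrite /g /= !(sg_t _ _ Ss so si) sx sy.
have vo : v <> o.
  move=> vo; apply: nz; apply: definable_closed => sg Ss so si e.
  have [sx sy] : sg x = x /\ sg y = y by split; apply: e; rewrite !inE eqxx ?orbT.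
  by apply: (S_inj Sg); rewrite -sgg // -v_ vo.
have [b bo bv] := mu_ratio vo zo.
have [gb|cb] := pselect (gen b).
  have [z' z'E] := t_comp_ratio vo gb; exists z' => u.
  rewrite -z'E; have -> : mu b (opp v) = opp z.
    have mo := minus_one_neq.
    rewrite (oppE vo) (oppE zo) (mu_sym vo mo) (mu_commute _ bo mo) bv.
    exact: mu_sym.
  by rewrite -gz t_opp.
have {}cb : c [:: o; i] b by apply: contrapT.
have bc u : c [:: o; i; x; y; b] u -> c [:: o; i; x; y] u.
  apply: (sp_trans Pc) => r; rewrite !inE => /or4P[/eqP->|/eqP->|/eqP->|].
  4: move=> /orP[]/eqP->.
  5: by apply: (sp_sub Pc) cb; submem.
  1-4: by apply: (sp_in Pc); rewrite !inE eqxx ?orbT.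
have [z2 _ nz2] := gen_exists [:: z; x; y].
have nz2' : ~ c [:: o; i; x; y] z2.
  by apply: contra_not nz2; apply: (sp_sub Pc); submem.
have [sg [Ss e sz]] := sh_move Hom (contra_not (@bc z) nz) (contra_not (@bc z2) nz2').
have [so si] := sigma_oi e.
have [sx [sy sb]] : sg x = x /\ sg y = y /\ sg b = b.
  by split; [|split]; apply: e; rewrite !inE eqxx ?orbT.
have bgz : mu b (g z) = z by rewrite -v_.
have bgz2 : mu b (g z2) = z2.
  by rewrite -sz -(sgg sg) // -{1}sb -(sg_mu Ss so si) // bgz.
have zz2 : z <> z2.
  by move=> zz2; apply: nz2; rewrite -zz2; apply: (sp_in Pc); rewrite !inE eqxx !orbT.
have := fix2_id (S_comp (S_mu bo) Sg) zz2 bgz bgz2.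
by move=> /(congr1 (@^~ o)) /= bgo; case: (mu_neq0 bo go).
Qed.

Definition add x y := t x y.
Definition mul x y := if x == o then o else mu x y.
Definition mul_inv x := if x == o then o else pinv (mu x) i.

Lemma t_add x y w : t x (t y w) = t (add x y) w.
Proof.
have [z zE] := t_comp_ex x y; rewrite zE /add.
by have := zE o; rewrite !t_o => ->.
Qed.

Lemma mulE x y : x <> o -> mul x y = mu x y.
Proof. by move=> /eqP/negbTE; rewrite /mul => ->. Qed.

Lemma mul0 y : mul o y = o. Proof. by rewrite /mul eqxx. Qed.

Lemma mul_o x : mul x o = o.
Proof.
by have [->|xo] := pselect (x = o); rewrite ?mul0 // mulE // mu_o.
Qed.

Lemma mulC : commutative mul.
Proof.
move=> x y; have [->|xo] := pselect (x = o); first by rewrite mul0 mul_o.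
have [->|yo] := pselect (y = o); first by rewrite mul0 mul_o.
by rewrite !mulE // mu_sym.
Qed.

Lemma mulA : associative mul.
Proof.
move=> x y z; have [->|xo] := pselect (x = o); first by rewrite !mul0.
have [->|yo] := pselect (y = o); first by rewrite !(mul0, mul_o).
rewrite [mul y z]mulE // [mul x y]mulE // !mulE //; last exact: mu_neq0.
by rewrite -muM.
Qed.

Lemma mul1 : left_id i mul.
Proof. by move=> x; rewrite mulE ?mu_one //; exact: nesym. Qed.

Lemma addA : associative add.
Proof. by move=> x y z; rewrite /add t_add. Qed.

Lemma add0 : left_id o add.
Proof. by move=> x; rewrite /add t_zero. Qed.

Lemma addr0 : right_id o add.
Proof. by move=> x; rewrite /add t_o. Qed.

Lemma addN : left_inverse o opp add.
Proof. by move=> x; rewrite /add -{2}[x]t_o opp_t. Qed.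

Lemma mulDr x y z : mul x (add y z) = add (mul x y) (mul x z).
Proof.
have [->|xo] := pselect (x = o); first by rewrite !mul0 add0.
by rewrite !mulE // /add mu_t.
Qed.

Lemma mulDl : left_distributive mul add.
Proof. by move=> x y z; rewrite -!(mulC z) mulDr. Qed.

Lemma add_inj x : injective (add x).
Proof. exact: S_inj (S_t x). Qed.

(* Expand (1 + 1) (x + y) in two ways. *)
Lemma addC : commutative add.
Proof.
move=> x y; have := mulDr (add i i) x y; rewrite !mulDl !mul1 -!addA.
move=> /add_inj; rewrite !addA.
move=> /(congr1 (add^~ (opp y))); rewrite -!addA.
have addrN : add y (opp y) = o by rewrite /add -[opp y]t_o t_opp.
by rewrite addrN !addr0.
Qed.

Lemma mulV x : x != o -> mul (mul_inv x) x = i.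
Proof.
move=> xo; rewrite mulC /mul /mul_inv (negbTE xo) pinvKV //.
exact/S_mu/eqP.
Qed.

Lemma i_neq_o : i != o. Proof. by apply/eqP/nesym. Qed.
Lemma mul_inv0 : mul_inv o = o. Proof. by rewrite /mul_inv eqxx. Qed.

Definition sharp2_field_operations : field_operations T :=
  FieldOperations addA addC add0 addN mulA mulC mul1 mulDl i_neq_o mulV mul_inv0.

Lemma sg_mul sg x y : Sigma sg -> sg o = o -> sg i = i ->
  sg (mul x y) = mul (sg x) (sg y).
Proof.
move=> Ss so si; have [->|xo] := pselect (x = o); first by rewrite so !mul0 so.
rewrite !mulE //; first exact: sg_mu.
exact: sg_neqo.
Qed.

Lemma S_affine f : S f -> exists2 a, a <> o & forall x, f x = add (f o) (mul a x).
Proof.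
move=> Sf; have Sg := S_comp (S_t (opp (f o))) Sf.
have go : (t (opp (f o)) \o f) o = o by rewrite /= -{2}[f o]t_o opp_t.
exists ((t (opp (f o)) \o f) i).
  by apply: fix_o_mu => //; apply: nesym.
move=> x; rewrite mulE; last by apply: fix_o_mu => //; apply: nesym.
by rewrite -muE //= /add t_opp.
Qed.

Lemma affine_S a b : a <> o -> exists2 f, S f & forall x, f x = add b (mul a x).
Proof.
move=> ao; exists (t b \o mu a); first by apply: S_comp; [apply: S_t|apply: S_mu].
by move=> x /=; rewrite mulE.
Qed.

End Sharp2.
End Sharp2.

Theorem sharp2_field (T : choiceType) (c : seq T -> T -> Prop)
    (Sigma S : set (T -> T)) (o i : T) :
  seq_pregeometry c -> seq_homogeneous c Sigma -> abelian_sharp2 Sigma S ->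
  o <> i -> exists (K : fieldType) (phi : K -> T),
  [/\ bijective phi, phi 0%R = o, phi 1%R = i,
    (forall f, S f -> exists a b : K, a != 0%R /\
      forall x, f (phi x) = phi (a * x + b)%R) /\
    (forall a b : K, a != 0%R -> exists f, S f /\
      forall x, f (phi x) = phi (a * x + b)%R)
  & forall sg, Sigma sg -> sg o = o -> sg i = i -> forall x y x' y',
      sg (phi x) = phi x' -> sg (phi y) = phi y' ->
      sg (phi (x + y)%R) = phi (x' + y')%R /\ sg (phi (x * y)%R) = phi (x' * y')%R].
Proof.
move=> Pc Hom Sh oi; pose O := Sharp2.sharp2_field_operations Pc Hom Sh oi.
pose phi : field_of O -> T := id.
exists (field_of O), phi; split=> //.
- by exists id.
- split=> [f Sf|a b a0].
  have [a ao fE] := Sharp2.S_affine Pc Hom Sh oi Sf.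
  exists (a : field_of O), (f o : field_of O); split; first exact/eqP.
  by move=> x; rewrite GRing.addrC; apply: fE.
  have /eqP ao := a0; have [f Sf fE] := Sharp2.affine_S Pc Hom Sh oi (b : T) ao.
  by exists f; split=> // x; rewrite GRing.addrC; apply: fE.
- move=> sg Ss so si x y x' y' ex ey.
  have {}ex : x' = sg x by rewrite ex.
  have {}ey : y' = sg y by rewrite ey.
  rewrite ex ey; split; first exact: Sharp2.sg_t.
  exact: (Sharp2.sg_mul Hom).
Qed.

(** * Fields with a homogeneous pregeometry *)

Section HomogeneousField.
Import GRing.Theory.
Local Open Scope ring_scope.
Variables (K : fieldType) (c : seq K -> K -> Prop) (Sigma : set (K -> K)).
Hypothesis (Pc : seq_pregeometry c) (Hom : seq_homogeneous c Sigma).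
Hypothesis morphS : forall sg, Sigma sg -> sg 0 = 0 -> sg 1 = 1 ->
  {morph sg : x y / x + y} /\ {morph sg : x y / x * y}.

Lemma Sigma_rmorphism sg : Sigma sg -> sg 0 = 0 -> sg 1 = 1 ->
  exists f : {rmorphism K -> K}, f =1 sg.
Proof.
move=> Ss s0 s1; have [sD sM] := morphS Ss s0 s1.
have sB : zmod_morphism sg.
  by move=> x y; apply: (addIr (sg y)); rewrite -sD !subrK.
pose A := GRing.isZmodMorphism.Build K K sg sB.
pose M := GRing.isMonoidMorphism.Build K K sg (conj s1 sM).
by exists (HB.pack_for {rmorphism K -> K} sg A M).
Qed.

Lemma Sigma_rmorphism01 sg s : Sigma sg -> {in [:: 0, 1 & s], sg =1 id} ->
  exists f : {rmorphism K -> K}, f =1 sg.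
Proof.
by move=> Ss e; apply: Sigma_rmorphism => //; apply: e; rewrite !inE eqxx ?orbT.
Qed.

Lemma map_poly_fixed (f : {rmorphism K -> K}) (p : {poly K}) :
  {in (p : seq K), f =1 id} -> map_poly f p = p.
Proof.
move=> fp; apply/polyP => j; rewrite coef_map /=.
have [jp|pj] := ltnP j (size p); first by rewrite fp // mem_nth.
by rewrite nth_default // rmorph0.
Qed.

(** A point outside that closure has an orbit larger than the degree of [p], consisting of roots of
    [p]. *)
Lemma root_closed (p : {poly K}) x : p != 0 -> root p x -> c (0 :: 1 :: p) x.
Proof.
move=> p0 px; apply: contrapT => nx.
have [bs [ubs sbs bsE]] := large_orbit Pc Hom (size p) nx.
have : all (root p) bs.
  apply/allP => b /bsE[sg [Ss e <-]].
  have [f fE] := Sigma_rmorphism01 Ss e.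
  have <- : map_poly f p = p.
    by apply: map_poly_fixed => y yp; rewrite fE e // !inE yp !orbT.
  by rewrite -fE rmorph_root.
by move=> rbs; have := max_poly_roots p0 rbs ubs; rewrite sbs ltnn.
Qed.

(** The free parameters of a monic polynomial. *)
Definition low_coefs (p : {poly K}) : seq K := take (size p).-1 p.

Lemma size_low_coefs (p : {poly K}) : size (low_coefs p) = (size p).-1.
Proof. by rewrite size_takel // leq_pred. Qed.

Lemma monic_low_coefs (p : {poly K}) : p \is monic ->
  (p : seq K) = rcons (low_coefs p) 1.
Proof.
move=> pm; have sp : (0 < size p)%N by rewrite size_poly_gt0 monic_neq0.
rewrite -(monicP pm) lead_coefE /low_coefs -take_nth prednK // take_size //.
Qed.

(** The product of the [X - x] over independent [x] splits by construction. Its roots depend on its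
    coefficients, so these are independent by Steinitz, and homogeneity carries them to those of
    [p]. *)
Lemma generic_poly_splits (p : {poly K}) : p \is monic ->
  ind c [:: 0; 1] (low_coefs p) ->
  exists rs : seq K, p = \prod_(r <- rs) ('X - r%:P).
Proof.
move=> pm ip; have [xs sx ix] := ind_extend Pc [:: 0; 1] (size p).-1.
have sp : (0 < size p)%N by rewrite size_poly_gt0 monic_neq0.
pose q : {poly K} := \prod_(r <- xs) ('X - r%:P).
have qm : q \is monic by apply: monic_prod_XsubC.
have sq : size q = size p by rewrite size_prod_XsubC sx prednK.
have iq : ind c [:: 0; 1] (low_coefs q).
  apply: (steinitz Pc ix); last by rewrite size_low_coefs sx sq.
  move=> x xxs; have : c (0 :: 1 :: q) x.
    by apply: root_closed; rewrite ?monic_neq0 // root_prod_XsubC.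
  apply: (sp_sub Pc) => y; rewrite (monic_low_coefs qm) !(inE, mem_cat, mem_rcons).
  by case/or4P=> ->; rewrite ?orbT.
have [sg [Ss e eE]] := ind_homogeneous Hom iq ip
  (etrans (size_low_coefs q) (etrans (congr1 predn sq) (esym (size_low_coefs p)))).
have [f fE] := Sigma_rmorphism01 Ss e.
exists (map f xs); rewrite big_map -map_prod_XsubC -/q; apply: val_inj => /=.
rewrite (monic_low_coefs pm) -eE map_polyE (monic_low_coefs qm) map_rcons rmorph1.
by rewrite (eq_map fE) (PolyK (c := 0)) // last_rcons oner_eq0.
Qed.

Lemma irreducible_root_dvd (L : fieldExtType K) (p u : {poly K}) (z : L) :
  irreducible_poly p -> root (map_poly (in_alg L) p) z ->
  ((map_poly (in_alg L) u).[z] == 0) = (p %| u).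
Proof.
move=> ip pz; apply/idP/idP => [uz|/dvdpP[w ->]].
  apply: contraTT uz => npu; apply: coprimep_root pz; rewrite coprimep_map.
  by rewrite irreducible_poly_coprime.
by rewrite rmorphM /= hornerM (eqP pz) mulr0.
Qed.

(** The minimal polynomial is padded by a power of [X], so that it has as many low coefficients as
    the dimension of the extension. *)
Lemma annihilating_poly (L : fieldExtType K) (y : L) :
  exists q : {poly K}, [/\ q \is monic, size q = (\dim {:L}).+1 &
    root (map_poly (in_alg L) q) y].
Proof.
have /polyOver1P[m mE] := minPolyOver 1 y.
have mm : m \is monic by rewrite -(map_monic (in_alg L)) -mE monic_minPoly.
have my : root (map_poly (in_alg L) m) y by rewrite -mE root_minPoly.
have sm : (size m <= (\dim {:L}).+1)%N.
  rewrite -(size_map_poly (in_alg L)) -mE size_minPoly ltnS.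
  by have := dim_Fadjoin 1 y; rewrite dimv1 muln1 => <-; apply: dimvS; apply: subvf.
exists (m * 'X^((\dim {:L}).+1 - size m)); split.
- by rewrite monicMl // monicXn.
- rewrite size_mulXn ?monic_neq0 //; exact: subnK.
- by rewrite rmorphM rootM my.
Qed.

(* A generic element [r.[z]] of [K[X]/(p)] is a root of a monic polynomial [q]
   with generic coefficients: [q] splits in [K], so [r.[z]] belongs to [K]. *)
Lemma irreducible_poly_linear (p : {poly K}) : irreducible_poly p -> (size p <= 2)%N.
Proof.
move=> ip; rewrite leqNgt; apply/negP => sp.
have [L dL [z pz _]] := irredp_FAdjoin ip.
set d := (size p).-1 in dL; have dE : size p = d.+1 by rewrite prednK // (leq_trans _ sp).
have d2 : (1 < d)%N by rewrite -ltnS -dE.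
pose B : seq K := 0 :: 1 :: p.
have [a sa ia] := ind_extend Pc B d.
pose ev (u : {poly K}) := (map_poly (in_alg L) u).[z].
pose r := Poly a; have [q [qm sq qy]] := annihilating_poly (ev r).
rewrite dL in sq.
have rE j : (j < d)%N -> r`_j = nth 0 a j by rewrite coef_Poly.
have pr : p %| q \Po r.
  by rewrite -(irreducible_root_dvd _ ip pz) map_comp_poly horner_comp.
have evB (u v : {poly K}) : (size u <= d)%N -> (size v <= d)%N -> ev u = ev v -> u = v.
  move=> su sv /eqP; rewrite -subr_eq0 /ev -hornerN -hornerD -rmorphN -rmorphD /=.
  rewrite (irreducible_root_dvd _ ip pz) => /dvdp_leq puv; apply/eqP.
  rewrite -subr_eq0; apply/negPn/negP => /puv; apply/negP; rewrite -ltnNge dE ltnS.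
  by rewrite (leq_trans (size_polyD _ _)) // size_polyN geq_max su.
have srd f : (size (map_poly f r : {poly K}) <= d)%N.
  by rewrite (leq_trans (size_poly _ _)) // (leq_trans (size_Poly _)) ?sa.
(* If a coefficient [x] of [r] were outside this closure, automorphisms fixing [p] and [q] would
   give it [d + 1] values; the transforms of [r] would then take [d + 1] distinct values at [z], all
   of them roots of [q]. *)
have ac x : x \in a -> c (low_coefs q ++ B) x.
  move=> xa; apply: contrapT => nx.
  have [bs [ubs sbs bsE]] := large_orbit Pc Hom d.+1 nx.
  have [F FE] : {F : K -> (K -> K) & forall b, b \in bs ->
      [/\ Sigma (F b), {in low_coefs q ++ B, F b =1 id} & F b x = b]}.
    apply: (@choice _ _ (fun b f => b \in bs ->
      [/\ Sigma f, {in low_coefs q ++ B, f =1 id} & f x = b])) => b.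
    have [bb|] := boolP (b \in bs); last by exists id.
    by have [f fP] := bsE b bb; exists f.
  have rF b : b \in bs -> exists f : {rmorphism K -> K}, [/\ f =1 F b,
      map_poly f p = p & map_poly f q = q].
    move=> bb; have [Ss e _] := FE b bb.
    have [f fE] : exists f : {rmorphism K -> K}, f =1 F b.
      by apply: (@Sigma_rmorphism01 _ p) => // y yB; apply: e; rewrite mem_cat [y \in B]yB orbT.
    exists f; split=> //; apply: map_poly_fixed => y yp; rewrite fE e //.
      by rewrite mem_cat !inE yp !orbT.
    move: yp; rewrite (monic_low_coefs qm) mem_rcons !(inE, mem_cat).
    by case/orP=> ->; rewrite ?orbT.
  pose ys := [seq ev (map_poly (F b) r) | b <- bs].
  have uys : uniq ys.
    rewrite map_inj_in_uniq // => b b' bb bb' /evB -/(_ (srd _) (srd _)) e.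
    have [[_ _ <-] [_ _ <-]] := (FE b bb, FE b' bb').
    have [[f [fE _ _]] [f' [fE' _ _]]] := (rF b bb, rF b' bb').
    have ix : (index x a < d)%N by rewrite -sa index_mem.
    have xE : x = r`_(index x a) by rewrite rE // nth_index.
    rewrite xE -fE -fE' -!coef_map.
    by rewrite (eq_map_poly fE) (eq_map_poly fE') e.
  have ays : all (root (map_poly (in_alg L) q)) ys.
    apply/allP => _ /mapP[b bb ->]; have [f [fE fp fq]] := rF b bb.
    rewrite /root /ev -horner_comp -map_comp_poly (irreducible_root_dvd _ ip pz).
    rewrite -(eq_map_poly fE) -{1}fp -fq -map_comp_poly dvdp_map.
    exact: pr.
  have q0 : map_poly (in_alg L) q != 0 by rewrite map_poly_eq0 monic_neq0.
  have := max_poly_roots q0 ays uys.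
  by rewrite size_map_poly size_map sbs sq ltnn.
have iq : ind c B (low_coefs q).
  by apply: (steinitz Pc ia ac); rewrite size_low_coefs sq sa.
have [|rs qE] := generic_poly_splits qm.
  by apply: (ind_sub Pc) iq => y; rewrite !inE => /orP[]/eqP->; rewrite eqxx ?orbT.
have : ev r \in map (in_alg L) rs.
  by rewrite -root_prod_XsubC big_map -map_prod_XsubC -qE.
move=> /mapP[s _ rs_]; have r_const : r = s%:P.
  apply: evB; first by rewrite (leq_trans (size_Poly _)) ?sa.
    by rewrite (leq_trans (size_polyC_leq1 _)) // ltnW.
  by rewrite rs_ /ev map_polyC hornerC.
(* Since [1 < d], the coefficient of index 1 is among the generic ones, but it vanishes for a
   constant. *)
have a1 : nth 0 a 1 \in a by rewrite mem_nth // sa.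
apply: (ind_notin Pc ia a1); rewrite -rE // r_const coefC /=.
exact: (sp_head Pc).
Qed.

(** A polynomial of least degree without roots is irreducible, as its proper nonconstant factors
    would have roots; it would then be linear. *)
Lemma homogeneous_field_closed : GRing.closed_field_axiom K.
Proof.
have rootP_ m : forall p : {poly K}, (1 < size p <= m)%N -> exists x, root p x.
  elim: m => [|m IH] p; first by case: (size p) => [|[]].
  move=> /andP[p1 pm]; have [p2|p2] := leqP (size p) 2.
    have [|x px] := @poly2_root K p; last by exists x.
    by apply/eqP; rewrite eqn_leq p2.
  apply: contrapT => npx; suff /irreducible_poly_linear : irreducible_poly p.
    by rewrite leqNgt p2.
  have p0 : p != 0 by rewrite -size_poly_gt0 (ltn_trans _ p1).
  split=> // w w1 wp; rewrite -dvdp_size_eqp //.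
  have w0 : w != 0 by apply: contraNneq p0 => w0; rewrite w0 dvd0p in wp.
  have w1' : (1 < size w)%N by rewrite ltn_neqAle eq_sym w1 size_poly_gt0.
  rewrite eqn_leq dvdp_leq //= leqNgt; apply/negP => wp'.
  have [|x wx] := IH w; first by rewrite w1' -ltnS (leq_trans wp').
  by apply: npx; exists x; have /dvdpP[u ->] := wp; rewrite rootM wx orbT.
move=> n P n0; pose p := 'X^n - \poly_(i < n) P i.
have sp : size p = n.+1.
  by rewrite size_polyDl ?size_polyXn // size_polyN ltnS size_poly.
have [|x] := rootP_ n.+1 p; first by rewrite sp !ltnS n0 leqnn.
rewrite /root /p !hornerE horner_poly subr_eq0 => /eqP xE.
by exists x.
Qed.

(* The point [x * theta x] is fixed by [theta]; it is either generic, or constant. *)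
Lemma identity_or_inverse (theta : K -> K) :
  (forall x y, x != 0 -> y != 0 -> theta (x * y) = theta x * theta y) ->
  (forall x, x != 0 -> theta x != 0) ->
  (forall x, x != 0 -> theta (theta x) = x) ->
  (forall sg, Sigma sg -> sg 0 = 0 -> sg 1 = 1 ->
    forall x, sg (theta x) = theta (sg x)) ->
  (forall x, x != 0 -> theta x = x) \/ (forall x, x != 0 -> theta x = x^-1).
Proof.
move=> tM t0 tK tS; have [g ng] := sp_infinite Pc [:: 0; 1].
have gen0 x s : ~ c (0 :: 1 :: s) x -> x != 0.
  by move=> nx; apply/eqP => x0; apply: nx; rewrite x0; apply: (sp_head Pc).
have g0 := gen0 _ _ ng; have k0 : g * theta g != 0 by rewrite mulf_neq0 ?t0.
have tk : theta (g * theta g) = g * theta g by rewrite tM ?t0 // tK // mulrC.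
(* Every nonzero [x] is a quotient of two generic points, so [theta] is determined by its values at
   these. *)
have quot x : x != 0 -> exists y, [/\ ~ c [:: 0; 1] y & ~ c [:: 0; 1] (x * y)].
  move=> x0; have [y ny] := sp_infinite Pc [:: 0; 1; x]; exists y.
  split; first by apply: contra_not ny; apply: (sp_sub Pc); submem.
  move=> cxy; apply: ny; have : c [:: 0; 1; x; x * y] y.
    apply: (fixed_closure Pc Hom) => sg Ss e.
    have [f fE] := Sigma_rmorphism01 Ss e.
    have fx : f x = x by rewrite fE e // !inE eqxx ?orbT.
    have fxy : f (x * y) = x * y by rewrite fE e // !inE eqxx ?orbT.
    by apply: (mulfI x0); rewrite -fE -{1}fx -rmorphM.
  apply: (sp_trans Pc) => z; rewrite !inE => /or4P[]/eqP->.
  4: by apply: (sp_sub Pc) cxy; submem.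
  1-3: by apply: (sp_in Pc); rewrite !inE eqxx ?orbT.
have [ck|nk] := pselect (c [:: 0; 1] (g * theta g)); [right|left].
  set k := g * theta g in k0 tk ck.
  have kE x : ~ c [:: 0; 1] x -> theta x = k / x.
    move=> nx; have kc y : c [:: 0; 1; k] y -> c [:: 0; 1] y.
      apply: (sp_trans Pc) => z; rewrite !inE => /or3P[]/eqP-> //;
      by apply: (sp_in Pc); rewrite !inE eqxx ?orbT.
    have [sg [Ss e sgx]] := sh_move Hom (contra_not (@kc g) ng) (contra_not (@kc x) nx).
    have [f fE] := Sigma_rmorphism01 Ss e.
    have sgk : f k = k by rewrite fE e // !inE eqxx ?orbT.
    have ft : f (theta g) = theta x.
      by rewrite fE tS ?sgx //; apply: e; rewrite !inE eqxx ?orbT.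
    apply: (mulfI (gen0 _ _ nx)); rewrite mulrCA mulfV ?(gen0 _ _ nx) // mulr1.
    by rewrite -ft -{1}sgx -fE -rmorphM.
  move=> x x0; have [y [ny nxy]] := quot x x0; have y0 := gen0 _ _ ny.
  have ky0 : k / y != 0 by rewrite mulf_neq0 ?invr_neq0.
  apply: (mulIf ky0); rewrite -(kE _ ny) -tM // (kE _ nxy) (kE _ ny).
  by rewrite invfM mulrCA.
have kE x : ~ c [:: 0; 1] x -> theta x = x.
  move=> nx; have [sg [Ss e sgx]] := sh_move Hom nk nx.
  by rewrite -sgx -tS ?tk //; apply: e; rewrite !inE eqxx ?orbT.
move=> x x0; have [y [ny nxy]] := quot x x0; have y0 := gen0 _ _ ny.
by have := tM _ _ x0 y0; rewrite (kE _ nxy) (kE _ ny) => /(mulIf y0).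
Qed.

End HomogeneousField.

(** * Coordinatization *)

Lemma transport_pregeometry (T U : eqType) (phi : U -> T) c :
  bijective phi -> seq_pregeometry c ->
  seq_pregeometry (fun s a => c (map phi s) (phi a)).
Proof.
move=> [psi phiK psiK] Pc; split.
- by move=> s a as_; apply: (sp_in Pc); apply: map_f.
- move=> s t b st; apply: (sp_trans Pc) => _ /mapP[a as_ ->]; exact: st.
- by move=> s a b; apply: (sp_exchange Pc).
- by move=> a; apply: (sp_nil Pc).
- move=> s; have [a na] := sp_infinite Pc (map phi s).
  by exists (psi a); rewrite psiK.
Qed.

Lemma transport_homogeneous (T U : eqType) (phi : U -> T) c (Sigma : set (T -> T)) :
  bijective phi -> seq_homogeneous c Sigma ->
  seq_homogeneous (fun s a => c (map phi s) (phi a))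
    [set f | exists2 sg, Sigma sg & forall x, phi (f x) = sg (phi x)].
Proof.
move=> [psi phiK psiK] Hom.
have lift sg : exists f : U -> U, forall x, phi (f x) = sg (phi x).
  by exists (psi \o sg \o phi) => x /=; rewrite psiK.
split; first split.
- by exists id; [exact: pg_id (sh_group Hom)|].
- move=> f g [sf Ssf fE] [sg Ssg gE]; exists (sf \o sg).
    exact: (pg_comp (sh_group Hom)).
  by move=> x /=; rewrite fE gE.
- move=> f [sf Ssf fE]; have [sg [Ssg sfK sgK]] := pg_inv (sh_group Hom) Ssf.
  have [g gE] := lift sg; exists g; split; first by exists sg.
    by move=> x; apply: (can_inj phiK); rewrite gE fE sfK.
  by move=> x; apply: (can_inj phiK); rewrite fE gE sgK.
- move=> f s a [sf Ssf fE] /(sh_cl Hom Ssf); rewrite fE -!map_comp.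
  by congr (c _ _); apply: eq_map => x /=; rewrite fE.
- move=> s a b na nb; have [sf [Ssf e sab]] := sh_move Hom na nb.
  have [f fE] := lift sf; exists f; split; first by exists sf.
    by move=> x xs; apply: (can_inj phiK); rewrite fE e //; apply: map_f.
  by apply: (can_inj phiK); rewrite fE.
Qed.

(** * Localisation at n - 2 independent points *)

Section Localization.
Variables (T : choiceType) (c : seq T -> T -> Prop) (Sigma S : set (T -> T)).
Variable n : nat.
Hypothesis (Pc : seq_pregeometry c) (Hom : seq_homogeneous c Sigma).
Hypothesis (Act : n_perm_action c Sigma S n).
Hypothesis (UG : seq_unique_generics c Sigma S n).
Hypothesis (AS : abelian_generic_stabilizers c Sigma S n).
Variable B : seq T.
Hypotheses (sB : (size B).+2 = n) (iB : ind c [::] B).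

Definition loc_type := {x : T | `[< ~ c B x >]}.
Definition loc_cl (s : seq loc_type) (a : loc_type) : Prop :=
  c (map val s ++ B) (val a).
Definition loc_perms (R : set (T -> T)) : set (loc_type -> loc_type) :=
  [set f | exists2 g, R g /\ {in B, g =1 id} & forall x, val (f x) = g (val x)].

Lemma loc_valP (x : loc_type) : ~ c B (val x).
Proof. exact/asboolP/(valP x). Qed.

Lemma loc_ex x : ~ c B x -> exists y : loc_type, val y = x.
Proof. by move=> /asboolT nx; exists (exist _ x nx). Qed.

Lemma loc_lift R g : perm_group R ->
  (forall f s a, R f -> c s a -> c (map f s) (f a)) -> R g -> {in B, g =1 id} ->
  exists f : loc_type -> loc_type, forall x, val (f x) = g (val x).
Proof.
move=> GR Rc Rg gB; have [h [Rh gK hK]] := pg_inv GR Rg.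
have hB : map h B = B.
  by apply: map_id_in => x xB; rewrite -[RHS]gK gB.
have [f fE] : {f : loc_type -> loc_type & forall x, val (f x) = g (val x)}.
  apply: (@choice _ _ (fun x y : loc_type => val y = g (val x))) => x.
  apply: loc_ex => /(Rc h _ _ Rh); rewrite hB gK; exact: loc_valP.
by exists f.
Qed.

Lemma loc_perm_group R : perm_group R ->
  (forall f s a, R f -> c s a -> c (map f s) (f a)) -> perm_group (loc_perms R).
Proof.
move=> GR Rc; split.
- by exists id => //; split=> //; apply: pg_id GR.
- move=> f f' [g [Rg gB] fE] [g' [Rg' gB'] fE']; exists (g \o g').
    by split; [exact: (pg_comp GR)|move=> x xB /=; rewrite gB' ?gB].
  by move=> x /=; rewrite fE fE'.
- move=> f [g [Rg gB] fE]; have [h [Rh gK hK]] := pg_inv GR Rg.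
  have hB : {in B, h =1 id} by move=> x xB; rewrite -{1}(gB x xB) gK.
  have [f' fE'] := loc_lift GR Rc Rh hB.
  exists f'; split; first by exists h.
    by move=> x; apply: val_inj; rewrite fE' fE gK.
  by move=> x; apply: val_inj; rewrite fE fE' hK.
Qed.

Lemma loc_pregeometry : seq_pregeometry loc_cl.
Proof.
split.
- by move=> s a as_; apply: (sp_in Pc); rewrite mem_cat map_f.
- move=> s t b st; apply: (sp_trans Pc) => x; rewrite mem_cat.
  case/orP=> [/mapP[a as_ ->]|xB]; first exact: st.
  by apply: (sp_in Pc); rewrite mem_cat xB orbT.
- by move=> s a b; apply: (sp_exchange Pc).
- by move=> a; apply: loc_valP.
- move=> s; have [a na] := sp_infinite Pc (map val s ++ B).
  have [|y yE] := @loc_ex a; first by apply: contra_not na; apply: (sp_sub Pc); submem.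
  by exists y; rewrite /loc_cl yE.
Qed.

Lemma loc_homogeneous : seq_homogeneous loc_cl (loc_perms Sigma).
Proof.
have Sc f s a : Sigma f -> c s a -> c (map f s) (f a) by exact: (sh_cl Hom).
split; first exact: loc_perm_group (sh_group Hom) Sc.
- move=> f s a [g [Sg gB] fE] /(Sc _ _ _ Sg).
  rewrite /loc_cl fE map_cat (map_id_in gB) -!map_comp; congr (c (_ ++ _) _).
  by apply: eq_map => x /=; rewrite fE.
- move=> s a b na nb; have [g [Sg e gab]] := sh_move Hom na nb.
  have gB : {in B, g =1 id} by move=> x xB; apply: e; rewrite mem_cat xB orbT.
  have [f fE] := loc_lift (sh_group Hom) Sc Sg gB.
  exists f; split; first by exists g.
    by move=> x xs; apply: val_inj; rewrite fE e // mem_cat map_f.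
  by apply: val_inj; rewrite fE.
Qed.

(** The localisation is a geometry by [closure_cons_geometry]; hence transitivity and determinacy
    for independent tuples reach all pairs of distinct points. *)
Lemma loc_ind2 (x y : loc_type) : x <> y -> ind c [::] (B ++ [:: val x; val y]).
Proof.
move=> xy; apply/(ind_cat Pc); rewrite cats0; split=> //.
split; first exact: loc_valP; split=> // cxy; apply: xy; apply: val_inj; apply: esym.
exact: (closure_cons_geometry Pc Hom Act UG AS sB iB (@loc_valP x) (@loc_valP y) cxy).
Qed.

Lemma loc_sharp2 : abelian_sharp2 (loc_perms Sigma) (loc_perms S).
Proof.
have Sc f s a : S f -> c s a -> c (map f s) (f a) by exact: (npa_cl Act).
have s2 (x y : loc_type) : size (B ++ [:: val x; val y]) = n by rewrite size_cat addn2.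
split; first exact: loc_perm_group (npa_group Act) Sc.
- move=> sg f [sg' [Ssg sgB] sgE] [f' [Sf fB] fE].
  have [g' Sg' gE'] := npa_normal Act Ssg Sf.
  have gB' : {in B, g' =1 id}.
    by move=> x xB; have /= := gE' x; rewrite fB // sgB.
  have [g gE] := loc_lift (npa_group Act) Sc Sg' gB'.
  exists g; first by exists g'.
  by apply: funext => x; apply: val_inj; rewrite /= sgE fE gE sgE; have /= <- := gE' (val x).
- move=> x y x' y' xy xy'.
  have [g Sg gE] := npa_transitive Pc Act (s2 x y) (s2 x' y') (loc_ind2 xy) (loc_ind2 xy').
  move: gE; rewrite map_cat => /eqP; rewrite eqseq_cat ?size_map // => /andP[/eqP gB].
  move=> /eqP[gx gy].
  have gB' : {in B, g =1 id}.
    by apply/eq_in_map; rewrite gB map_id.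
  have [f fE] := loc_lift (npa_group Act) Sc Sg gB'.
  by exists f; split; [exists g|apply: val_inj; rewrite fE..].
- move=> f g x y [f' [Sf fB] fE] [g' [Sg gB] gE] xy fgx fgy.
  have fg : f' =1 g'.
    apply: (ind_agree Pc Hom Act UG AS Sf Sg (s2 x y) (loc_ind2 xy)) => z.
    rewrite mem_cat !inE => /or3P[zB|/eqP->|/eqP->]; first by rewrite fB ?gB.
      by rewrite -fE -gE fgx.
    by rewrite -fE -gE fgy.
  by apply: funext => z; apply: val_inj; rewrite fE gE fg.
- move=> f g x [f' [Sf fB] fE] [g' [Sg gB] gE] fx gx.
  have iu : ind c [::] (val x :: B).
    apply: (ind_catC Pc (t := B) (u := [:: val x])); apply/(ind_cat Pc).
    by rewrite cats0; split=> //; split=> //; apply: loc_valP.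
  have [cm _] := fixing_spec Pc Hom Act UG AS (u := val x :: B) sB iu.
  have fixp h h' : S h' -> {in B, h' =1 id} -> (forall x, val (h x) = h' (val x)) ->
      h x = x -> fixing S (val x :: B) h'.
    move=> Sh' hB hE hx; split=> // y; rewrite inE => /orP[/eqP->|/hB//].
    by rewrite -hE hx.
  apply: funext => y; apply: val_inj; rewrite /= !(fE, gE).
  have /= -> := cm _ _ (fixp f f' Sf fB fE fx) (fixp g g' Sg gB gE gx) (val y) => //.
Qed.

End Localization.

(** * Field coordinates outside the closure of n - 2 points *)

Section Coordinates.
Import GRing.Theory.
Local Open Scope ring_scope.
Variables (T : choiceType) (c : seq T -> T -> Prop) (Sigma S : set (T -> T)).
Variable n : nat.
Hypothesis (Pc : seq_pregeometry c) (Hom : seq_homogeneous c Sigma).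
Hypothesis (Act : n_perm_action c Sigma S n).
Hypothesis (UG : seq_unique_generics c Sigma S n).
Hypothesis (AS : abelian_generic_stabilizers c Sigma S n).
Variables (B : seq T) (o i : T).
Hypotheses (sB : (size B).+2 = n) (iB : ind c [::] (B ++ [:: o; i])).

(** [co_inverse] concerns the involutions permuting the origin and [B]; both the projective line and
    the bound on the rank rest on it. *)
Record coordinates (K : fieldType) (f : K -> T) : Prop := {
  co_inj : injective f;
  co_range : forall x, ~ c B x <-> exists a, f a = x;
  co_0 : f 0 = o;
  co_1 : f 1 = i;
  co_affine : forall g, S g -> {in B, g =1 id} ->
    exists a b, a != 0 /\ forall x, g (f x) = f (a * x + b);
  co_perm : forall a b, a != 0 ->
    exists g, [/\ S g, {in B, g =1 id} & forall x, g (f x) = f (a * x + b)];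
  co_Sigma : forall sg, Sigma sg -> {in [:: o, i & B], sg =1 id} ->
    forall x y x' y', sg (f x) = f x' -> sg (f y) = f y' ->
    sg (f (x + y)) = f (x' + y') /\ sg (f (x * y)) = f (x' * y');
  co_inverse : forall u, S u -> (exists x, u x <> x) -> u i = i ->
    {in o :: B, forall x, u x \in o :: B} -> {in o :: B, forall x, u (u x) = x} ->
    forall x, x != 0 -> u (f x) = f x^-1
}.

Lemma field_coordinatization : exists (K : fieldType) (f : K -> T),
  coordinates f /\ GRing.closed_field_axiom K.
Proof.
have iB0 := ind_catl Pc iB.
have [io ii] : ~ c B o /\ ~ c (o :: B) i.
  by have := ind_catr Pc iB; rewrite cats0 => -[no [ni _]].
have ni : ~ c B i by apply: contra_not ii; apply: (sp_sub Pc); submem.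
have [o' o'E] := loc_ex io; have [i' i'E] := loc_ex ni.
have oi' : o' <> i'.
  by move=> oi; apply: ii; rewrite -o'E oi i'E; apply: (sp_head Pc).
have Pq := loc_pregeometry Pc B; have Hq := loc_homogeneous Hom B.
have Sq := loc_sharp2 Pc Hom Act UG AS sB iB0.
have [K0 [phi [phi_bij phi0 phi1 [affS Saff] phiS]]] := sharp2_field Pq Hq Sq oi'.
have [psi phiK psiK] := phi_bij.
pose cK := fun (s : seq K0) a => @loc_cl T c B (map phi s) (phi a).
pose SK : set (K0 -> K0) :=
  [set f | exists2 sg, @loc_perms T c B Sigma sg & forall x, phi (f x) = sg (phi x)].
have PK : seq_pregeometry cK := transport_pregeometry phi_bij Pq.
have HK : seq_homogeneous cK SK := transport_homogeneous phi_bij Hq.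
have morphK sg : SK sg -> sg 0 = 0 -> sg 1 = 1 ->
    {morph sg : x y / x + y} /\ {morph sg : x y / x * y}.
  move=> [sg' Ssg' sgE] s0 s1.
  have so : sg' o' = o' by rewrite -phi0 -sgE s0.
  have si : sg' i' = i' by rewrite -phi1 -sgE s1.
  by split=> x y; apply: (can_inj phiK); rewrite sgE;
    have [] := phiS _ Ssg' so si x y (sg x) (sg y) (esym (sgE x)) (esym (sgE y)).
exists K0, (val \o phi); split; last exact: homogeneous_field_closed PK HK morphK.
have fB x : ~ c B x <-> exists a, (val \o phi) a = x.
  split=> [nx|[a <-]]; last exact: loc_valP.
  have [y <-] := loc_ex nx.
  by exists (psi y); rewrite /= psiK.
have aff g : S g -> {in B, g =1 id} ->
    exists a b, a != 0 /\ forall x, g (val (phi x)) = val (phi (a * x + b)).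
  move=> Sg gB; have [f fE] := loc_lift (npa_group Act) (npa_cl Act) Sg gB.
  have [|a [b [a0 abE]]] := affS f; first by exists g.
  by exists a, b; split=> // x; rewrite -fE abE.
have perm a b : a != 0 ->
    exists g, [/\ S g, {in B, g =1 id} & forall x, g (val (phi x)) = val (phi (a * x + b))].
  move=> a0; have [f [[g [Sg gB] fE] abE]] := Saff a b a0.
  by exists g; split=> // x; rewrite -fE abE.
have locS sg : Sigma sg -> {in [:: o, i & B], sg =1 id} -> exists f,
    [/\ @loc_perms T c B Sigma f, forall x, val (f x) = sg (val x), f o' = o' & f i' = i'].
  move=> Ssg e; have eB : {in B, sg =1 id} by move=> x xB; apply: e; rewrite !inE xB !orbT.
  have [f fE] := loc_lift (sh_group Hom) (sh_cl Hom) Ssg eB.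
  exists f; split=> //; first by exists sg.
    by apply: val_inj; rewrite fE o'E e // mem_head.
  by apply: val_inj; rewrite fE i'E e // !inE eqxx orbT.
split=> //.
- by apply: inj_comp; [exact: val_inj|exact: can_inj phiK].
- by rewrite /= phi0.
- by rewrite /= phi1.
- move=> sg Ssg e x y x' y' ex ey; have [f [Lf fE fo fi]] := locS sg Ssg e.
  have ex' : f (phi x) = phi x' by apply: val_inj; rewrite fE.
  have ey' : f (phi y) = phi y' by apply: val_inj; rewrite fE.
  by have [e1 e2] := phiS f Lf fo fi x y x' y' ex' ey'; rewrite -!fE e1 e2.
- move=> u Su [x0 ux0] ui uB uuB.
  have sBoi : size (B ++ [:: o; i]) = n by rewrite size_cat addn2.
  have boi (P : T -> Prop) : {in o :: B, forall x, P x} -> P i ->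
      {in B ++ [:: o; i], forall x, P x}.
    move=> PB Pi x; rewrite mem_cat !inE => /or3P[xB|/eqP->|/eqP->] //.
      by apply: PB; rewrite inE xB orbT.
    by apply: PB; rewrite mem_head.
  have uu x : u (u x) = x.
    apply: (ind_agree Pc Hom Act UG AS (pg_comp (npa_group Act) Su Su)
      (pg_id (npa_group Act)) sBoi iB).
    by apply: boi => //=; rewrite !ui.
  have uc x : c (o :: B) x -> c (o :: B) (u x).
    move=> /(npa_cl Act Su); apply: (sp_sub Pc) => _ /mapP[y yB ->]; exact: uB.
  have fgen x : x != 0 -> ~ c (o :: B) (val (phi x)).
    move=> x0' cx; move/eqP: x0'; apply; apply: (can_inj phiK).
    rewrite phi0; apply: val_inj; rewrite o'E.
    exact: (closure_cons_geometry Pc Hom Act UG AS sB iB0 io (@loc_valP _ _ _ (phi x)) cx).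
  have genf p : ~ c (o :: B) p -> exists2 x, val (phi x) = p & x != 0.
    move=> np; have /fB[x xp] : ~ c B p.
      by apply: contra_not np; apply: (sp_sub Pc); submem.
    exists x => //; apply: contra_notN np => /eqP x00.
    by rewrite -xp x00 /= phi0 o'E; apply: (sp_head Pc).
  have [th thE] : {th : K0 -> K0 & forall x,
      (x = 0 -> th x = 0) /\ (x != 0 -> u (val (phi x)) = val (phi (th x)) /\ th x != 0)}.
    apply: (@choice _ _ (fun x y => (x = 0 -> y = 0) /\
      (x != 0 -> u (val (phi x)) = val (phi y) /\ y != 0))) => x.
    have [->|xn0] := eqVneq x 0; first by exists 0; split=> //; rewrite eqxx.
    have [|y yE y0] := genf (u (val (phi x))); last first.
      by exists y; split=> // x00; rewrite x00 eqxx in xn0.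
    by move/uc; rewrite uu; apply: fgen.
  have th0 : th 0 = 0 by have [-> //] := thE 0.
  have uf x : x != 0 -> u (val (phi x)) = val (phi (th x)) by move=> /(thE x).2[].
  have thn0 x : x != 0 -> th x != 0 by move=> /(thE x).2[].
  have f_inj : injective (val \o phi).
    by apply: inj_comp; [exact: val_inj|exact: can_inj phiK].
  (* The conjugate by [u] of the multiplication by [x] fixes [o] and [B], so it is a multiplication;
     evaluation at 1 shows that its ratio is [th x]. *)
  have thM x y : x != 0 -> y != 0 -> th (x * y) = th x * th y.
    move=> xn0 yn0; have [m [Sm mB mE]] := perm x 0 xn0.
    have mo : {in o :: B, m =1 id}.
      move=> z; rewrite inE => /orP[/eqP->|/mB //].
      by rewrite -o'E -phi0 mE mulr0 addr0.
    have Sg : S (u \o m \o u) by exact: (pg_comp (npa_group Act) Su (pg_comp (npa_group Act) Sm Su)).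
    have gfix : {in o :: B, forall z, (u \o m \o u) z = z}.
      by move=> z zB /=; rewrite mo ?uB // uu.
    have [z zB|a [b [a0 gE]]] := aff _ Sg; first by apply: gfix; rewrite inE zB orbT.
    have b0 : b = 0.
      apply: f_inj; have := gE 0; rewrite mulr0 add0r /= => <-.
      by rewrite phi0 o'E; apply: gfix; rewrite mem_head.
    have aE : a = th x.
      apply: f_inj; have := gE 1; rewrite mulr1 b0 addr0 /= => <-.
      by rewrite phi1 i'E ui -i'E -phi1 mE mulr1 addr0 uf.
    have := gE (th y); rewrite b0 addr0 aE /= -uf // uu mE addr0.
    by rewrite uf ?mulf_neq0 // => /f_inj.
  have thK x : x != 0 -> th (th x) = x.
    by move=> xn0; apply: f_inj; rewrite /= -uf ?thn0 // -uf // uu.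
  have thS sg : SK sg -> sg 0 = 0 -> sg 1 = 1 -> forall x, sg (th x) = th (sg x).
    move=> [sg' [g [Sg gB] gE] sgE] s0 s1 x.
    have [->|xn0] := eqVneq x 0; first by rewrite th0 !s0 th0.
    have fE y : val (phi (sg y)) = g (val (phi y)) by rewrite sgE gE.
    have go : g o = o by rewrite -o'E -phi0 -fE s0.
    have gi : g i = i by rewrite -i'E -phi1 -fE s1.
    have goB : {in o :: B, g =1 id}.
      by move=> z; rewrite inE => /orP[/eqP->|/gB].
    have [h Sh hE] := npa_normal Act Sg Su.
    have hu : h =1 u.
      apply: (ind_agree Pc Hom Act UG AS Sh Su sBoi iB); apply: boi.
        by move=> z zB; have /= := hE z; rewrite goB ?uB // goB.
      by have /= := hE i; rewrite gi ui gi.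
    have sx0 : sg x != 0.
      apply/eqP => sx0; move/eqP: xn0; apply; apply: f_inj => /=.
      have [g' [_ gK _]] := pg_inv (sh_group Hom) Sg.
      by apply: (can_inj gK); rewrite -!fE sx0 s0.
    apply: f_inj; rewrite /= fE -uf // -uf //; have /= -> := hE (val (phi x)).
    by rewrite hu fE.
  have [idt|inv] := identity_or_inverse PK HK morphK thM thn0 thK thS; last first.
    by move=> x xn0 /=; rewrite uf // inv.
  (* If [th] were the identity, [u] would fix an [n]-tuple independent over [o :: B] and be
     trivial. *)
  case: ux0; have [zs sz iz] := ind_extend Pc (o :: B) n.
  apply: (trivial_stabilizer Pc Hom Act UG AS Su sz).
    by apply: (ind_sub Pc) iz; submem.
  move=> z zz; have [x <- xn0] := genf z (ind_notin Pc iz zz).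
  by rewrite uf // idt.
Qed.

Definition closed_field_of (K : fieldType) (clK : GRing.closed_field_axiom K) : Type := K.
HB.instance Definition _ (K : fieldType) (clK : GRing.closed_field_axiom K) :=
  GRing.Field.on (closed_field_of clK).
HB.instance Definition _ (K : fieldType) (clK : GRing.closed_field_axiom K) :=
  Field_isAlgClosed.Build (closed_field_of clK) clK.

Theorem coordinatization : exists (K : closedFieldType) (f : K -> T), coordinates f.
Proof.
have [K [f [fP clK]]] := field_coordinatization.
by exists (closed_field_of clK), f; case: fP; split.
Qed.

End Coordinates.

(** * The projective line *)

Section ProjectiveLine.
Import GRing.Theory.
Local Open Scope ring_scope.
Local Open Scope quotient_scope.
Variable K : fieldType.

Lemma mulmx_col2 (M : 'M[K]_2) (v : 'cV[K]_2) j :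
  (M *m v) j 0 = M j 0 * v 0 0 + M j 1 * v 1 0.
Proof.
rewrite mxE big_ord_recl big_ord1; congr (_ * _ + _ * _); congr (_ _ _);
  exact: val_inj.
Qed.

Lemma ord2_cases (j : 'I_2) : j = 0 \/ j = 1.
Proof. by case: j => [[|[|]]] // p; [left|right]; apply: val_inj. Qed.

Lemma cV2_eq (u v : 'cV[K]_2) : u 0 0 = v 0 0 -> u 1 0 = v 1 0 -> u = v.
Proof.
by move=> e0 e1; apply/matrixP => j k; rewrite ord1; case: (ord2_cases j) => ->.
Qed.

Lemma projective_eq (u v : nonzero_vector K) k : k != 0 ->
  (u : 'cV_2) 0 0 = k * (v : 'cV_2) 0 0 -> (u : 'cV_2) 1 0 = k * (v : 'cV_2) 1 0 ->
  \pi_(projective_line K) u = \pi_(projective_line K) v.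
Proof.
move=> k0 e0 e1; apply/eqP; rewrite eqmodE; apply/asboolP; exists k; split=> //.
by apply: cV2_eq; rewrite mxE.
Qed.

Lemma projective_point_cases (l : projective_line K) :
  l = infinite_point K \/ exists x, l = finite_point x.
Proof.
elim/quotW: l => v; have [v1|v1] := eqVneq ((v : 'cV_2) 1 0) 0; [left|right].
  have v0 : (v : 'cV_2) 0 0 != 0.
    apply: contraNneq (vector_valP v) => v0; apply/eqP.
    by apply: cV2_eq; rewrite mxE.
  by apply: (projective_eq v0); rewrite !mxE /= ?mulr1 ?mulr0.
exists ((v : 'cV_2) 0 0 / (v : 'cV_2) 1 0).
apply: (projective_eq v1); rewrite !mxE /= ?mulr1 //.
by rewrite mulrCA mulfV // mulr1.
Qed.

Lemma finite_point_inj : injective (@finite_point K).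
Proof.
move=> x y /eqP; rewrite eqmodE => /asboolP[k [_ /matrixP e]].
have := e 1 0; rewrite !mxE /= mulr1 => k1.
by have := e 0 0; rewrite !mxE /= -k1 mul1r.
Qed.

Lemma finite_point_neq x : finite_point x <> infinite_point K.
Proof.
move=> /eqP; rewrite eqmodE => /asboolP[k [_ /matrixP /(_ 1 0)]].
by rewrite !mxE /= mulr0 => /eqP; rewrite oner_eq0.
Qed.

Lemma PGL2_act_finite (M : GL2 K) x : val M 1 0 * x + val M 1 1 != 0 ->
  PGL2_act (\pi_(PGL2 K) M) (finite_point x) =
  finite_point ((val M 0 0 * x + val M 0 1) / (val M 1 0 * x + val M 1 1)).
Proof.
move=> k0; rewrite PGL2_actE; apply: (projective_eq k0);
  rewrite mulmx_col2 !mxE /= !mulr1 //.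
by rewrite mulrCA mulfV // mulr1.
Qed.

Lemma det_mx22 (M : 'M[K]_2) : \det M = M 0 0 * M 1 1 - M 0 1 * M 1 0.
Proof.
rewrite (expand_det_row _ 0) big_ord_recl big_ord1 /cofactor !det_mx11 !mxE /=.
have -> : lift 0 (0 : 'I_1) = 1 :> 'I_2 by apply: val_inj.
have -> : lift 1 (0 : 'I_1) = 0 :> 'I_2 by apply: val_inj.
by rewrite expr0 expr1 mul1r mulN1r mulrN.
Qed.

Lemma GL2_nondegenerate (M : GL2 K) :
  val M 0 0 * val M 1 1 - val M 0 1 * val M 1 0 != 0.
Proof.
by have := GL2_valP M; rewrite unitmxE det_mx22 unitfE.
Qed.

Lemma PGL2_act_finite_infinite (M : GL2 K) x : val M 1 0 * x + val M 1 1 = 0 ->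
  PGL2_act (\pi_(PGL2 K) M) (finite_point x) = infinite_point K.
Proof.
move=> k0; rewrite PGL2_actE.
have k1 : val M 0 0 * x + val M 0 1 != 0.
  apply: contraNneq (GL2_nondegenerate M) => k1.
  have -> : val M 0 1 = - (val M 0 0 * x) by apply/eqP; rewrite -addr_eq0 addrC k1.
  have -> : val M 1 1 = - (val M 1 0 * x) by apply/eqP; rewrite -addr_eq0 addrC k0.
  by apply/eqP; ring.
by apply: (projective_eq k1); rewrite mulmx_col2 !mxE /= !mulr1 ?mulr0.
Qed.

Lemma PGL2_act_infinite (M : GL2 K) : val M 1 0 != 0 ->
  PGL2_act (\pi_(PGL2 K) M) (infinite_point K) =
  finite_point (val M 0 0 / val M 1 0).
Proof.
move=> k0; rewrite PGL2_actE; apply: (projective_eq k0);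
  rewrite mulmx_col2 !mxE /= !mulr1 ?mulr0 ?addr0 //.
by rewrite mulrCA mulfV // mulr1.
Qed.

Lemma PGL2_act_infinite_infinite (M : GL2 K) : val M 1 0 = 0 ->
  PGL2_act (\pi_(PGL2 K) M) (infinite_point K) = infinite_point K.
Proof.
move=> k0; rewrite PGL2_actE.
have k1 : val M 0 0 != 0.
  by apply: contraNneq (GL2_nondegenerate M) => k1; rewrite k1 k0 mul0r mulr0 subrr.
by apply: (projective_eq k1); rewrite mulmx_col2 !mxE /= ?k0 ?mul0r ?mulr1 ?mulr0 ?addr0.
Qed.

Lemma PGL2_actM (p q : PGL2 K) l : PGL2_act (p * q)%g l = PGL2_act p (PGL2_act q l).
Proof.
elim/quotW: p => M; elim/quotW: q => N; elim/quotW: l => v.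
rewrite [X in PGL2_act X _](PGL2_mulE M N) (PGL2_actE N v).
rewrite (PGL2_actE M (GL2_act N v)) (PGL2_actE (M * N)%g v); congr (\pi _); apply: val_inj.
exact: esym (mulmxA _ _ _).
Qed.

Lemma PGL2_act1 l : PGL2_act (1%g : PGL2 K) l = l.
Proof.
elim/quotW: l => v; rewrite [LHS](PGL2_actE 1%g); congr (\pi _).
by apply: val_inj; rewrite /= mul1mx.
Qed.

(** For an element acting trivially, the images of infinity, 0 and 1 force its matrix to be
    scalar. *)
Lemma PGL2_faithful (p q : PGL2 K) :
  (forall l, PGL2_act p l = PGL2_act q l) -> p = q.
Proof.
move=> pq; suff r1 : (q^-1 * p)%g = 1%g by rewrite -[LHS]mul1g -(mulgV q) -mulgA r1 mulg1.
have : forall l, PGL2_act (q^-1 * p)%g l = l.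
  by move=> l; rewrite PGL2_actM pq -PGL2_actM mulVg PGL2_act1.
move: (q^-1 * p)%g; elim/quotW => M ML.
have c0 : val M 1 0 = 0.
  have := ML (infinite_point K); have [//|c0] := eqVneq (val M 1 0) 0.
  by rewrite PGL2_act_infinite // => /finite_point_neq.
have d0 : val M 1 1 != 0.
  by apply: contraNneq (GL2_nondegenerate M) => d0; rewrite d0 c0 !mulr0 subrr.
have Mx x : (val M 0 0 * x + val M 0 1) / val M 1 1 = x.
  have := ML (finite_point x); rewrite PGL2_act_finite c0 mul0r add0r //.
  by move/finite_point_inj.
have b0 : val M 0 1 = 0.
  by have /eqP := Mx 0; rewrite mulr0 add0r mulf_eq0 invr_eq0 (negbTE d0) orbF => /eqP.
have ad : val M 0 0 = val M 1 1.
  by have := Mx 1; rewrite mulr1 b0 addr0 => /(congr1 ( *%R^~ (val M 1 1))); rewrite divfK // mul1r.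
apply/eqP/PGL2_eqP; exists (val M 1 1); split=> //=; apply/matrixP => j k.
rewrite !mxE; case: (ord2_cases j) => ->; case: (ord2_cases k) => ->;
  by rewrite ?ad ?b0 ?c0 /= ?mulr1 ?mulr0.
Qed.

Definition mx22 (a b c d : K) : 'M[K]_2 :=
  \matrix_(j, k) if j == 0 then (if k == 0 then a else b) else if k == 0 then c else d.

Lemma mx22_unit a b c d : a * d - b * c != 0 -> mx22 a b c d \in unitmx.
Proof. by move=> D; rewrite unitmxE det_mx22 !mxE /= unitfE. Qed.

End ProjectiveLine.

(** * The rank is at most 3 *)

Section RankBound.
Import GRing.Theory.
Local Open Scope ring_scope.
Variables (T : choiceType) (c : seq T -> T -> Prop) (Sigma S : set (T -> T)).
Variable n : nat.
Hypothesis (Pc : seq_pregeometry c) (Hom : seq_homogeneous c Sigma).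
Hypothesis (Act : n_perm_action c Sigma S n).
Hypothesis (UG : seq_unique_generics c Sigma S n).
Hypothesis (AS : abelian_generic_stabilizers c Sigma S n).

Lemma coordinates_infinite B o i (K : fieldType) (f : K -> T) (s : seq K) :
  coordinates c Sigma S B o i f -> exists x, x \notin s.
Proof.
move=> C; have [p np] := sp_infinite Pc (map f s ++ B).
have [|x xp] := (co_range C p).1 _.
  by apply: contra_not np; apply: (sp_sub Pc); submem.
exists x; apply: contra_notN np => xs; rewrite -xp.
by apply: (sp_in Pc); rewrite mem_cat map_f.
Qed.

(* If n > 3, the element exchanging two points of [B] and fixing the others
   induces a field automorphism, which must be the inversion. *)
Lemma rank_le3 : (n <= 3)%N.
Proof.
rewrite leqNgt; apply/negP => n4.
have [z sz iz] := ind_extend Pc [::] n.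
have uz := ind_uniq Pc iz.
have [o [i [a [b [B1 zE]]]]] : exists o i a b B1, z = [:: o, i, a, b & B1].
  by move: sz n4; case: (z) => [|o [|i [|a [|b B1]]]] <- //; exists o, i, a, b, B1.
pose B := [:: a, b & B1].
have sB : (size B).+2 = n by rewrite -sz zE.
have iB : ind c [::] (B ++ [:: o; i]).
  by apply: (ind_perm Pc) iz; rewrite zE /B; permeq.
have [K [f C]] := coordinatization Pc Hom Act UG AS sB iB.
have [u Su] : exists2 u, S u & map u z = [:: o, i, b, a & B1].
  apply: (npa_transitive Pc Act) => //.
  by apply: (ind_perm Pc) iz; rewrite zE; permeq.
rewrite zE /= => -[uo ui ua ub uB1].
have uB1' : {in B1, u =1 id} by apply/eq_in_map; rewrite uB1 map_id.
have uB : {in B, forall x, u x \in B /\ u (u x) = x}.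
  move=> x; rewrite !inE => /or3P[/eqP->|/eqP->|xB].
  - by rewrite ua ub eqxx orbT.
  - by rewrite ub ua eqxx.
  - by rewrite !(uB1' x) // xB !orbT.
have uinv x : x != 0 -> u (f x) = f x^-1.
  apply: (co_inverse C Su _ ui).
  - exists a; rewrite ua => ba; move: uz.
    by rewrite zE -ba /= !inE eqxx /= !andbF.
  - move=> y; rewrite inE => /orP[/eqP->|/uB[uy _]]; first by rewrite uo mem_head.
    by rewrite inE uy orbT.
  - by move=> y; rewrite inE => /orP[/eqP->|/uB[]//]; rewrite !uo.
have uu x : u (u (f x)) = f x.
  have [->|x0] := eqVneq x 0; first by rewrite (co_0 C) !uo.
  by rewrite uinv // uinv ?invrK // invr_neq0.
have u0 : u (f 0) = f 0 by rewrite (co_0 C).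
have uf x : exists y, u (f x) = f y.
  by have [->|x0] := eqVneq x 0; [exists 0|exists x^-1; apply: uinv].
have [g [Sg gB gE]] := co_perm C 1 (oner_neq0 K).
(* The conjugate by [u] of the translation by 1 is an affine map without fixed point sending 0 to 1,
   hence that translation itself. *)
have Sh : S (u \o g \o u).
  by apply: (pg_comp (npa_group Act) Su (pg_comp (npa_group Act) Sg Su)).
have [x xB|al [be [al0 hE]]] := co_affine C Sh.
  by have [ux uux] := uB x xB; rewrite /= gB.
have al1 : al = 1.
  apply: contraTeq isT => al1; have s0 : 1 - al != 0 by rewrite subr_eq0 eq_sym.
  have := hE (be / (1 - al)); have -> : al * (be / (1 - al)) + be = be / (1 - al).
    by field.
  have [y yE] := uf (be / (1 - al)); rewrite /= yE gE => /(congr1 u).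
  have [y' y'E] := uf (1 * y + 1); rewrite y'E -y'E uu yE => /(co_inj C) /eqP.
  by rewrite mul1r -subr_eq0 addrC addKr oner_eq0.
have be1 : be = 1.
  apply: (co_inj C); have := hE 0; rewrite mulr0 add0r => <- /=.
  by rewrite u0 gE mulr0 add0r uinv ?oner_neq0 // invr1.
(* At [x^-1] the two expressions of the conjugate read [1 / (x + 1) = 1 / x + 1]. *)
have key (x : K) : x != 0 -> x + 1 != 0 -> x ^+ 2 + x + 1 = 0.
  move=> x0 x1; have := hE x^-1; rewrite al1 be1 mul1r /= uinv ?invr_neq0 //.
  rewrite invrK gE mul1r uinv // => /(co_inj C) e.
  have e' : x = (x + 1) ^+ 2 by rewrite -[LHS](mulfK x1) e; field.
  have -> : x ^+ 2 + x + 1 = (x + 1) ^+ 2 - x by ring.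
  by rewrite -e' subrr.
(* The roots of the quadratic are [x] and [-1 - x]; [y] avoids both. *)
have [x xn] := coordinates_infinite [:: 0; -1] C.
have [y yn] := coordinates_infinite [:: 0; -1; x; -1 - x] C.
move: xn yn; rewrite !inE !negb_or => /andP[x0 x1] /and4P[y0 y1 yx yx1].
have ex : x ^+ 2 + x + 1 = 0 by apply: key => //; rewrite addr_eq0.
have ey : y ^+ 2 + y + 1 = 0 by apply: key => //; rewrite addr_eq0.
have : (y - x) * (y - (- 1 - x)) = 0.
  by rewrite -[RHS](subrr 0) -{1}ey -ex; ring.
by move=> /eqP; rewrite mulf_eq0 !subr_eq0 (negbTE yx) (negbTE yx1).
Qed.

End RankBound.

(** * Hereditarily unique generics *)

Definition has_non_classical_subgroup (G : groupType) (P : Type)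
    (Sigma : set ((G -> G) * (P -> P))) :=
  exists (A : set P) (H : set G),
    [/\ finite_set A, subgroup H, ~ bounded [set: P] H, non_classical H
      & invariant_subgroup Sigma A H].

Lemma card_le_setD_finite (T : Type) (A F : set T) :
  infinite_set A -> finite_set F -> (A #<= A `\` F)%card.
Proof.
move=> iA /(@finite_seqP {classic T})[s ->]; elim: s => [|x s IH].
  by rewrite set_nil setD0.
have -> : A `\` [set` x :: s] = (A `\` [set` s]) `\ x.
  apply/seteqP; split=> [y [Ay /= ys]|y [[Ay /= ys] yx]]; split=> //=.
  - by split=> // yns; apply: ys; rewrite inE yns orbT.
  - by move=> yx; apply: ys; rewrite yx mem_head.
  - by rewrite inE => /orP[/eqP|].
apply: (card_le_trans IH); apply: card_le_setD1.
by move=> fD; apply: iA; apply: card_le_finite IH fD.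
Qed.

Lemma not_bounded_card_le (T U : Type) (D : set T) (H : set U) :
  (D #<= H)%card -> ~ bounded D H.
Proof.
move=> DH /andP[HD /negP]; apply; apply/card_eqPle; split=> //.
Qed.

Section Hereditary.
Variables (n : nat) (G : groupType) (P : Type).
Variables (cl : set P -> set P) (act : G -> P -> P).
Variable Sigma : set ((G -> G) * (P -> P)).
Hypothesis NA : n_action act [set: G] [set: P] cl n.
Hypothesis Hom : homogeneous act [set: G] [set: P] cl Sigma.

Let T : choiceType := {classic P}.
Let v : T -> P := id.
Let PA : pregeometric_action act [set: G] [set: P] cl. Proof. by case: NA. Qed.
Let IP := pact_pregeometry PA.
Let Pcl : pregeometry [set: P] cl. Proof. by case: IP. Qed.
Let c := seqcl v cl.
Let S := induced v act [set: G].
Let Sg := induced_aut v Sigma.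

Lemma full_inj : injective v. Proof. by []. Qed.
Lemma full_range (p : P) : [set: P] p <-> exists t, v t = p.
Proof. by split=> // _; exists p. Qed.

Lemma full_pregeometry : seq_pregeometry c.
Proof. exact: transfer_pregeometry full_range IP. Qed.
Lemma full_homogeneous : seq_homogeneous c Sg.
Proof. exact: (transfer_homogeneous full_inj full_range Hom). Qed.
Lemma full_action : n_perm_action c Sg S n.
Proof. exact: (transfer_action full_inj full_range PA Hom NA). Qed.

Let Pc := full_pregeometry.

Lemma faithful (g h : G) : (forall x, act g x = act h x) -> g = h.
Proof.
have [_ _ det] := NA; move=> gh; have [s ss is_] := ind_extend Pc [::] n.+1.
apply: (det g h (v @` [set` s])) => //.
by rewrite -ss; apply: (ind_dim full_inj full_range IP Pc).
Qed.

(** Finitely many basis elements support [s], and all others lie outside its closure. This makes the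
    subgroups attached to finite sets unbounded. *)
Lemma card_le_closure_complement (s : seq T) :
  ([set: P] #<= ~` cl (v @` [set` s]))%card.
Proof.
have [_ _ ndim [B [bB BP]]] := IP; have [_ iB PB] := bB.
have infB : infinite_set B by move=> [k Bk]; apply: (ndim k); exists B.
have [||F [fF FB sF]] := @finite_support P T v [set: P] cl IP B s; first by [].
  by move=> p _; have := PB p I; rewrite set0U.
rewrite -(card_le_eql BP); apply: card_le_trans (card_le_setD_finite infB fF) _.
apply: subset_card_le => b [Bb nFb] cb; apply: (iB b Bb); rewrite set0U.
have bF : cl F b.
  rewrite -(cl_idempotent Pcl (subsetT F)).
  by apply: (cl_monotone Pcl) cb.
apply: (cl_monotone Pcl) bF => // q Fq; split; first exact: FB.
by move=> qb; apply: nFb; rewrite -qb.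
Qed.

(** With [k = n - 1] the subgroup [N] has rank one on the localisation, so a nonabelian [N] would be
    non-classical. Its invariance is part of the homogeneity of its action. *)
Lemma hereditary_abelian : hereditarily_unique_generics act cl Sigma n ->
  ~ has_non_classical_subgroup Sigma -> abelian_generic_stabilizers c Sg S n.
Proof.
move=> [_ HU] nnc u su iu; pose A := v @` [set` u].
have kn : (size u < n)%N by rewrite -su.
have [|N [nN nA hN uN]] := HU (size u) A kn (ind_independent full_range IP Pc iu).
  exact: (card_seqcl_image full_inj (ind_uniq Pc iu)).
have nk : (n - size u = 1)%N by rewrite -su subSnn.
rewrite nk in nA uN; have [sN NA_ _] := nN.
pose T2 := {x : T | `[< ~ cl A x >]}; pose w (x : T2) : P := val x.
have w_inj : injective w by exact: val_inj.
have w_range p : (~` cl A) p <-> exists t, w t = p.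
  split=> [np|[t <-]]; last exact/asboolP/(valP t).
  by exists (exist _ (p : T) (asboolT np)).
have Nab : abelian_set N.
  apply: contrapT => nab; apply: nnc; exists A, N; split=> //.
  - exact/finite_image/finite_seq.
  - apply: not_bounded_card_le; apply: card_le_trans (card_le_closure_complement u) _.
    exact: (rank_one_card_ge w_inj w_range nA hN).
  - exact: (rank_one_non_classical w_inj w_range nA hN uN).
  - move=> s Fs; have [AG _] := hN.
    have [[sNN _ sN'] _] := aaut_group (agroup_aut AG Fs).
    by apply/seteqP; split=> [_ [g Ng <-]|g Ng]; [apply: sNN|apply: sN'].
exists [set f : T -> T | exists2 g, N g & forall x, f x = act g x]; split.
- move=> f [g Ng fE]; split; first by exists g.
  by move=> x xu; rewrite fE; apply: (NA_ g Ng); exists x.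
- move=> f f' [g Ng fE] [g' Ng' fE'] x /=.
  by rewrite !fE !fE' -!(pact_mul PA) // Nab.
- move=> a b na nb.
  have [[a' a'E] [b' b'E]] := ((w_range a).1 na, (w_range b).1 nb).
  have [g Ng gE] := rank_one_transitive w_inj w_range nA hN a' b'.
  by exists (act g); [exists g|rewrite -b'E -gE a'E].
- move=> sg f [s Ss sgE] sgu [g Ng fE].
  have Fs : fixer Sigma A s.
    by split=> // _ [x xu <-]; rewrite -sgE; congr v; apply: sgu.
  have [AG _] := hN; have [[sNN _ _] _] := aaut_group (agroup_aut AG Fs).
  have [AG' _] := Hom; have As := agroup_aut AG' Ss.
  exists (act (s.1 g)); first by exists (s.1 g) => //; apply: sNN.
  move=> x /=; have /= e := sgE (f x); have /= e' := sgE x.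
  by rewrite /v /= in e e'; rewrite e e' fE (aaut_act As).
Qed.

Lemma full_unique_generics :
  unique_generics act [set: G] [set: P] cl Sigma n -> seq_unique_generics c Sg S n.
Proof. exact: (transfer_unique_generics full_inj full_range PA Hom). Qed.

End Hereditary.

(** * The three cases *)

(** Elements with the same value at [x] agree at [k x] for every [k] commuting with them, that is,
    everywhere by transitivity. *)
Lemma rank_one_regular (G : groupType) (P : Type) (cl : set P -> set P)
    (act : G -> P -> P) (Sigma : set ((G -> G) * (P -> P))) :
  n_action act [set: G] [set: P] cl 1 ->
  homogeneous act [set: G] [set: P] cl Sigma ->
  unique_generics act [set: G] [set: P] cl Sigma 1 ->
  ~ has_non_classical_subgroup Sigma ->
  abelian_set [set: G] /\ regular act.
Proof.
move=> NA Hom UG nnc; have [PA _ _] := NA.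
pose T : choiceType := {classic P}; pose v : T -> P := id.
have vi : injective v by [].
have vr p : [set: P] p <-> exists t, v t = p by split=> // _; exists p.
have ab : abelian_set [set: G].
  apply: contrapT => nab; apply: nnc; exists set0, [set: G]; split.
  - exact: finite_set0.
  - exact: pact_subgroup PA.
  - exact: not_bounded_card_le (rank_one_card_ge vi vr NA Hom).
  - exact: (rank_one_non_classical vi vr NA Hom UG).
  - move=> s [Ss _]; have [AG _] := Hom.
    have [[_ _ sG] _] := aaut_group (agroup_aut AG Ss).
    by apply/seteqP; split=> // g Gg; apply: sG.
split=> // x y; have [g _ gx] := rank_one_transitive vi vr NA Hom x y.
exists g; split=> // h hx; apply: (faithful NA) => z.
have [k _ kz] := rank_one_transitive vi vr NA Hom x z.
rewrite /v in gx kz; rewrite -kz -!(pact_mul PA) // (ab g k) // (ab h k) //.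
by rewrite !(pact_mul PA) // gx hx.
Qed.

Lemma inj_surj_bijective (T U : Type) (f : T -> U) :
  injective f -> (forall y, exists x, f x = y) -> bijective f.
Proof.
move=> fi fs; have [g gK] := @choice U T (fun y x => f x = y) fs.
by exists g => [x|//]; apply: fi.
Qed.

Section Coordinatized.
Import GRing.Theory.
Local Open Scope ring_scope.
Variables (n : nat) (G : groupType) (P : Type).
Variables (cl : set P -> set P) (act : G -> P -> P).
Variable Sigma : set ((G -> G) * (P -> P)).
Hypothesis NA : n_action act [set: G] [set: P] cl n.
Hypothesis Hom : homogeneous act [set: G] [set: P] cl Sigma.

Let T : choiceType := {classic P}.
Let v : T -> P := id.
Let PA : pregeometric_action act [set: G] [set: P] cl. Proof. by case: NA. Qed.
Let c := seqcl v cl.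
Let S := induced v act [set: G].
Let Sg := induced_aut v Sigma.

Variables (B : seq T) (o i : T) (K : fieldType) (f : K -> T).
Hypothesis C : coordinates c Sg S B o i f.

Lemma coordinates_invariant :
  invariant_field_structure (G := G) Sigma [set` [:: o, i & B]] (range f) f.
Proof.
have HcS := full_homogeneous Hom.
have imS sg : Sg sg -> {in [:: o, i & B], sg =1 id} -> forall x, exists y, sg (f x) = f y.
  move=> Ss e x; have [sg' [Ss' sgK _]] := pg_inv (sh_group HcS) Ss.
  have [|y yE] := (co_range C (sg (f x))).1 _; last by exists y.
  have nx : ~ c B (f x) by apply/(co_range C); exists x.
  move=> /(sh_cl HcS Ss'); rewrite sgK map_id_in // => y yB.
  by rewrite -[RHS]sgK e // !inE yB !orbT.
split; first split.
- by move=> x _; exists x.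
- by move=> x y _ _; apply: (co_inj C).
- by move=> _ [x _ <-]; exists x.
move=> s [Ss sA] /=; pose sg : T -> T := s.2.
have Ssg : Sg sg by exists s.
have sge : {in [:: o, i & B], sg =1 id} by move=> x xA; apply: sA.
have [sg' [Ssg' sgK sgK']] := pg_inv (sh_group HcS) Ssg.
have sge' : {in [:: o, i & B], sg' =1 id}.
  by move=> x xA; rewrite -[RHS]sgK sge.
have im := imS sg Ssg sge.
have pre y : exists x, sg (f x) = f y.
  by have [x xE] := imS sg' Ssg' sge' y; exists x; rewrite -xE; apply: sgK'.
split.
- apply/seteqP; split=> [_ [_ [x _ <-] <-]|_ [y _ <-]].
    by have [y yE] := im x; exists y.
  by have [x xE] := pre y; exists (f x); [exists x|].
- apply/seteqP; split=> [_ [_ [[x y] _ <-] <-]|_ [[x' y'] _ <-]] /=.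
    have [[x' ex] [y' ey]] := (im x, im y); exists (x', y') => //=.
    by have [e _] := co_Sigma C Ssg sge ex ey; rewrite /sg in ex ey e; rewrite ex ey e.
  have [[x ex] [y ey]] := (pre x', pre y'); exists (f x, f y, f (x + y)).
    by exists (x, y).
  by have [e _] := co_Sigma C Ssg sge ex ey; rewrite /sg in ex ey e; rewrite /= ex ey e.
- apply/seteqP; split=> [_ [_ [[x y] _ <-] <-]|_ [[x' y'] _ <-]] /=.
    have [[x' ex] [y' ey]] := (im x, im y); exists (x', y') => //=.
    by have [_ e] := co_Sigma C Ssg sge ex ey; rewrite /sg in ex ey e; rewrite ex ey e.
  have [[x ex] [y ey]] := (pre x', pre y'); exists (f x, f y, f (x * y)).
    by exists (x, y).
  by have [_ e] := co_Sigma C Ssg sge ex ey; rewrite /sg in ex ey e; rewrite /= ex ey e.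
Qed.

Lemma coordinates_group_affine (g : G) : {in B, act g =1 id} ->
  exists a b, a != 0 /\ forall x, act g (f x) = f (a * x + b).
Proof. by apply: (co_affine C); exists g. Qed.

Lemma coordinates_group_perm (a b : K) : a != 0 ->
  exists g : G, {in B, act g =1 id} /\ forall x, act g (f x) = f (a * x + b).
Proof.
move=> a0; have [h [[g _ gE] hB hE]] := co_perm C b a0; exists g.
by split=> [x xB|x]; rewrite -?[LHS]gE; [apply: hB|apply: hE].
Qed.

Lemma affine_action_isomorphism : B = [::] -> bijective f /\
  exists phi : affine_group K -> G,
    action_isomorphism (@affine_act K) act phi (f : K -> P).
Proof.
move=> B0; have fs p : exists x, f x = p.
  apply/(co_range C); rewrite B0; apply: (sp_nil (full_pregeometry NA)).
have fb : bijective f by apply: inj_surj_bijective => //; exact: co_inj C.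
split=> //.
have ex (u : affine_group K) : exists g, forall x, act g (f x) = f (u.1 * x + u.2).
  by have [g [_ gE]] := coordinates_group_perm u.2 (affine_valP u); exists g.
have [phi phiE] := choice ex.
have eqG g h : (forall x, act g (f x) = act h (f x)) -> g = h.
  by move=> gh; apply: (faithful NA) => p; have [x <-] := fs p.
exists phi; split=> //.
- apply: inj_surj_bijective => [u w uw|g].
    have e x : u.1 * x + u.2 = w.1 * x + w.2.
      by apply: (co_inj C); rewrite -!phiE uw.
    have e2 : u.2 = w.2 by have := e 0; rewrite !mulr0 !add0r.
    have e1 : u.1 = w.1 by have := e 1; rewrite !mulr1 e2 => /addIr.
    by apply: val_inj; rewrite /= [LHS]surjective_pairing [RHS]surjective_pairing e1 e2.
  have [|a [b [a0 gE]]] := @coordinates_group_affine g; first by rewrite B0.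
  exists (@AffineGroup K (a, b) a0); apply: eqG => x.
  by rewrite phiE gE.
- move=> u w; apply: eqG => x; rewrite (pact_mul PA) // !phiE /=.
  by congr f; ring.
Qed.

Local Open Scope quotient_scope.

(* [(a x + b) / (k x + d) = p / (k x + d) + a / k] with [p = b - a d / k] *)
Lemma projective_action_isomorphism (w : G) (infty : P) : B = [:: infty] ->
  cl [set infty] = [set infty] -> act w infty = o -> act w o = infty ->
  (forall x, x != 0 -> act w (f x) = f x^-1) ->
  exists theta : projective_line K -> P,
    [/\ theta (infinite_point K) = infty, theta \o @finite_point K = f
      & exists phi : PGL2 K -> G, action_isomorphism (@PGL2_act K) act phi theta].
Proof.
move=> BE cli wi wo wf.
have cB p : c B p <-> p = infty.
  by rewrite /c /seqcl BE image_set_cons image_set_nil set0U /v cli.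
have fneq x : f x <> infty by move=> /cB; apply/(co_range C); exists x.
have fex p : p <> infty -> exists x, f x = p by move=> np; apply/(co_range C)/cB.
have [theta thetaP] : {theta : projective_line K -> P & forall l,
    (l = infinite_point K -> theta l = infty) /\
    forall x, l = finite_point x -> theta l = f x}.
  apply: (@choice _ _ (fun l p => (l = infinite_point K -> p = infty) /\
    forall x, l = finite_point x -> p = f x)) => l.
  have [->|[x ->]] := projective_point_cases l.
    by exists infty; split=> // x e; have := @finite_point_neq K x; rewrite -e.
  exists (f x); split=> [/finite_point_neq //|y].
  by move=> /finite_point_inj ->.
have th_inf : theta (infinite_point K) = infty by apply: (thetaP _).1.
have th_fin x : theta (finite_point x) = f x by apply: (thetaP _).2.
have eqG g h : (forall l, act g (theta l) = act h (theta l)) -> g = h.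
  move=> gh; apply: (faithful NA) => p.
  have [->|/fex[x <-]] := pselect (p = infty); first by rewrite -th_inf.
  by rewrite -th_fin.
have aff (a b : K) : a != 0 -> exists g : G, act g infty = infty /\
    forall x, act g (f x) = f (a * x + b).
  move=> a0; have [g [gB gE]] := coordinates_group_perm b a0; exists g; split=> //.
  by apply: gB; rewrite BE mem_head.
have good (M : GL2 K) : exists g, forall l,
    theta (PGL2_act (\pi_(PGL2 K) M) l) = act g (theta l).
  have D := GL2_nondegenerate M.
  set a := val M 0 0; set b := val M 0 1; set k := val M 1 0; set d := val M 1 1.
  rewrite -/a -/b -/k -/d in D.
  have [k0|k0] := eqVneq k 0.
    have [a0 d0] : a != 0 /\ d != 0.
      by move: D; rewrite k0 mulr0 subr0 mulf_eq0 negb_or => /andP.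
    have [g [gi gf]] := aff (a / d) (b / d) (mulf_neq0 a0 (invr_neq0 d0)).
    exists g => l; have [->|[x ->]] := projective_point_cases l.
      by rewrite PGL2_act_infinite_infinite // th_inf gi.
    rewrite PGL2_act_finite -/a -/b -/k -/d k0 mul0r add0r // !th_fin gf.
    by congr f; field.
  have p0 : b - a * d / k != 0.
    apply: contraNneq D => e; have -> : a * d - b * k = - k * (b - a * d / k) by field.
    by rewrite e mulr0.
  have [g [gi gf]] := aff _ (a / k) p0; have [h [hi hf]] := aff _ d k0.
  exists (g * (w * h))%g => l; rewrite !(pact_mul PA) //.
  have [->|[x ->]] := projective_point_cases l.
    rewrite PGL2_act_infinite // th_fin th_inf hi wi -(co_0 C) gf.
    by congr f; rewrite mulr0 add0r.
  rewrite th_fin hf; have [y0|y0] := eqVneq (k * x + d) 0.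
    by rewrite PGL2_act_finite_infinite // th_inf y0 (co_0 C) wo gi.
  rewrite PGL2_act_finite // th_fin wf // gf -/a -/b -/k -/d; congr f; field.
  by rewrite k0 y0.
have goodP (p : PGL2 K) : exists g, forall l, theta (PGL2_act p l) = act g (theta l).
  by elim/quotW: p => M; apply: good.
have [phi phiE] := choice goodP.
have phiM : {morph phi : p q / (p * q)%g}.
  by move=> p q; apply: eqG => l; rewrite -phiE PGL2_actM (pact_mul PA) // -!phiE.
have th_inj : injective theta.
  move=> l l'; have [->|[x ->]] := projective_point_cases l;
    have [->|[y ->]] := projective_point_cases l'; rewrite ?th_inf ?th_fin //.
  - by move=> /esym /fneq.
  - by move=> /fneq.
  - by move=> /(co_inj C) ->.
have afff (g : G) : act g infty = infty -> exists p, phi p = g.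
  move=> gi; have [|a [b [a0 gE]]] := @coordinates_group_affine g.
    by move=> x; rewrite BE inE => /eqP->.
  have u : mx22 a b 0 1 \in unitmx by apply: mx22_unit; rewrite mulr1 mulr0 subr0.
  exists (\pi_(PGL2 K) (MkGL2 u)); apply: eqG => l; rewrite -phiE.
  have [->|[x ->]] := projective_point_cases l.
    by rewrite PGL2_act_infinite_infinite ?mxE // th_inf gi.
  by rewrite PGL2_act_finite !mxE /= ?mul0r ?add0r ?oner_neq0 // divr1 !th_fin gE.
exists theta; split=> //; first exact: funext.
exists phi; split=> //.
- apply: inj_surj_bijective => [p q pq|g].
    by apply: PGL2_faithful => l; apply: th_inj; rewrite !phiE pq.
  have [/afff //|/fex[x xE]] := pselect (act g infty = infty).
  (* A matrix of determinant -1 sending infinity to [x]; it reduces surjectivity to the stabiliser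
     of infinity, which acts affinely. *)
  have u : mx22 x (x + 1) 1 1 \in unitmx.
    by apply: mx22_unit; rewrite !mulr1 opprD addNKr oppr_eq0 oner_neq0.
  pose q : PGL2 K := \pi_(PGL2 K) (MkGL2 u).
  have qi : act (phi q) infty = f x.
    rewrite -th_inf -phiE PGL2_act_infinite !mxE /= ?oner_neq0 //.
    by rewrite divr1 th_fin.
  have [|p pE] := afff ((phi q)^-1 * g)%g.
    by rewrite (pact_mul PA) // -xE -qi -(pact_mul PA) // mulVg (pact_one PA).
  exists (q * p)%g; rewrite phiM pE mulgA mulgV mul1g //.
- apply: inj_surj_bijective => // p.
  have [->|/fex[x <-]] := pselect (p = infty); first by exists (infinite_point K).
  by exists (finite_point x).
Qed.

End Coordinatized.

Theorem theorem3p17 (n : nat) (G : groupType) (P : Type)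
    (cl : set P -> set P) (act : G -> P -> P)
    (Sigma : set ((G -> G) * (P -> P))) :
  (1 <= n)%N ->
  geometry [set: P] cl ->
  n_action act [set: G] [set: P] cl n ->
  homogeneous act [set: G] [set: P] cl Sigma ->
  hereditarily_unique_generics act cl Sigma n ->
  (exists (A : set P) (H : set G),
     [/\ finite_set A, subgroup H, ~ bounded [set: P] H, non_classical H
       & invariant_subgroup Sigma A H]) \/
  [/\ n = 1%N \/ n = 2%N \/ n = 3%N,
      n = 1%N -> abelian_set [set: G] /\ regular act,
      n = 2%N -> exists (A : set P) (K : closedFieldType) (f : K -> P),
        [/\ finite_set A,
            invariant_field_structure Sigma A [set: P] f
          & exists phi : affine_group K -> G,
              action_isomorphism (@affine_act K) act phi f]
    & n = 3%N -> exists (infty : P) (A : set P) (K : closedFieldType)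
          (theta : projective_line K -> P),
        [/\ finite_set A,
            theta (infinite_point K) = infty,
            invariant_field_structure Sigma A (~` [set infty])
              (theta \o @finite_point K)
          & exists phi : PGL2 K -> G,
              action_isomorphism (@PGL2_act K) act phi theta]].
Proof.
move=> n1 [_ geom] NA Hom HU.
have [nc|nnc] := pselect (has_non_classical_subgroup Sigma); [by left|right].
have Pc := full_pregeometry NA; have Hc := full_homogeneous Hom.
have Ac := full_action NA Hom; have UGc := full_unique_generics NA Hom HU.1.
have AS := hereditary_abelian NA Hom HU nnc.
have n3 : (n <= 3)%N by exact: (rank_le3 Pc Hc Ac UGc AS).
split.
- by case: n n1 n3 {NA HU Ac UGc AS} => [|[|[|[|]]]] //; [left|right; left|right; right].
- move=> e; rewrite e in NA HU; have [UG _] := HU.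
  exact: (rank_one_regular NA Hom UG nnc).
- move=> n2; have [[|o [|i [|]]] //] := ind_extend Pc [::] n; rewrite n2 // => _ ioi.
  have sB : (size ([::] : seq {classic P})).+2 = n by rewrite n2.
  have [K [f C]] := coordinatization Pc Hc Ac UGc AS sB ioi.
  have [fb iso] := affine_action_isomorphism NA C erefl.
  exists [set` [:: o; i]], K, f; split=> //; first exact: (@finite_seq {classic P}).
  have <- : range f = [set: P].
    by apply/seteqP; split=> // p _; have [g _ gK] := fb; exists (g p).
  exact: (coordinates_invariant Hom C).
- move=> n3'; have [[|infty [|o [|i [|]]]] //] := ind_extend Pc [::] n; rewrite n3' // => _ ioi.
  have sB : (size [:: infty : {classic P}]).+2 = n by rewrite n3'.
  have [K [f C]] := coordinatization Pc Hc Ac UGc AS sB ioi.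
  have iioi : ind (seqcl (id : {classic P} -> P) cl) [::] [:: o; infty; i].
    by apply: (ind_perm Pc) ioi; permeq.
  (* [w0] exchanges infinity and the origin and fixes 1, so [co_inverse] makes it the inversion. *)
  have [||w0 [w Gw wE] [wi wo w1]] := npa_transitive Pc Ac
    (x := [:: infty; o; i]) (y := [:: o; infty; i]) _ _ ioi iioi; rewrite ?n3' //.
  have io : o <> infty.
    have := ind_uniq Pc ioi; rewrite /= !inE negb_or => /andP[/andP[/eqP oi _] _].
    by move=> e; apply: oi.
  have w0f x : x != 0%R -> w0 (f x) = f (x^-1)%R.
    apply: (co_inverse C).
    - by exists w.
    - by exists infty; rewrite wi.
    - exact: w1.
    - by move=> y; rewrite !inE => /orP[]/eqP->; rewrite ?wi ?wo eqxx ?orbT.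
    - by move=> y; rewrite !inE => /orP[]/eqP->; rewrite ?wi ?wo ?wi.
  (* Because [P] is a geometry, the coordinates cover everything but [infty]. *)
  have cinf : cl [set infty] = [set infty] by exact: geom.
  have [||x x0|theta [thi thf iso]] :=
    projective_action_isomorphism NA C (w := w) (infty := infty) erefl cinf.
  - by rewrite -[RHS]wi wE.
  - by rewrite -[RHS]wo wE.
  - by rewrite -w0f // wE.
  exists infty, [set` [:: o; i; infty]], K, theta; split=> //.
    exact: (@finite_seq {classic P}).
  have <- : range f = ~` [set infty].
    apply/seteqP; split=> [_ [x _ <-] e|p np].
      have : ~ seqcl (id : {classic P} -> P) cl [:: infty] (f x).
        by apply/(co_range C); exists x.
      by apply; rewrite e; apply: (sp_head Pc).
    have [|x xp] := (co_range C p).1 _; last by exists x.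
    by rewrite /seqcl image_set_cons image_set_nil set0U cinf.
  rewrite thf; exact: (coordinates_invariant Hom C).
Qed.
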